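(* (i) We have $\mathcal G\circ\mathcal F=c_{\underline t,q}\,\mathrm{Id}_{\mathcal A}$ and $\mathcal F\circ\mathcal G=c_{\underline t,q}\,\mathrm{Id}_F$, with the constant $c_{\underline t,q}=w(\gamma_0^{-1};\underline{\tilde t};q)\,\langle1,1\rangle_{\underline t,q}$. (ii) For all $\gamma\in\sigma$, $$\frac{\langle E_\gamma,E'_{\gamma^{-1}}\rangle_{\underline t,q}}{\langle1,1\rangle_{\underline t,q}}=\frac{w(\gamma_0^{-1};\underline{\tilde t};q)}{w(\gamma^{-1};\underline{\tilde t};q)}.$$
   Context: Parameters: $q\in\mathbb C$ with $0<|q|<1$ and a fixed square root $q^{1/2}$; $\underline t=(k_0,k_1,u_0,u_1)$ nonzero complex numbers with $k_0^2,k_1^2,u_1^2\notin\{\pm q^j:j\in\mathbb Z\}$. Set $a=k_1u_1$, $b=-k_1u_1^{-1}$, $c=q^{1/2}k_0u_0$, $d=-q^{1/2}k_0u_0^{-1}$; dual parameters $\underline{\tilde t}=(u_1,k_1,u_0,k_0)$ ($k_0$ and $u_1$ interchanged), $\tilde a=k_0k_1$, $\tilde b=-k_1k_0^{-1}$, $\tilde c=q^{1/2}u_0u_1$, $\tilde d=-q^{1/2}u_1u_0^{-1}$. Assume $ef\notin q^{\mathbb Z}$ for all $e,f\in\{a,b,c,d\}$ and for all $e,f\in\{\tilde a,\tilde b,\tilde c,\tilde d\}$ (including $e=f$). $\mathcal A=\mathbb C[x^{\pm1}]$. On $\mathcal A$ define $(T_1f)(x)=k_1f(x)+k_1^{-1}\frac{(1-k_1u_1x)(1+k_1u_1^{-1}x)}{1-x^2}\bigl(f(x^{-1})-f(x)\bigr)$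 and $(T_0f)(x)=k_0f(x)+k_0^{-1}\frac{(1-q^{1/2}k_0u_0x^{-1})(1+q^{1/2}k_0u_0^{-1}x^{-1})}{1-qx^{-2}}\bigl(f(qx^{-1})-f(x)\bigr)$, $Y=T_1T_0$. Let $\epsilon(m)=1$ for $m\ge0$, $\epsilon(m)=-1$ for $m<0$, $\gamma_m=(k_0k_1)^{\epsilon(m)}q^m$, $\gamma_m'=\gamma_m^{-1}$, $\sigma=\{\gamma_m\}_{m\in\mathbb Z}$, $\sigma'=\{\gamma_m'\}_{m\in\mathbb Z}$. Order the monomials by $1\prec x^{-1}\prec x\prec x^{-2}\prec x^2\prec\cdots$; $P_m$ ($m\in\mathbb Z$) is the unique Laurent polynomial $x^m+$ lower order terms w.r.t. $\preceq$ with $YP_m=\gamma_mP_m$, and $P_m'$ is the polynomial obtained by the same construction with $k_0,k_1,u_0,u_1,q,q^{1/2}$ replaced by their inverses. Put $E_{\gamma_m}=P_m/P_m(k_1^{-1}u_1^{-1})$ and $E'_{\gamma_m'}=P_m'/P_m'(k_1u_1)$ (the denominators are nonzero). $(y;q)_\infty=\prod_{j\ge0}(1-yq^j)$, $(y_1,\dots,y_r;q)_\infty=\prod_i(y_i;q)_\infty$. The bilinear form on $\mathcal A$ is $$\langle f,g\rangle_{\underline t,q}=\frac1{2\pi i}\int_{C}f(x)g(x^{-1})\Delta(x;\underline t;q)\frac{dx}{x},\qquad \Delta(x;\underline t;q)=\frac{(x^2,qx^{-2};q)_\infty}{(ax,bx,cx,dx,qax^{-1},qbx^{-1},cx^{-1},dx^{-1};q)_\infty},$$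 where $C$ is a counterclockwise continuous rectifiable Jordan curve with $aq^k,bq^k,cq^k,dq^k$ ($k\ge0$) (and hence $0$) in its interior and $a^{-1}q^{-k},b^{-1}q^{-k},c^{-1}q^{-k},d^{-1}q^{-k}$ ($k\ge0$) in its exterior. $\Delta(y;\underline{\tilde t};q)$ is the same expression with $a,b,c,d$ replaced by $\tilde a,\tilde b,\tilde c,\tilde d$; it is assumed that it has simple poles at all points of $\sigma'$. Define $w(\gamma;\underline{\tilde t};q)=\mathrm{sgn}(\gamma)\,\mathrm{Res}_{y=\gamma}\bigl(\Delta(y;\underline{\tilde t};q)/y\bigr)$ for $\gamma\in\sigma'$, where $\mathrm{sgn}(\gamma_m')=\epsilon(m)$. $F$ is the space of functions $g:\sigma'\to\mathbb C$ with finite support. $\mathcal F:\mathcal A\to F$ is $(\mathcal Ff)(\gamma)=\langle f,E'_\gamma\rangle_{\underline t,q}$, and $\mathcal G:F\to\mathcal A$ is $\mathcal G(g)(x)=\sum_{\gamma\in\sigma'}g(\gamma)E_{\gamma^{-1}}(x)\,w(\gamma;\underline{\tilde t};q)$. *)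

(* Defs.v *)
From HB Require Import structures.
From mathcomp Require Import all_boot all_order all_algebra.
From mathcomp Require Import all_classical all_reals all_analysis.
From mathcomp Require Import finmap complex.
(* The notations of monalg are incompatible with those of mathcomp-analysis. *)
From mathcomp Require Import -(notations) monalg.

Set Implicit Arguments.
Unset Strict Implicit.
Unset Printing Implicit Defensive.

Import Order.TTheory GRing.Theory Num.Theory numFieldNormedType.Exports.

Local Open Scope classical_set_scope.
Local Open Scope ring_scope.

(* R[i] itself has no topological structure in the library; seen as a
   numClosedFieldType it inherits the one given by its norm. *)
Definition cplx (R : realType) : numClosedFieldType := R[i].

Section ComplexAnalysis.
Variable R : realType.
Local Notation C := (cplx R).

Definition two_pi_i : C := Complex 0 (2 * pi).

(* Curves are functions on the parameter interval [0, 1]; a subdivision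
   0 = p_0 < p_1 < ... < p_n = 1 is given by s = [:: p_1; ...; p_n]. *)
Definition subdiv_pt (s : seq R) (i : nat) : R := nth 0 (0 :: s) i.

Definition rs_sum (f : C -> C) (g : R -> C) (s : seq R) (tau : nat -> R) : C :=
  \sum_(i < size s)
    f (g (tau i)) * (g (subdiv_pt s i.+1) - g (subdiv_pt s i)).

(* l is the Riemann-Stieltjes integral of f(z) dz along g. *)
Definition is_contour_int (f : C -> C) (g : R -> C) (l : C) : Prop :=
  forall e : R, 0 < e -> exists2 d : R, 0 < d &
    forall (s : seq R) (tau : nat -> R), itv_partition 0 1 s ->
      (forall i, (i < size s)%N ->
         subdiv_pt s i.+1 - subdiv_pt s i < d /\
         subdiv_pt s i <= tau i <= subdiv_pt s i.+1) ->
      `|rs_sum f g s tau - l| < (e%:C)%C.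

Definition contour_int (f : C -> C) (g : R -> C) : C :=
  xget 0 [set l | is_contour_int f g l].

Definition rectifiable (g : R -> C) : Prop :=
  exists M : R, forall s : seq R, itv_partition 0 1 s ->
    \sum_(i < size s) `|g (subdiv_pt s i.+1) - g (subdiv_pt s i)| <= (M%:C)%C.

Definition jordan_curve (g : R -> C) : Prop :=
  [/\ {within `[0, 1], continuous g}, g 0 = g 1 &
      {in `[0, 1[ &, injective g}].

Definition curve_trace (g : R -> C) : set C := g @` `[0, 1].

Definition curve_interior (g : R -> C) : set C :=
  [set z | ~ curve_trace g z /\ bounded_set (connected_component (~` curve_trace g) z)].

Definition curve_exterior (g : R -> C) : set C :=
  [set z | ~ curve_trace g z /\ ~ bounded_set (connected_component (~` curve_trace g) z)].

Definition winding_number (g : R -> C) (z : C) : C :=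
  two_pi_i^-1 * contour_int (fun y => (y - z)^-1) g.

Definition counterclockwise (g : R -> C) : Prop :=
  forall z, curve_interior g z -> winding_number g z = 1.

Definition circle (z0 : C) (r : R) (t : R) : C :=
  z0 + (r%:C)%C * Complex (cos (2 * pi * t)) (sin (2 * pi * t)).

(* At an isolated singularity the integral does not depend on r small. *)
Definition residue (f : C -> C) (z0 : C) : C :=
  lim ((fun r : R => two_pi_i^-1 * contour_int f (circle z0 r)) @ 0^'+).

Definition has_simple_pole (f : C -> C) (z0 : C) : Prop :=
  exists h : C -> C,
    [/\ \forall z \near z0, derivable h z 1,
        h z0 != 0 &
        \forall z \near z0^', f z = h z / (z - z0)].

Definition qpinf (q y : C) : C :=
  limn (fun n : nat => \prod_(j < n) (1 - y * q ^+ j) : C).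

Definition qpinfs (q : C) (ys : seq C) : C := \prod_(y <- ys) qpinf q y.

End ComplexAnalysis.

Section Laurent.
Variable R : realType.
Local Notation C := (cplx R).

(* f : laurent stands for the sum over k : int of (mcoeff k f) x^k. *)
Definition laurent := malg int C.

Definition leval (f : laurent) (x : C) : C :=
  \sum_(k <- msupp f) mcoeff k f * x ^ k.

Definition lone : laurent := mkmalgU 0 1.

(* The position of x^m in 1 < x^-1 < x < x^-2 < x^2 < ... *)
Definition mrank (m : int) : nat :=
  match m with Posz n => n.*2 | Negz n => n.*2.+1 end.

Definition monic_at (m : int) (f : laurent) : Prop :=
  mcoeff m f = 1 /\ forall k, (mrank m < mrank k)%N -> mcoeff k f = 0.

End Laurent.

(* qh is the fixed square root of q. *)
Record par (R : realType) := Par {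
  k0 : cplx R; k1 : cplx R; u0 : cplx R; u1 : cplx R; qh : cplx R }.

Definition epsi (m : int) : int := if 0 <= m then 1 else - 1.

Section AskeyWilson.
Variable R : realType.
Local Notation C := (cplx R).
Implicit Types (t : par R) (f g h : laurent R).

Definition qq t : C := qh t ^+ 2.

Definition dual_par t : par R := Par (u1 t) (k1 t) (u0 t) (k0 t) (qh t).

Definition inv_par t : par R :=
  Par (k0 t)^-1 (k1 t)^-1 (u0 t)^-1 (u1 t)^-1 (qh t)^-1.

Definition pa t : C := k1 t * u1 t.
Definition pb t : C := - (k1 t * (u1 t)^-1).
Definition pc t : C := qh t * k0 t * u0 t.
Definition pd t : C := - (qh t * k0 t * (u0 t)^-1).
Definition pabcd t : seq C := [:: pa t; pb t; pc t; pd t].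

(* T1 f and T0 f are the Laurent polynomials whose values are given by the
   defining formulas away from the zeros of the denominators. *)
Definition T1 t f : laurent R :=
  xget 0 [set g | forall x : C, x != 0 -> x ^+ 2 != 1 ->
    leval g x = k1 t * leval f x +
      (k1 t)^-1 *
      ((1 - k1 t * u1 t * x) * (1 + k1 t * (u1 t)^-1 * x) / (1 - x ^+ 2)) *
      (leval f x^-1 - leval f x)].

Definition T0 t f : laurent R :=
  xget 0 [set g | forall x : C, x != 0 -> x ^+ 2 != qq t ->
    leval g x = k0 t * leval f x +
      (k0 t)^-1 *
      ((1 - qh t * k0 t * u0 t * x^-1) * (1 + qh t * k0 t * (u0 t)^-1 * x^-1)
        / (1 - qq t * x ^- 2)) *
      (leval f (qq t * x^-1) - leval f x)].

Definition Yop t f : laurent R := T1 t (T0 t f).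

Definition gam t (m : int) : C := (k0 t * k1 t) ^ epsi m * qq t ^ m.
Definition gam' t (m : int) : C := (gam t m)^-1.
Definition sigma t : set C := range (gam t).
Definition sigma' t : set C := range (gam' t).

Definition Ppol t (m : int) : laurent R :=
  xget 0 [set f | monic_at m f /\ Yop t f = gam t m *: f].
Definition Ppol' t (m : int) : laurent R := Ppol (inv_par t) m.

Definition sigma_index t (y : C) : int := xget 0 [set m | gam t m = y].
Definition sigma'_index t (y : C) : int := xget 0 [set m | gam' t m = y].

Definition Epol t (y : C) : laurent R :=
  let P := Ppol t (sigma_index t y) in
  (leval P ((k1 t)^-1 * (u1 t)^-1))^-1 *: P.

Definition Epol' t (y : C) : laurent R :=
  let P := Ppol' t (sigma'_index t y) in
  (leval P (k1 t * u1 t))^-1 *: P.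

Definition Delta t (x : C) : C :=
  let q := qq t in
  qpinfs q [:: x ^+ 2; q * x ^- 2] /
  qpinfs q [:: pa t * x; pb t * x; pc t * x; pd t * x;
               q * pa t * x^-1; q * pb t * x^-1; pc t * x^-1; pd t * x^-1].

Definition aw_form t (c : R -> C) f h : C :=
  (two_pi_i R)^-1 *
  contour_int (fun x => leval f x * leval h x^-1 * Delta t x / x) c.

Definition admissible_contour t (c : R -> C) : Prop :=
  [/\ jordan_curve c, rectifiable c, counterclockwise c,
      curve_interior c 0 &
      forall e, e \in pabcd t -> forall k : nat,
        curve_interior c (e * qq t ^+ k) /\
        curve_exterior c (e^-1 * qq t ^- k)].

(* w(y; dual parameters; q) for y in sigma'; the sign refers to the
   parametrization of sigma' by the original parameters t. *)
Definition weight t (y : C) : C :=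
  (epsi (sigma'_index t y))%:~R *
  residue (fun z => Delta (dual_par t) z / z) y.

Definition fin_supp t (g : sigma' t -> C) : Prop :=
  finite_set [set y | g y != 0].

Definition fourier t (c : R -> C) f : sigma' t -> C :=
  fun y => aw_form t c f (Epol' t (set_val y)).

Definition inv_fourier t (g : sigma' t -> C) : laurent R :=
  \sum_(y \in [set: sigma' t])
    (g y * weight t (set_val y)) *: Epol t (set_val y)^-1.

(* x is not of the form q^j, j in Z *)
Definition not_qpow t (x : C) : Prop := forall j : int, x != qq t ^ j.

Definition generic_par t : Prop :=
  [/\ [/\ k0 t != 0, k1 t != 0, u0 t != 0 & u1 t != 0],
      0 < `|qq t| < 1,
      forall z, z \in [:: k0 t ^+ 2; k1 t ^+ 2; u1 t ^+ 2] ->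
        not_qpow t z /\ not_qpow t (- z),
      forall e e', e \in pabcd t -> e' \in pabcd t -> not_qpow t (e * e') &
      forall e e', e \in pabcd (dual_par t) -> e' \in pabcd (dual_par t) ->
        not_qpow t (e * e')].

End AskeyWilson.

Arguments fourier {R} t c f y.
Arguments inv_fourier {R} t g.
Arguments fin_supp {R} t g.

(* Main.v *)
(* Y is triangular with simple spectrum, and Y P = gm P has one solution for
   each gm in the chain g_0, g_1, ... of all points of sigma, where g_{r+1} is
   1/(q g_r) for r even and 1/g_r for r odd.  T1 - alpha and X^-1 T1^-1 - alpha,
   for suitable alpha(g_r), map the eigenspace of g_r to that of g_{r+1}; since T1
   and X^-1 T1^-1 act on the value at 1/(k1 u1) by k1 and u1, this gives a
   recursion for the normalised polynomials E_r.

   The weight Delta times the coefficient of T1 (resp. T0) is invariant under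
   x -> 1/x (resp. x -> q/x).  Truncating the q-products, the integrals involved
   become integrals of rational functions, for which the substitution is checked
   by partial fractions: only winding numbers enter, no deformation of the
   contour.  Hence T1 and T0 have as adjoints the inverses of the operators with
   inverted parameters, so that E_r and E'_s are orthogonal for r <> s, and the
   recursion for the E_r turns into one for N_r = <E_r, E'_r>.

   Delta with dual parameters satisfies functional equations under x -> 1/x and
   x -> q/x with the same rational factors, so the residues w_r satisfy the
   inverse recursion and N_r w_r does not depend on r.  This gives (ii) and,
   expanding in the E_r, (i), provided that <1, 1> <> 0.  If <1, 1> = 0, all N_r
   and all <f, 1> vanish; integrating against the denominators of Delta, the
   integral of (x^2; q)_oo (q x^-2; q)_oo dx / x is zero, whereas by the finite
   Jacobi triple product the constant term of this theta function is
   1 / (q; q)_oo. *)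

Require Import Defs.
From HB Require Import structures.
From mathcomp Require Import all_boot all_order all_algebra.
From mathcomp Require Import all_classical all_reals all_analysis.
From mathcomp Require Import finmap complex.
From mathcomp Require Import -(notations) monalg.
From mathcomp Require Import ring lra zify.

Set Implicit Arguments.
Unset Strict Implicit.
Unset Printing Implicit Defensive.

Import Order.TTheory GRing.Theory Num.Theory numFieldNormedType.Exports.

Local Open Scope classical_set_scope.
Local Open Scope ring_scope.

(** * Contour integrals along rectifiable curves *)

Section Norm.
Variable R : realType.
Local Notation C := (cplx R).
Implicit Types (x y z : C).

(** The curve is only rectifiable and Jordan, and Cauchy's theorem is replaced as follows. Powers (x
    - p)^n with n <> -1 have a primitive along the curve and integrate to zero. For n = -1 the
    integral is locally constant in p off the curve and vanishes for large p, hence outside; inside,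
    it is 2 pi i by the definition of counterclockwise. Up to orientation, x -> s/x carries dx/(x -
    p) to dx/x - dx/(x - s/p), and the contour separates p from s/p, so both integrals agree. The
    weights have infinitely many poles; their truncations have finitely many, keep the symmetry
    exactly and converge uniformly on the curve.

    The numbers alpha have this origin: if Y f = gm f, the span of f and T1 f is stable under Y^-1,
    with a triangular matrix whose second eigenvalue is gm, and T1 f - alpha f is the second
    eigenvector. For X^-1 T1^-1 that eigenvalue is q gm. The differences k1 - alpha and u1 - alpha
    factor through the dual parameters, which is how the dual weight comes to match the norms. *)

Definition nm (z : C) : R := complex.Re `|z|.

Lemma nmE z : `|z| = ((nm z)%:C)%C :> C.
Proof. by rewrite /nm normc_def. Qed.

Lemma nm_ge0 z : 0 <= nm z.
Proof. by rewrite -(@lecR R) -nmE normr_ge0. Qed.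

Lemma nm0 : nm 0 = 0.
Proof. by rewrite /nm normr0. Qed.

Lemma nm1 : nm 1 = 1.
Proof. by rewrite /nm normr1. Qed.

Lemma nm_eq0 z : (nm z == 0) = (z == 0).
Proof. by rewrite -[RHS]normr_eq0 nmE -(inj_eq (@complexI R)). Qed.

Lemma nm_gt0 z : (0 < nm z) = (z != 0).
Proof. by rewrite lt_neqAle nm_ge0 andbT eq_sym nm_eq0. Qed.

Lemma nmM x y : nm (x * y) = nm x * nm y.
Proof. by apply: (@complexI R); rewrite rmorphM/= -!nmE normrM. Qed.

Lemma nmN x : nm (- x) = nm x.
Proof. by rewrite /nm normrN. Qed.

Lemma nmB x y : nm (x - y) = nm (y - x).
Proof. by rewrite /nm distrC. Qed.

Lemma nmV x : nm x^-1 = (nm x)^-1.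
Proof. by apply: (@complexI R); rewrite fmorphV/= -!nmE normfV. Qed.

Lemma nmX x n : nm (x ^+ n) = nm x ^+ n.
Proof. by apply: (@complexI R); rewrite rmorphXn/= -!nmE normrX. Qed.

Lemma nmD x y : nm (x + y) <= nm x + nm y.
Proof. by rewrite -(@lecR R) rmorphD/= -!nmE ler_normD. Qed.

Lemma nm_distD z x y : nm (x - y) <= nm (x - z) + nm (z - y).
Proof. by rewrite -[x - y](subrKA z) nmD. Qed.

Lemma nm_sum (I : Type) (r : seq I) (P : pred I) (F : I -> C) :
  nm (\sum_(i <- r | P i) F i) <= \sum_(i <- r | P i) nm (F i).
Proof.
elim/big_ind2 : _ => //; first by rewrite nm0.
by move=> ? ? ? ? *; apply: le_trans (nmD _ _) _; apply: lerD.
Qed.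

Lemma nm_real (r : R) : nm (r%:C)%C = `|r|.
Proof. by rewrite /nm normc_def/= expr0n/= addr0 sqrtr_sqr. Qed.

Lemma nm_Re z : `|complex.Re z| <= nm z.
Proof.
rewrite /nm normc_def/= -sqrtr_sqr ler_wsqrtr//.
by rewrite lerDl sqr_ge0.
Qed.

Lemma nm_Im z : `|complex.Im z| <= nm z.
Proof.
rewrite /nm normc_def/= -sqrtr_sqr ler_wsqrtr//.
by rewrite lerDr sqr_ge0.
Qed.

Lemma nm_ReIm z : nm z <= `|complex.Re z| + `|complex.Im z|.
Proof.
rewrite /nm normc_def/= -[leRHS]ger0_norm ?addr_ge0//.
rewrite -[leRHS]sqrtr_sqr ler_wsqrtr//.
rewrite sqrrD -addrA !real_normK ?num_real// lerD2l lerDr.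
by rewrite mulrn_wge0// mulr_ge0.
Qed.

Lemma cltP (e : C) : 0 < e -> exists2 d : R, 0 < d & e = (d%:C)%C.
Proof.
move=> e0; exists (nm e); first by rewrite nm_gt0 gt_eqF.
by rewrite -nmE gtr0_norm.
Qed.

Lemma cvg_nmP (T : Type) (F : set_system T) (FF : Filter F) (f : T -> C) (l : C) :
  (forall e : R, 0 < e -> \forall x \near F, nm (l - f x) < e) <->
  f @ F --> l.
Proof.
split=> [h|/cvgrPdist_lt h e e0].
  apply/cvgrPdist_lt => e /cltP[d d0 ->].
  by have := h d d0; apply: filterS => x xd; rewrite nmE ltcR.
have := h (e%:C)%C; rewrite ltcR => /(_ e0).
by apply: filterS => x; rewrite nmE ltcR.
Qed.

Lemma near_nmP (z : C) (P : set C) :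
  (\forall x \near z, P x) <-> exists2 e : R, 0 < e & forall x, nm (z - x) < e -> P x.
Proof.
split=> [/nbhs_ballP[e /= e0 h]|[e e0 h]].
  have [d d0 de] := cltP e0; exists d => // x zx; apply: h.
  by rewrite /ball/= de nmE ltcR.
apply/nbhs_ballP; exists (e%:C)%C => /=; first by rewrite ltcR.
by move=> x; rewrite /ball/= nmE ltcR => /h.
Qed.

Lemma nm_lim_unique (l l' : C) :
  (forall e : R, 0 < e -> nm (l - l') <= e) -> l = l'.
Proof.
move=> h; apply/eqP; rewrite -subr_eq0 -nm_eq0 eq_le nm_ge0 andbT.
by apply/ler_addgt0Pr => e /h; rewrite add0r.
Qed.

(* R[i] has no declared completeness instance. *)
Lemma cplx_complete (u : nat -> C) :
  (forall e : R, 0 < e -> exists N, forall m n, (N <= m)%N -> (N <= n)%N ->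
     nm (u m - u n) < e) ->
  exists l : C, forall e : R, 0 < e ->
     exists N, forall n, (N <= n)%N -> nm (u n - l) < e.
Proof.
move=> uc.
have part (p : C -> R) : (forall z, `|p z| <= nm z) ->
    (forall x y, p (x - y) = p x - p y) ->
    exists l : R, forall e : R, 0 < e ->
     exists N, forall n, (N <= n)%N -> `|p (u n) - l| < e.
  move=> pn pB.
  have : cauchy ((p \o u) @ \oo).
    apply: cauchy_exP => e /= e0; have [N hN] := uc e e0.
    exists (p (u N)); exists N => // n /= Nn.
    by rewrite /ball/= -pB; apply: le_lt_trans (pn _) _; exact: hN.
  move=> /cauchy_cvgP/cvg_ex[l ul]; exists l => e e0.
  move/cvgrPdist_lt : ul => /(_ e e0)[N _ hN]; exists N => n Nn.
  by rewrite distrC; apply: hN.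
have [a ha] := part (@complex.Re R) nm_Re (fun x y => raddfB _ _ _).
have [b hb] := part (@complex.Im R) nm_Im (fun x y => raddfB _ _ _).
exists (Complex a b) => e e0.
have e2 : 0 < e / 2 by rewrite divr_gt0.
have [N1 h1] := ha _ e2; have [N2 h2] := hb _ e2.
exists (maxn N1 N2) => n; rewrite geq_max => /andP[/h1 n1 /h2 n2].
apply: le_lt_trans (nm_ReIm _) _.
rewrite [ltRHS]splitr ltrD//.
  by rewrite (_ : complex.Re _ = complex.Re (u n) - a) // raddfB.
by rewrite (_ : complex.Im _ = complex.Im (u n) - b) // raddfB.
Qed.
End Norm.

(** * Riemann-Stieltjes sums and their limits *)

Section RiemannStieltjes.
Variable R : realType.
Local Notation C := (cplx R).
Implicit Types (g : R -> C) (phi psi : R -> C) (s : seq R) (tau : nat -> R).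

Definition tagged s tau (d : R) := itv_partition 0 1 s /\
  forall i, (i < size s)%N ->
    subdiv_pt s i.+1 - subdiv_pt s i < d /\
    subdiv_pt s i <= tau i <= subdiv_pt s i.+1.

(** The integrand is a function of the parameter rather than of the point, so that step functions
    are integrands too. *)
Definition rsum phi g s tau : C :=
  \sum_(i < size s) phi (tau i) * (g (subdiv_pt s i.+1) - g (subdiv_pt s i)).

Definition rs_int phi g (l : C) := forall e : R, 0 < e -> exists2 d : R, 0 < d &
  forall s tau, tagged s tau d -> nm (rsum phi g s tau - l) < e.

Lemma contour_intE (f : C -> C) g l :
  is_contour_int f g l <-> rs_int (f \o g) g l.
Proof.
split=> h e e0; have [d d0 hd] := h e e0; exists d => // s tau.
  by case=> sp st; rewrite -ltcR -nmE; exact: hd.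
by move=> sp st; rewrite nmE ltcR; exact: hd.
Qed.

Lemma subdiv_pt0 s : subdiv_pt s 0 = 0. Proof. by []. Qed.

Lemma subdiv_pt_size s : itv_partition 0 1 s -> subdiv_pt s (size s) = 1.
Proof. by case=> _ /eqP; rewrite (last_nth 0). Qed.

Lemma subdiv_pt_lt s i : itv_partition 0 1 s -> (i < size s)%N ->
  subdiv_pt s i < subdiv_pt s i.+1.
Proof. by case=> /(pathP 0) h _ /h. Qed.

Lemma subdiv_pt_le s i j : itv_partition 0 1 s -> (i <= j <= size s)%N ->
  subdiv_pt s i <= subdiv_pt s j.
Proof.
move=> sp /andP[]; elim: j => [|j IH]; first by rewrite leqn0 => /eqP ->.
rewrite leq_eqVlt => /predU1P[->//|ij] js.
by apply: (le_trans (IH _ (ltnW js))) => //; exact/ltW/subdiv_pt_lt.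
Qed.

Lemma subdiv_pt01 s i : itv_partition 0 1 s -> (i <= size s)%N ->
  0 <= subdiv_pt s i <= 1.
Proof.
move=> sp si; rewrite -{1}(subdiv_pt0 s) -(subdiv_pt_size sp).
by rewrite !subdiv_pt_le// ?leqnn ?si.
Qed.

Lemma tag01 s tau d i : tagged s tau d -> (i < size s)%N -> 0 <= tau i <= 1.
Proof.
move=> [sp h] si; have [_ /andP[h1 h2]] := h i si.
have /andP[a1 _] := subdiv_pt01 sp (ltnW si).
have /andP[_ a2] := subdiv_pt01 sp si.
by rewrite (le_trans a1 h1) (le_trans h2 a2).
Qed.

(** Equal parts give subdivisions of any mesh. Without them [rs_int] could hold vacuously and limits
    would not be unique. *)
Lemma tagged_exists (d : R) : 0 < d -> exists s tau, tagged s tau d.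
Proof.
move=> d0; pose n := (Num.truncn d^-1).+1.
have n0 : 0 < n%:R :> R by rewrite ltr0n.
have nd : n%:R^-1 < d.
  by rewrite invf_plt ?posrE// truncnS_gt.
pose s := [seq (j.+1)%:R / n%:R : R | j <- iota 0 n].
have ss : size s = n by rewrite size_map size_iota.
have sE i : (i <= n)%N -> subdiv_pt s i = i%:R / n%:R.
  case: i => [|i] ni; first by rewrite mul0r.
  by rewrite /subdiv_pt/= (nth_map 0) ?size_iota// nth_iota.
have dif i : (i < n)%N -> subdiv_pt s i.+1 = subdiv_pt s i + n%:R^-1.
  by move=> ni; rewrite (sE i.+1)// (sE i (ltnW ni)) -natr1 mulrDl mul1r.
exists s, (subdiv_pt s); split; last first.
  rewrite ss => i ni; rewrite dif// lexx addrAC subrr add0r; split=> //.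
  by rewrite lerDl invr_ge0 ltW.
split; last first.
  by rewrite (last_nth 0) ss -/(subdiv_pt s n) sE// divff ?eqxx// gt_eqF.
apply/(pathP 0) => i; rewrite ss => ni.
rewrite -/(subdiv_pt s i) -[nth _ _ _]/(subdiv_pt s i.+1).
by rewrite dif// ltrDl invr_gt0.
Qed.

Lemma taggedW s tau d d' : d <= d' -> tagged s tau d -> tagged s tau d'.
Proof.
move=> dd [sp h]; split=> // i /h[h1 h2]; split=> //.
exact: lt_le_trans h1 dd.
Qed.

Lemma rs_int_unique phi g l l' : rs_int phi g l -> rs_int phi g l' -> l = l'.
Proof.
move=> h h'; apply: nm_lim_unique => e e0.
have e2 : 0 < e / 2 by rewrite divr_gt0.
have [d d0 hd] := h _ e2; have [d' d'0 hd'] := h' _ e2.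
have [s [tau st]] : exists s tau, tagged s tau (Num.min d d').
  by apply: tagged_exists; rewrite lt_min d0.
rewrite (le_trans (nm_distD (rsum phi g s tau) _ _))// [leRHS]splitr.
rewrite ltW// ltrD//; first rewrite nmB; [apply: hd|apply: hd'];
 by apply: taggedW st; rewrite ge_min lexx ?orbT.
Qed.

Lemma rs_int_ext phi psi g l : (forall t, 0 <= t <= 1 -> phi t = psi t) ->
  rs_int phi g l -> rs_int psi g l.
Proof.
move=> pp h e e0; have [d d0 hd] := h e e0; exists d => // s tau st.
rewrite (_ : rsum _ _ _ _ = rsum phi g s tau); first exact: hd.
by apply: eq_bigr => i _; rewrite pp// (tag01 st).
Qed.

Lemma rs_intD phi psi g l l' : rs_int phi g l -> rs_int psi g l' ->
  rs_int (fun t => phi t + psi t) g (l + l').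
Proof.
move=> h h' e e0; have e2 : 0 < e / 2 by rewrite divr_gt0.
have [d d0 hd] := h _ e2; have [d' d'0 hd'] := h' _ e2.
exists (Num.min d d'); first by rewrite lt_min d0.
move=> s tau st; rewrite (_ : rsum _ _ _ _ = rsum phi g s tau + rsum psi g s tau).
  rewrite opprD addrACA (le_lt_trans (nmD _ _))// [ltRHS]splitr ltrD//;
  [apply: hd|apply: hd']; by apply: taggedW st; rewrite ge_min lexx ?orbT.
by rewrite /rsum -big_split/=; apply: eq_bigr => i _; rewrite mulrDl.
Qed.

Lemma rs_intZ (a : C) phi g l : rs_int phi g l ->
  rs_int (fun t => a * phi t) g (a * l).
Proof.
move=> h e e0; have a1 : 0 < nm a + 1 by rewrite ltr_wpDl ?nm_ge0.
have [d d0 hd] := h (e / (nm a + 1)) (divr_gt0 e0 a1).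
exists d => // s tau st; rewrite (_ : rsum _ _ _ _ = a * rsum phi g s tau); last first.
  by rewrite /rsum mulr_sumr; apply: eq_bigr => i _; rewrite mulrA.
have := hd _ _ st; rewrite -mulrBr nmM ltr_pdivlMr// mulrC; apply: le_lt_trans.
by rewrite ler_wpM2r ?nm_ge0// lerDl.
Qed.

Lemma rs_int0 g : rs_int (fun=> 0) g 0.
Proof.
move=> e e0; exists 1 => // s tau _; rewrite /rsum big1 ?subrr ?nm0// => i _.
by rewrite mul0r.
Qed.

Lemma rs_int_sum (I : Type) (r : seq I) (F : I -> R -> C) (l : I -> C) g :
  (forall i, rs_int (F i) g (l i)) ->
  rs_int (fun t => \sum_(i <- r) F i t) g (\sum_(i <- r) l i).
Proof.
move=> h; elim: r => [|i r IH].
  rewrite big_nil; apply: rs_int_ext (rs_int0 g) => t _.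
  by rewrite big_nil.
rewrite big_cons; apply: rs_int_ext (rs_intD (h i) IH) => t _.
by rewrite big_cons.
Qed.

Definition variation_le g (M : R) := forall s, itv_partition 0 1 s ->
  \sum_(i < size s) nm (g (subdiv_pt s i.+1) - g (subdiv_pt s i)) <= M.

Lemma rectifiable_nm g : rectifiable g -> exists M, variation_le g M.
Proof.
case=> M h; exists M => s /h; under eq_bigr do rewrite nmE.
by rewrite -rmorph_sum/= lecR.
Qed.

Lemma rsum_bound phi g M s tau d (B : R) : variation_le g M -> tagged s tau d ->
  0 <= B -> (forall t, 0 <= t <= 1 -> nm (phi t) <= B) ->
  nm (rsum phi g s tau) <= B * M.
Proof.
move=> gM st B0 hB; have [sp _] := st.
apply: le_trans (_ : B * \sum_(i < size s)
    nm (g (subdiv_pt s i.+1) - g (subdiv_pt s i)) <= _); last first.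
  by rewrite ler_wpM2l// gM.
rewrite (le_trans (nm_sum _ _ _))// mulr_sumr; apply: ler_sum => i _.
by rewrite nmM ler_wpM2r ?nm_ge0// hB// (tag01 st).
Qed.

Lemma variation_ge0 g M : variation_le g M -> 0 <= M.
Proof.
have [s [tau [sp _]]] := tagged_exists (@ltr01 R).
by move=> /(_ s sp); apply: le_trans; apply: sumr_ge0 => i _; exact: nm_ge0.
Qed.

Lemma rs_int_bound phi g M l (B : R) : variation_le g M -> rs_int phi g l ->
  0 <= B -> (forall t, 0 <= t <= 1 -> nm (phi t) <= B) -> nm l <= B * M.
Proof.
move=> gM h B0 hB; apply/ler_addgt0Pr => e e0.
have [d d0 hd] := h e e0.
have [s [tau st]] := tagged_exists d0.
rewrite -[l](subrK (rsum phi g s tau)) addrC (le_trans (nmD _ _))// lerD//.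
  exact: rsum_bound gM st B0 hB.
by rewrite nmB ltW// hd.
Qed.

(** Sums are bounded by the supremum of the integrand times the variation, so a uniform error
    survives integration. The error [e] is cut into M + 2 parts: M for replacing the integrand, one
    for the sum of [psi], one for [l' - l]. *)
Lemma rs_int_approx phi g M l : variation_le g M ->
  (forall e : R, 0 < e -> exists psi l', [/\ rs_int psi g l', nm (l' - l) < e &
    forall t, 0 <= t <= 1 -> nm (phi t - psi t) <= e]) ->
  rs_int phi g l.
Proof.
move=> gM h e e0; have M0 := variation_ge0 gM.
have M2 : 0 < M + 2 by rewrite ltr_wpDl.
have e1 : 0 < e / (M + 2) by rewrite divr_gt0.
have [psi [l' [hpsi hl hp]]] := h _ e1.
have [d d0 hd] := hpsi _ e1.
exists d => // s tau st.
have -> : rsum phi g s tau - l = rsum (fun t => phi t - psi t) g s tau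
    + (rsum psi g s tau - l') + (l' - l).
  rewrite addrA [X in X + l']addrA subrK; congr (_ - _).
  rewrite /rsum -big_split/=; apply: eq_bigr => i _.
  by rewrite -mulrDl subrK.
have b1 := rsum_bound gM st (ltW e1) hp.
have b2 := hd _ _ st.
apply: le_lt_trans (nmD _ _) _; apply: le_lt_trans (lerD (nmD _ _) (lexx _)) _.
have -> : e = e / (M + 2) * M + e / (M + 2) + e / (M + 2).
  by field; rewrite gt_eqF.
by apply: ltrD => //; apply: ler_ltD.
Qed.

Definition ucont (phi : R -> C) := forall e : R, 0 < e -> exists2 d : R, 0 < d &
  forall x y : R, 0 <= x <= 1 -> 0 <= y <= 1 -> `|x - y| < d -> nm (phi x - phi y) < e.

(** Tags increase with their intervals, so those at or beyond [b] form a final segment of the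
    indices. *)
Lemma tags_threshold s tau d (b : R) : tagged s tau d -> exists2 k, (k <= size s)%N &
    forall i, (i < size s)%N -> (b <= tau i) = (k <= i)%N.
Proof.
move=> [sp sh].
have mono i j : (i <= j)%N -> (j < size s)%N -> tau i <= tau j.
  move=> ij js; move: ij; rewrite leq_eqVlt => /predU1P[->//|ij].
  have [_ /andP[_ h1]] := sh i (ltn_trans ij js).
  have [_ /andP[h2 _]] := sh j js.
  apply: le_trans h1 _; apply: le_trans h2.
  by apply: subdiv_pt_le => //; rewrite ij ltnW.
suff : forall m, (m <= size s)%N -> exists2 k, (k <= m)%N &
  forall i, (i < m)%N -> (b <= tau i) = (k <= i)%N by apply.
elim=> [|m IH] ms; first by exists 0%N.
have [k km hk] := IH (ltnW ms).
case: (ltnP k m) => [km'|mk].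
  exists k => [|i]; first exact: leqW.
  rewrite ltnS leq_eqVlt => /predU1P[->|]; last exact: hk.
  rewrite (ltnW km'); apply: (@le_trans _ _ (tau k)); last by apply: mono => //; exact: ltnW.
  by rewrite hk.
have {mk}mk : k = m by apply/eqP; rewrite eqn_leq km.
case: (lerP b (tau m)) => bm.
  exists m => // i; rewrite ltnS leq_eqVlt => /predU1P[->|im].
    by rewrite bm leqnn.
  by rewrite hk// mk.
exists m.+1 => // i; rewrite ltnS leq_eqVlt => /predU1P[->|im].
  by rewrite ltnn leNgt bm.
by rewrite hk// mk leqNgt im/= ltnNge ltnW.
Qed.

(** Only the tags at or beyond [b] contribute, and their increments telescope to [g 1] minus the
    value of [g] at a subdivision point whose distance to [b] is at most the mesh. *)
Lemma rs_int_step g (b : R) : ucont g -> 0 <= b <= 1 ->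
  rs_int (fun t => (b <= t)%R%:R) g (g 1 - g b).
Proof.
move=> gc b01 e e0; have [d d0 hd] := gc e e0.
exists (d / 2); first by rewrite divr_gt0.
move=> s tau st; have [sp sh] := st.
have [k kn hk] := tags_threshold b st.
have -> : rsum (fun t => (b <= t)%R%:R) g s tau = g 1 - g (subdiv_pt s k).
  rewrite /rsum -(subdiv_pt_size sp) -(telescope_sumr (g \o subdiv_pt s) kn).
  rewrite -(big_mkord xpredT (fun i => (b <= tau i)%R%:R *
    (g (subdiv_pt s i.+1) - g (subdiv_pt s i)))).
  rewrite (big_cat_nat (leq0n k) kn)//= big1_seq ?add0r; last first.
    move=> i /andP[_]; rewrite mem_index_iota => /andP[_ ik].
    by rewrite (hk i (leq_trans ik kn)) leqNgt ik mul0r.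
  apply: eq_big_nat => i /andP[ki ik].
  by rewrite hk// ki mul1r.
rewrite opprB addrC addrA subrK.
have k01 := subdiv_pt01 sp kn.
apply: hd => //; rewrite ltr_norml; apply/andP; split.
  have [->|k0] := posnP k.
    by rewrite subdiv_pt0 subr0 (lt_le_trans _ (proj1 (andP b01)))// oppr_lt0.
  have k1 : (k.-1 < size s)%N by rewrite prednK.
  have [h1 /andP[h2 h3]] := sh _ k1; rewrite prednK// in h1 h3.
  have := hk _ k1; rewrite -{2}(prednK k0) ltnn => /negbT; rewrite -ltNge => h4.
  lra.
have [kn'|kn'] := ltnP k (size s).
  have [h1 /andP[h2 h3]] := sh _ kn'.
  have := hk _ kn'; rewrite leqnn => h4.
  lra.
have -> : k = size s by apply/eqP; rewrite eqn_leq kn.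
rewrite subdiv_pt_size//; lra.
Qed.
End RiemannStieltjes.

(** * Existence of the integral of a continuous function *)

Section Existence.
Variable R : realType.
Local Notation C := (cplx R).
Implicit Types (g phi psi : R -> C).

Definition wcont phi := forall t : R, 0 <= t <= 1 -> forall e : R, 0 < e ->
  exists2 d : R, 0 < d &
  forall u : R, 0 <= u <= 1 -> `|t - u| < d -> nm (phi t - phi u) < e.

Lemma within_wcont phi : {within `[0, 1], continuous phi} -> wcont phi.
Proof.
move=> /subspace_continuousP h t t01 e e0.
have /h/cvg_nmP/(_ e e0) : `[0%R, 1%R]%classic t by rewrite /= in_itv.
rewrite near_withinE => /nbhs_ballP[d /= d0 hd].
by exists d => // u u01 tu; apply: hd => //=.
Qed.

(** Compactness in its near-covering form, applied to the filter of small positive scales. It serves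
    both uniform continuity and boundedness. *)
Lemma unit_compact (P : R -> R -> Prop) :
  (forall t, 0 <= t <= 1 -> exists2 d : R, 0 < d &
     forall u e, 0 <= u <= 1 -> `|t - u| < d -> 0 < e < d -> P e u) ->
  exists2 d : R, 0 < d & forall u, 0 <= u <= 1 -> P d u.
Proof.
move=> h.
have Kc : near_covering (`[0, 1]%classic : set R).
  by apply/compact_near_coveringP; exact: segment_compact.
have PF : Filter (0^'+ : set_system R) by exact: at_right_proper_filter.
have hc : \forall e \near 0^'+, `[0, 1]%classic `<=` (fun u : R => 0 <= u <= 1 -> P e u).
  apply: Kc => t; rewrite /= in_itv/= => /h[d d0 hd].
  exists (ball t d, [set e : R | 0 < e < d]) => /=.
    split; first exact: nbhsx_ballx.
    by near=> e; apply/andP; split; near: e; [exact: nbhs_right_gt|exact: nbhs_right_lt].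
  by move=> [u e] /= [tu ed] u01; apply: hd.
case: hc => r /= r0 hr; exists (r / 2); first by rewrite divr_gt0.
move=> u u01; apply: (hr (r / 2)) => //=.
- by rewrite sub0r normrN gtr0_norm ?divr_gt0// ltr_pdivrMr// ltr_pMr// ltr1n.
- by rewrite divr_gt0.
Unshelve. all: by end_near. Qed.

Lemma wcont_ucont phi : wcont phi -> ucont phi.
Proof.
move=> h e e0.
have [t t01|d d0 hd] := @unit_compact (fun d u => forall v : R, 0 <= v <= 1 ->
    `|u - v| < d -> nm (phi u - phi v) < e).
  have [d d0 hd] := h t t01 (e / 2) (divr_gt0 e0 (ltr0n _ 2)).
  exists (d / 2); first by rewrite divr_gt0.
  move=> u r u01 tu /andP[r0 rd] v v01 uv.
  rewrite (le_lt_trans (nm_distD (phi t) _ _))// [ltRHS]splitr ltrD//.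
    rewrite nmB hd// (lt_trans tu)// ltr_pdivrMr//; lra.
  apply: hd => //; rewrite -(subrKA u) (le_lt_trans (ler_normD _ _))//.
  lra.
by exists d => // x y *; exact: hd.
Qed.

Lemma wcont_bounded phi : wcont phi ->
  exists2 B : R, 0 < B & forall t, 0 <= t <= 1 -> nm (phi t) <= B.
Proof.
move=> h.
(* Boundedness by 1/d is phrased so that it passes to every smaller scale [d]. *)
have [t t01|d d0 hd] := @unit_compact (fun d u => d * nm (phi u) <= 1).
  have [d d0 hd] := h t t01 1 ltr01.
  have p0 : 0 < nm (phi t) + 1 by rewrite ltr_wpDl// nm_ge0.
  exists (Num.min d (nm (phi t) + 1)^-1); first by rewrite lt_min d0 invr_gt0.
  move=> u e u01; rewrite lt_min => /andP[/hd tu _]; rewrite lt_min => /andP[e0 /andP[_ ep]].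
  have {}tu : nm (phi u) <= nm (phi t) + 1.
    have := nmD (phi t) (phi u - phi t); rewrite addrC subrK => /le_trans; apply.
    by rewrite lerD2l nmB ltW// tu.
  apply: le_trans (ler_wpM2l (ltW e0) tu) _.
  by rewrite -ler_pdivlMr// div1r ltW.
exists d^-1; first by rewrite invr_gt0.
by move=> t /hd; rewrite mulrC -ler_pdivlMr// div1r.
Qed.

Lemma wcont_comp phi (f : C -> C) : wcont phi ->
  (forall t, 0 <= t <= 1 -> {for phi t, continuous f}) -> wcont (f \o phi).
Proof.
move=> h hf t t01 e e0.
have /cvg_nmP/(_ e e0)/near_nmP[d d0 hd] := hf t t01.
have [d' d'0 hd'] := h t t01 d d0.
by exists d' => // u u01 tu; apply: hd; exact: hd'.
Qed.

Lemma wcont_lower phi : wcont phi -> (forall t, 0 <= t <= 1 -> phi t != 0) ->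
  exists2 m : R, 0 < m & forall t, 0 <= t <= 1 -> m <= nm (phi t).
Proof.
move=> h h0.
have : wcont (GRing.inv \o phi).
  by apply: wcont_comp => // t t01; apply: inv_continuous; exact: h0.
case/wcont_bounded => B B0 hB; exists B^-1; first by rewrite invr_gt0.
move=> t t01; have := hB t t01; rewrite /= nmV => hb.
by rewrite invf_ple ?posrE// nm_gt0 h0.
Qed.

(* A uniformly continuous integrand is a uniform limit of step functions. *)
Lemma rs_int_exists phi g M : ucont phi -> ucont g -> variation_le g M ->
  exists l, rs_int phi g l.
Proof.
move=> pc gc gM; have M0 := variation_ge0 gM.
have step (e : R) : 0 < e -> exists psi l', rs_int psi g l' /\
    forall t, 0 <= t <= 1 -> nm (phi t - psi t) <= e.
  move=> e0; have [d d0 hd] := pc e e0.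
  pose n := (Num.truncn d^-1).+1.
  have n0 : 0 < n%:R :> R by rewrite ltr0n.
  have nd : n%:R^-1 < d by rewrite invf_plt ?posrE// truncnS_gt.
  pose x j : R := j%:R / n%:R.
  have x01 j : (j <= n)%N -> 0 <= x j <= 1.
    move=> jn; rewrite /x divr_ge0 ?ler0n//= ler_pdivrMr// mul1r ler_nat//.
  (* The step function equal to [phi (x k)] between [x k] and [x k.+1], written through its jumps so
     that [rs_int_step] applies to each term. *)
  pose psi t := phi 0 * (0 <= t)%R%:R +
    \sum_(j < n) (phi (x j.+1) - phi (x j)) * (x j.+1 <= t)%R%:R.
  exists psi; eexists; split.
    apply: rs_intD; first by apply: rs_intZ; apply: rs_int_step; rewrite // lexx ler01.
    apply: rs_int_sum => j; apply: rs_intZ; apply: rs_int_step => //; exact: x01.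
  move=> t /andP[t0 t1].
  have tn0 : 0 <= t * n%:R by rewrite mulr_ge0// ltW.
  pose k := Num.truncn (t * n%:R).
  have kn : (k <= n)%N.
    rewrite -(ler_nat R) (@le_trans _ _ (t * n%:R))//.
      by rewrite truncn_le.
    by rewrite ler_piMl// ltW.
  have -> : psi t = phi (x k).
    rewrite /psi t0 mulr1.
    rewrite -(big_mkord xpredT (fun j => (phi (x j.+1) - phi (x j)) * (x j.+1 <= t)%R%:R)).
    rewrite (big_cat_nat (leq0n k) kn)/= [X in _ + (_ + X)]big1_seq ?addr0; last first.
      move=> j /andP[_]; rewrite mem_index_iota => /andP[kj jn].
      rewrite /x ler_pdivrMr// -truncn_ge_nat//.
      by rewrite leqNgt ltnS kj mulr0.
    under eq_big_nat => j /andP[_ jk].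
      rewrite /x ler_pdivrMr// -truncn_ge_nat// jk mulr1.
      over.
    rewrite -/(x _) (telescope_sumr (phi \o x))//=.
    by rewrite /x mul0r addrC subrK.
  rewrite ltW// hd//; [by rewrite t0|exact: x01|].
  apply: le_lt_trans nd; rewrite ger0_norm.
    rewrite lerBlDr -div1r -mulrDl ler_pdivlMr// addrC natr1 ltW//.
    by rewrite truncnS_gt.
  by rewrite subr_ge0 ler_pdivrMr// truncn_le.
have /choice[psi /choice[l hpl]] : forall n : nat, exists psi, exists l', rs_int psi g l' /\
    forall t, 0 <= t <= 1 -> nm (phi t - psi t) <= n.+1%:R^-1.
  by move=> n; apply: step; rewrite invr_gt0 ltr0n.
have M1 : 0 < M + 1 by rewrite ltr_wpDl.
have inv_small (e : R) : 0 < e -> exists N, forall n, (N <= n)%N -> n.+1%:R^-1 < e.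
  move=> e0; exists (Num.truncn e^-1) => n Nn.
  rewrite invf_plt ?posrE//; apply: lt_le_trans (truncnS_gt _) _.
  by rewrite ler_nat ltnS.
have [L hL] : exists l0 : C, forall e : R, 0 < e ->
     exists N, forall n, (N <= n)%N -> nm (l n - l0) < e.
  apply: cplx_complete => e e0.
  have [N hN] := inv_small (e / (M + 1) / 2) (divr_gt0 (divr_gt0 e0 M1) (ltr0n _ 2)).
  exists N => m n Nm Nn.
  have [hm hm'] := hpl m; have [hn hn'] := hpl n.
  have := rs_intD hm (rs_intZ (-1) hn); rewrite mulN1r => hmn.
  apply: le_lt_trans (rs_int_bound (B := e / (M + 1)) gM hmn _ _) _.
  - by rewrite divr_ge0// ltW.
  - move=> t t01; rewrite mulN1r (le_trans (nm_distD (phi t) _ _))//.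
    rewrite [leRHS]splitr lerD//.
      by rewrite nmB (le_trans (hm' _ t01))// ltW// hN.
    by rewrite (le_trans (hn' _ t01))// ltW// hN.
  - by rewrite -mulrA gtr_pMr// mulrC ltr_pdivrMr// mul1r ltrDl.
exists L; apply: rs_int_approx gM _ => e e0.
have [N1 h1] := hL e e0; have [N2 h2] := inv_small e e0.
exists (psi (maxn N1 N2)), (l (maxn N1 N2)).
have [ha hb] := hpl (maxn N1 N2).
split=> //; first by apply: h1; rewrite leq_maxl.
by move=> t t01; rewrite (le_trans (hb _ t01))// ltW// h2// leq_maxr.
Qed.

End Existence.

(** * Primitives along a closed curve *)

Section Primitives.
Variables (R : realType) (c : R -> cplx R) (M : R).
Local Notation C := (cplx R).
Implicit Types (F G f g : C -> C).
Hypotheses (cw : wcont c) (cl : c 0 = c 1) (cM : variation_le c M).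

Definition ontrace (P : C -> Prop) := forall t : R, 0 <= t <= 1 -> P (c t).

(* f is the derivative of F along the curve, with a Lipschitz modulus. *)
Definition primitive_bound (K : R) F f :=
  [/\ ontrace (fun u => nm (F u) <= K), ontrace (fun u => nm (f u) <= K),
      ontrace (fun u => ontrace (fun v => nm (F v - F u) <= K * nm (v - u))) &
      ontrace (fun u => ontrace (fun v => ontrace (fun w =>
        nm (F v - F u - f w * (v - u)) <= K * (nm (v - w) + nm (u - w)) * nm (v - u))))].

Definition primitive F f := exists2 K : R, 0 < K & primitive_bound K F f.

(** The increments of [F] telescope to zero around the closed curve, and they differ from the terms
    of the sum by a small multiple of the increments of [c], whose total is bounded by the
    variation. *)
Lemma primitive_cint F f : primitive F f -> rs_int (f \o c) c 0.
Proof.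
move=> [K K0 [_ _ _ hK]] e e0; have M0 := variation_ge0 cM.
have M1 : 0 < M + 1 by rewrite ltr_wpDl.
pose eta := e / (K * 2 * (M + 1)).
have eta0 : 0 < eta by rewrite divr_gt0// !mulr_gt0.
have [d d0 hd] := wcont_ucont cw eta0.
exists d => // s tau st; have [sp sh] := st.
have tele : \sum_(i < size s) (F (c (subdiv_pt s i.+1)) - F (c (subdiv_pt s i))) = 0.
  rewrite -(big_mkord xpredT (fun i => F (c (subdiv_pt s i.+1)) - F (c (subdiv_pt s i)))).
  rewrite (telescope_sumr (F \o c \o subdiv_pt s))//= subdiv_pt0 subdiv_pt_size//.
  by rewrite cl subrr.
rewrite subr0 /rsum -[X in nm X]opprK nmN -[X in nm X]add0r -[X in X - _]tele -sumrB.
apply: (@le_lt_trans _ _ (\sum_(i < size s) K * 2 * eta *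
   nm (c (subdiv_pt s i.+1) - c (subdiv_pt s i)))).
  apply: le_trans (nm_sum _ _ _) _; apply: ler_sum => i _.
  have i1 := subdiv_pt01 sp (ltnW (ltn_ord i)).
  have i2 := subdiv_pt01 sp (ltn_ord i).
  have i3 := tag01 st (ltn_ord i).
  apply: le_trans (hK _ i1 _ i2 _ i3) _; rewrite ler_wpM2r ?nm_ge0//.
  rewrite -mulrA ler_wpM2l ?(ltW K0)// mulr_natl mulr2n.
  have [h1 /andP[h2 h3]] := sh _ (ltn_ord i).
  rewrite lerD// ltW// hd//; first by rewrite ger0_norm ?subr_ge0//; lra.
  by rewrite ler0_norm ?subr_le0//; lra.
have Ke : 0 < K * 2 * eta by apply: mulr_gt0 => //; exact: mulr_gt0.
rewrite -mulr_sumr; apply: (@le_lt_trans _ _ (K * 2 * eta * M)).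
  by apply: ler_wpM2l; [exact: ltW|exact: cM].
have -> : e = K * 2 * eta * (M + 1).
  by rewrite /eta; field; rewrite !gt_eqF.
by rewrite ltr_pM2l ?ltrDl.
Qed.

Lemma primitive_id : primitive id (fun=> 1).
Proof.
have [B B0 hB] := wcont_bounded cw.
exists (B + 1); first by rewrite addr_gt0.
split=> [t t01|t t01|t t01 u u01|t t01 u u01 w w01].
- by rewrite (le_trans (hB _ t01))// lerDl.
- by rewrite nm1 lerDr ltW.
- by rewrite ler_peMl ?nm_ge0// lerDr ltW.
- by rewrite mul1r subrr nm0 !mulr_ge0 ?addr_ge0 ?nm_ge0// ltW.
Qed.

Lemma primitive_cst (a : C) : primitive (fun=> a) (fun=> 0).
Proof.
exists (nm a + 1); first by rewrite ltr_wpDl ?nm_ge0.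
split=> [t t01|t t01|t t01 u u01|t t01 u u01 w w01].
- by rewrite lerDl.
- by rewrite nm0 addr_ge0 ?nm_ge0.
- by rewrite subrr nm0 mulr_ge0 ?addr_ge0 ?nm_ge0.
- by rewrite mul0r !subrr nm0 !mulr_ge0 ?addr_ge0 ?nm_ge0.
Qed.

Lemma primitiveW F f (K K' : R) : 0 < K -> K <= K' ->
  primitive_bound K F f -> primitive_bound K' F f.
Proof.
move=> K0 KK [h1 h2 h3 h4].
split=> [t t01|t t01|t t01 u u01|t t01 u u01 w w01].
- exact: le_trans (h1 _ t01) KK.
- exact: le_trans (h2 _ t01) KK.
- by apply: le_trans (h3 _ t01 _ u01) _; rewrite ler_wpM2r// nm_ge0.
- apply: le_trans (h4 _ t01 _ u01 _ w01) _.
  by rewrite !ler_wpM2r ?addr_ge0 ?nm_ge0.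
Qed.

Lemma primitiveD F f G g : primitive F f -> primitive G g ->
  primitive (fun x => F x + G x) (fun x => f x + g x).
Proof.
move=> [K K0 [h1 h2 h3 h4]] [L L0 [k1 k2 k3 k4]].
exists (K + L); first by rewrite addr_gt0.
split=> [t t01|t t01|t t01 u u01|t t01 u u01 w w01].
- by rewrite (le_trans (nmD _ _))// lerD ?h1 ?k1.
- by rewrite (le_trans (nmD _ _))// lerD ?h2 ?k2.
- by rewrite opprD addrACA (le_trans (nmD _ _))// mulrDl lerD ?h3 ?k3.
- rewrite (_ : _ - _ = (F (c u) - F (c t) - f (c w) * (c u - c t))
     + (G (c u) - G (c t) - g (c w) * (c u - c t))); last by ring.
  by rewrite (le_trans (nmD _ _))// !mulrDl lerD -?mulrDl ?h4 ?k4.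
Qed.

Lemma primitiveM F f G g : primitive F f -> primitive G g ->
  primitive (fun x => F x * G x) (fun x => f x * G x + F x * g x).
Proof.
move=> [K0 K00 hF] [L0 L00 hG]; pose K := K0 + L0 + 1.
have KK : K0 <= K by rewrite /K; lra.
have LK : L0 <= K by rewrite /K; lra.
have K1 : 1 <= K by rewrite /K; lra.
have K_gt0 : 0 < K by rewrite (lt_le_trans ltr01).
have Kp := ltW K_gt0.
have [h1 h2 h3 h4] := primitiveW K00 KK hF.
have [k1 k2 k3 k4] := primitiveW L00 LK hG.
exists (4 * K ^+ 2); first by rewrite mulr_gt0// exprn_gt0.
have K2 : 0 <= K ^+ 2 by rewrite exprn_ge0.
split=> [t t01|t t01|t t01 u u01|t t01 u u01 w w01].
- rewrite nmM (@le_trans _ _ (K ^+ 2))//; last by rewrite ler_peMl// ler1n.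
  by rewrite expr2 ler_pM ?nm_ge0 ?h1 ?k1.
- rewrite (le_trans (nmD _ _))// (@le_trans _ _ (K ^+ 2 + K ^+ 2))//; last by lra.
  by rewrite expr2 !nmM lerD// ler_pM ?nm_ge0 ?h1 ?k1 ?h2 ?k2.
- rewrite (_ : _ - _ = (F (c u) - F (c t)) * G (c u) + F (c t) * (G (c u) - G (c t))); last by ring.
  rewrite (le_trans (nmD _ _))// !nmM.
  have a1 : nm (F (c u) - F (c t)) * nm (G (c u)) <= K ^+ 2 * nm (c u - c t).
    by rewrite expr2 mulrAC ler_pM ?nm_ge0 ?h3 ?k1.
  have a2 : nm (F (c t)) * nm (G (c u) - G (c t)) <= K ^+ 2 * nm (c u - c t).
    by rewrite expr2 -mulrA ler_pM ?nm_ge0 ?h1 ?k3.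
  apply: le_trans (lerD a1 a2) _; rewrite -mulrDl ler_wpM2r ?nm_ge0//; lra.
- rewrite (_ : _ - _ =
    (F (c u) - F (c t) - f (c w) * (c u - c t)) * G (c u)
    + f (c w) * (c u - c t) * (G (c u) - G (c w))
    + F (c t) * (G (c u) - G (c t) - g (c w) * (c u - c t))
    + (F (c t) - F (c w)) * (g (c w) * (c u - c t))); last by ring.
  set S := nm (c u - c w) + nm (c t - c w); set D := nm (c u - c t).
  have D0 : 0 <= D by rewrite nm_ge0.
  have S1 : nm (c u - c w) <= S by rewrite lerDl nm_ge0.
  have S2 : nm (c t - c w) <= S by rewrite lerDr nm_ge0.
  have S0 : 0 <= S by rewrite addr_ge0 ?nm_ge0.
  have a1 : nm ((F (c u) - F (c t) - f (c w) * (c u - c t)) * G (c u)) <= K ^+ 2 * S * D.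
    rewrite nmM (_ : K ^+ 2 * S * D = K * S * D * K); last by ring.
    by rewrite ler_pM ?nm_ge0 ?h4 ?k1.
  have a2 : nm (f (c w) * (c u - c t) * (G (c u) - G (c w))) <= K ^+ 2 * S * D.
    rewrite !nmM (_ : K ^+ 2 * S * D = K * D * (K * S)); last by ring.
    rewrite ler_pM ?mulr_ge0 ?nm_ge0//; first by rewrite ler_pM ?nm_ge0 ?h2.
    by rewrite (le_trans (k3 _ w01 _ u01))// ler_wpM2l.
  have a3 : nm (F (c t) * (G (c u) - G (c t) - g (c w) * (c u - c t))) <= K ^+ 2 * S * D.
    rewrite nmM (_ : K ^+ 2 * S * D = K * (K * S * D)); last by ring.
    by rewrite ler_pM ?nm_ge0 ?h1 ?k4.
  have a4 : nm ((F (c t) - F (c w)) * (g (c w) * (c u - c t))) <= K ^+ 2 * S * D.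
    rewrite !nmM (_ : K ^+ 2 * S * D = K * S * (K * D)); last by ring.
    rewrite ler_pM ?mulr_ge0 ?nm_ge0//; last by rewrite ler_pM ?nm_ge0 ?k2.
    by rewrite (le_trans (h3 _ w01 _ t01))// ler_wpM2l.
  apply: le_trans (nmD _ _) _; apply: le_trans (lerD (nmD _ _) (lexx _)) _.
  apply: le_trans (lerD (lerD (nmD _ _) (lexx _)) (lexx _)) _.
  lra.
Qed.

Lemma primitive_inv F f (m : R) : 0 < m -> ontrace (fun u => m <= nm (F u)) ->
  primitive F f -> primitive (fun x => (F x)^-1) (fun x => - f x / F x ^+ 2).
Proof.
move=> m0 hm [K0 K00 hF]; pose K := K0 + 1 + m^-1.
have mi0 : 0 < m^-1 by rewrite invr_gt0.
have KK : K0 <= K by rewrite /K; lra.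
have K1 : 1 <= K by rewrite /K; lra.
have mK : m^-1 <= K by rewrite /K; lra.
have K_gt0 : 0 < K by rewrite (lt_le_trans ltr01).
have Kp := ltW K_gt0.
have [h1 h2 h3 h4] := primitiveW K00 KK hF.
have F0 t : 0 <= t <= 1 -> F (c t) != 0.
  by move=> /hm mt; rewrite -nm_gt0 (lt_le_trans m0).
have i1 t : 0 <= t <= 1 -> nm (F (c t))^-1 <= K.
  move=> t01; rewrite nmV (le_trans _ mK)// lef_pV2 ?posrE// ?nm_gt0 ?F0//.
  exact: hm.
have KX n : (n < 7)%N -> K ^+ n <= K ^+ 7 by move=> n7; apply: ler_weXn2l => //; exact: ltnW.
exists (4 * K ^+ 7); first by rewrite mulr_gt0// exprn_gt0.
have K7 : 0 <= K ^+ 7 by rewrite exprn_ge0.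
split=> [t t01|t t01|t t01 u u01|t t01 u u01 w w01].
- have := i1 t t01; have := KX 1%N isT; rewrite expr1; lra.
- rewrite mulNr nmN nmM -exprVn expr2 nmM.
  have : nm (f (c t)) * (nm (F (c t))^-1 * nm (F (c t))^-1) <= K * (K * K).
    by rewrite !ler_pM ?mulr_ge0 ?nm_ge0 ?h2 ?i1.
  have := KX 3%N isT; rewrite !exprS expr0 mulr1; lra.
- rewrite (_ : _ - _ = - (F (c u) - F (c t)) * ((F (c u))^-1 * (F (c t))^-1)); last first.
    by field; rewrite !F0.
  rewrite nmM nmN nmM.
  have : nm (F (c u) - F (c t)) * (nm (F (c u))^-1 * nm (F (c t))^-1) <=
    K * nm (c u - c t) * (K * K).
    by rewrite ler_pM ?mulr_ge0 ?nm_ge0 ?h3// ler_pM ?nm_ge0 ?i1.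
  move=> /le_trans; apply.
  rewrite (_ : _ * _ = K ^+ 3 * nm (c u - c t)); last by ring.
  rewrite ler_wpM2r ?nm_ge0// (le_trans (KX 3%N isT))//; lra.
- set S := nm (c u - c w) + nm (c t - c w); set D := nm (c u - c t).
  have D0 : 0 <= D by rewrite nm_ge0.
  have S1 : nm (c u - c w) <= S by rewrite lerDl nm_ge0.
  have S2 : nm (c t - c w) <= S by rewrite lerDr nm_ge0.
  have S0 : 0 <= S by rewrite addr_ge0 ?nm_ge0.
  rewrite (_ : _ - _ = - (F (c u) - F (c t) - f (c w) * (c u - c t)) *
     ((F (c u))^-1 * (F (c t))^-1) + (f (c w) * (c u - c t)) *
     (F (c t) * (F (c u) - F (c w)) + F (c w) * (F (c t) - F (c w))) *
     (((F (c w))^-1 * (F (c w))^-1) * ((F (c u))^-1 * (F (c t))^-1))); last first.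
    by field; rewrite !F0.
  have a1 : nm (- (F (c u) - F (c t) - f (c w) * (c u - c t)) *
     ((F (c u))^-1 * (F (c t))^-1)) <= K ^+ 3 * (S * D).
    rewrite !nmM nmN (_ : K ^+ 3 * (S * D) = K * S * D * (K * K)); last by ring.
    by rewrite ler_pM ?mulr_ge0 ?nm_ge0 ?h4// ler_pM ?nm_ge0 ?i1.
  have a2 : nm ((f (c w) * (c u - c t)) *
     (F (c t) * (F (c u) - F (c w)) + F (c w) * (F (c t) - F (c w))) *
     (((F (c w))^-1 * (F (c w))^-1) * ((F (c u))^-1 * (F (c t))^-1))) <=
     2 * K ^+ 7 * (S * D).
    rewrite !nmM (_ : 2 * K ^+ 7 * (S * D) =
      K * D * (K * (K * S) + K * (K * S)) * (K * K * (K * K))); last by ring.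
    rewrite ler_pM ?mulr_ge0 ?nm_ge0//.
      rewrite ler_pM ?mulr_ge0 ?nm_ge0//; first by rewrite ler_pM ?nm_ge0 ?h2.
      rewrite (le_trans (nmD _ _))// !nmM lerD// ler_pM ?nm_ge0 ?h1//.
        by rewrite (le_trans (h3 _ w01 _ u01))// ler_wpM2l.
      by rewrite (le_trans (h3 _ w01 _ t01))// ler_wpM2l.
    by rewrite !ler_pM ?mulr_ge0 ?nm_ge0 ?i1.
  have a3 : K ^+ 3 * (S * D) <= K ^+ 7 * (S * D).
    by rewrite ler_wpM2r ?mulr_ge0// KX.
  have a4 : 0 <= K ^+ 7 * (S * D) by rewrite !mulr_ge0.
  apply: le_trans (nmD _ _) _; apply: le_trans (lerD a1 a2) _.
  rewrite (_ : 4 * K ^+ 7 * S * D = 4 * (K ^+ 7 * (S * D))); last by ring.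
  lra.
Qed.
End Primitives.

(** * Winding numbers *)

Section Winding.
Variables (R : realType) (c : R -> cplx R) (M : R).
Local Notation C := (cplx R).
Implicit Types (F G f g : C -> C).
Hypotheses (cw : wcont c) (cl : c 0 = c 1) (cM : variation_le c M).

Lemma cint_exists f : ontrace c (fun x => {for x, continuous f}) ->
  exists l, rs_int (f \o c) c l.
Proof.
move=> fc; apply: (rs_int_exists (M := M)) => //; last exact: wcont_ucont.
by apply: wcont_ucont; exact: wcont_comp.
Qed.

Lemma contour_int_eq f l : is_contour_int f c l -> contour_int f c = l.
Proof.
move=> /[dup] h /contour_intE h'; apply: rs_int_unique h'; apply/contour_intE.
by apply: (@xgetPex _ 0 [set l | is_contour_int f c l]); exists l.
Qed.

Lemma primitive_ext F f g : ontrace c (fun x => f x = g x) ->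
  primitive c F f -> primitive c F g.
Proof.
move=> fg [K K0 [h1 h2 h3 h4]]; exists K => //; split=> //.
  by move=> t t01; rewrite -fg// h2.
by move=> t t01 u u01 w w01; rewrite -fg// h4.
Qed.

Lemma primitiveX F f n : primitive c F f ->
  primitive c (fun x => F x ^+ n) (fun x => n%:R * F x ^+ n.-1 * f x).
Proof.
move=> Ff; elim: n => [|n IH].
  apply: primitive_ext (primitive_cst c 1) => t _; by rewrite !mul0r.
under eq_fun do rewrite exprS.
apply: primitive_ext (primitiveM Ff IH) => t _ /=.
case: n {IH} => [|n]; first by rewrite expr0; ring.
by rewrite /= exprS -[n.+2]addn1 natrD; ring.
Qed.

(** The integrand is the derivative of F^(n+1)/(n+1). Taking F = x, 1/(x - p) and 1/(s/x - p) covers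
    every exact form that occurs below. *)
Lemma cint_pow F f n : primitive c F f ->
  rs_int (fun t => F (c t) ^+ n * f (c t)) c 0.
Proof.
move=> /(primitiveX n.+1)/(primitive_cint cw cl cM).
move=> /(rs_intZ n.+1%:R^-1); rewrite mulr0; apply: rs_int_ext => t _ /=.
by rewrite -mulrA mulKf// pnatr_eq0.
Qed.

Definition avoids (p : C) := ontrace c (fun x => x != p).

Lemma avoids_lower p : avoids p ->
  exists2 m : R, 0 < m & ontrace c (fun x => m <= nm (x - p)).
Proof.
move=> hp; have h : wcont ((fun x => x - p) \o c).
  apply: wcont_comp => // t _; apply: continuousB; first exact: cvg_id.
  exact: cst_continuous.
have [|m m0 hm] := wcont_lower h; last by exists m.
by move=> t /hp; rewrite /= subr_eq0.
Qed.

Lemma primitive_subV p : avoids p ->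
  primitive c (fun x => (x - p)^-1) (fun x => - (x - p)^-1 ^+ 2).
Proof.
move=> /avoids_lower[m m0 hm].
have /(primitive_inv m0) := primitiveD (primitive_id cw) (primitive_cst c (- p)).
move=> /(_ hm); apply: primitive_ext => t _.
by rewrite addr0 mulN1r exprVn.
Qed.

Lemma cint_xn n : rs_int (fun t => c t ^+ n) c 0.
Proof.
have := cint_pow n (primitive_id cw); apply: rs_int_ext => t _.
by rewrite mulr1.
Qed.

Lemma cint_subV n p : avoids p -> rs_int (fun t => (c t - p)^-1 ^+ n.+2) c 0.
Proof.
move=> /primitive_subV/(cint_pow n)/(rs_intZ (-1)); rewrite mulr0.
apply: rs_int_ext => t _; rewrite !exprS expr0; ring.
Qed.

(** The pullback of a pole of order at least 2 under x -> s/x: the derivative of F = 1/(s/x - p) is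
    F^2 s/x^2, so the integrand is F^n F'. *)
Lemma cint_pull n p (s : C) : avoids 0 -> ontrace c (fun x => s / x != p) ->
  rs_int (fun t => (s / c t - p)^-1 ^+ n.+2 * (s / c t ^+ 2)) c 0.
Proof.
move=> h0 hp.
have h1 := primitiveD (primitiveM (primitive_cst c s) (primitive_subV h0)) (primitive_cst c (- p)).
have w1 : wcont ((fun x => s * x^-1 + - p) \o c).
  apply: wcont_comp => // t t01; apply: continuousD; last exact: cst_continuous.
  apply: continuousM; first exact: cst_continuous.
  by apply: inv_continuous; exact: h0.
have [|m m0 hm'] := wcont_lower w1.
  by move=> t t01; rewrite /= subr_eq0 hp.
have hm : ontrace c (fun x => m <= nm (s * (x - 0)^-1 + - p)).
  by move=> t /hm'; rewrite subr0.
have := cint_pow n (primitive_inv m0 hm h1); apply: rs_int_ext => t t01.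
by rewrite subr0 !exprS !expr0 !mulr1 !invfM; ring.
Qed.

Lemma half_small (K e : R) : 0 < e -> exists n : nat, (1 / 2) ^+ n * K <= e.
Proof.
move=> e0; have : (fun n : nat => (1 / 2 : R) ^+ n * K) @ \oo --> (0 * K).
  apply: cvgM; last exact: cvg_cst.
  by apply: cvg_expr; rewrite ger0_norm//; lra.
move/cvgrPdist_lt => /(_ e e0)[n _ hn]; exists n.
have := hn n (leqnn n); rewrite mul0r sub0r normrN => /ltW.
exact: le_trans (ler_norm _).
Qed.

(** Expand 1/(x - p') in powers of (p' - p)/(x - p): every term but the first is exact. The radius
    m/2 makes the ratio of the geometric series at most 1/2 on the curve. *)
Lemma winding_loc p : avoids p -> exists2 d : R, 0 < d & forall p',
  nm (p' - p) < d -> forall l, rs_int (fun t => (c t - p)^-1) c l ->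
    rs_int (fun t => (c t - p')^-1) c l.
Proof.
move=> hp; have [m m0 hm] := avoids_lower hp.
exists (m / 2); first by rewrite divr_gt0.
move=> p' pp' l hl; apply: rs_int_approx cM _ => e e0.
have hm' t : 0 <= t <= 1 -> m / 2 <= nm (c t - p').
  move=> t01; have := nm_distD p' (c t) p; have := hm t t01.
  by move: pp'; lra.
have [n hn] := half_small (2 / m) e0.
exists (fun t => \sum_(k < n.+1) (p' - p) ^+ k * (c t - p)^-1 ^+ k.+1), (l + \sum_(k < n) 0).
split.
- under eq_fun do rewrite big_ord_recl /= expr0 mul1r expr1.
  apply: rs_intD hl _; apply: rs_int_sum => k.
  rewrite -[X in rs_int _ _ X](mulr0 ((p' - p) ^+ (lift ord0 k))).
  by apply: rs_intZ; exact: cint_subV.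
- by rewrite big1// addr0 subrr nm0.
- move=> t t01.
  have a0 : c t - p != 0 by rewrite subr_eq0 hp.
  have b0 : c t - p' != 0.
    by rewrite -nm_gt0 (lt_le_trans _ (hm' t t01))// divr_gt0.
  have -> : (c t - p')^-1 - \sum_(k < n.+1) (p' - p) ^+ k * (c t - p)^-1 ^+ k.+1 =
      ((p' - p) / (c t - p)) ^+ n.+1 * (c t - p')^-1.
    elim: n {hn} => [|n IH].
      by rewrite big_ord_recl big_ord0 addr0 expr0 !expr1; field; rewrite a0 b0.
    rewrite big_ord_recr/= opprD addrA IH !exprMn !exprS.
    set x := (p' - p) ^+ n; set y := (c t - p)^-1 ^+ n.
    by field; rewrite a0 b0.
  rewrite nmM nmX nmM !nmV; apply: le_trans hn.
  have q2 : nm (p' - p) / nm (c t - p) <= 1 / 2.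
    rewrite ler_pdivrMr ?nm_gt0//; have := hm t t01; move: pp'; lra.
  rewrite ler_pM ?exprn_ge0 ?invr_ge0 ?divr_ge0 ?nm_ge0//.
    rewrite exprS -[leRHS]mul1r ler_pM ?exprn_ge0 ?divr_ge0 ?nm_ge0//; first lra.
    by rewrite lerXn2r ?nnegrE ?divr_ge0 ?nm_ge0.
  by rewrite -invf_div lef_pV2 ?posrE ?nm_gt0 ?divr_gt0 ?hm'.
Qed.

(** For |p| more than twice the bound of the curve, 1/(x - p) is a uniform limit of polynomials in
    x, which integrate to zero. *)
Lemma winding_far : exists2 B : R, 0 < B & forall p, B < nm p ->
  rs_int (fun t => (c t - p)^-1) c 0.
Proof.
have [B B0 hB] := wcont_bounded cw.
exists (2 * B); first by rewrite mulr_gt0.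
move=> p pB; apply: rs_int_approx cM _ => e e0.
have p0 : p != 0 by rewrite -nm_gt0 (lt_trans _ pB)// mulr_gt0.
have [n hn] := half_small B^-1 e0.
exists (fun t => \sum_(k < n) - p^-1 ^+ k.+1 * c t ^+ k), (\sum_(k < n) 0).
split.
- apply: rs_int_sum => k; rewrite -[X in rs_int _ _ X](mulr0 (- p^-1 ^+ k.+1)).
  by apply: rs_intZ; exact: cint_xn.
- by rewrite big1// subrr nm0.
- move=> t t01; have tB := hB t t01.
  have b1 : B <= nm (c t - p).
    have := nmD (c t - p) (- c t); rewrite addrAC subrr add0r !nmN.
    by move: tB pB; lra.
  have b0 : c t - p != 0 by rewrite -nm_gt0 (lt_le_trans _ b1).
  have -> : (c t - p)^-1 - \sum_(k < n) - p^-1 ^+ k.+1 * c t ^+ k =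
      (c t / p) ^+ n * (c t - p)^-1.
    elim: n {hn} => [|n IH].
      by rewrite big_ord0 subr0 expr0 mul1r.
    rewrite big_ord_recr/= opprD addrA IH !exprMn !exprS.
    set x := p^-1 ^+ n; set y := c t ^+ n.
    by field; rewrite p0 b0.
  rewrite nmM nmX nmM !nmV; apply: le_trans hn.
  have q2 : nm (c t) / nm p <= 1 / 2.
    rewrite ler_pdivrMr ?nm_gt0//; move: pB tB; lra.
  rewrite ler_pM ?exprn_ge0 ?invr_ge0 ?divr_ge0 ?nm_ge0//.
    by rewrite lerXn2r ?nnegrE ?divr_ge0 ?nm_ge0.
  by rewrite lef_pV2 ?posrE ?nm_gt0.
Qed.

Lemma avoidsP p : ~ curve_trace c p <-> avoids p.
Proof.
split=> [h t t01|h [t]]; last first.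
  by rewrite /= in_itv/= => /h + e; rewrite e eqxx.
by apply/eqP => e; apply: h; exists t; rewrite //= in_itv.
Qed.

Lemma cint_ext_exists p : avoids p -> exists l, rs_int (fun t => (c t - p)^-1) c l.
Proof.
move=> hp; have [|l hl] := @cint_exists (fun x => (x - p)^-1); last by exists l.
move=> t t01; apply: continuousV; first by rewrite subr_eq0 hp.
by apply: continuousB; [exact: cvg_id|exact: cst_continuous].
Qed.

(** The points with vanishing integral form a subset of the component that is open and closed by
    [winding_loc]. The component is unbounded, so it reaches the points treated by [winding_far]. *)
Lemma winding_exterior p : curve_exterior c p ->
  rs_int (fun t => (c t - p)^-1) c 0.
Proof.
move=> [pT pU]; set A := connected_component _ p in pU.
pose S : set C := [set z | rs_int (fun t => (c t - z)^-1) c 0].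
have AT z : A z -> avoids z.
  by move=> /(@connected_component_sub C (~` curve_trace c) p)/avoidsP.
suff AS : A `&` S = A.
  have : (A `&` S) p by rewrite AS; exact: connected_component_refl.
  by case.
apply: (@component_connected C (~` curve_trace c) p).
- have [B B0 hB] := winding_far.
  apply: contrapT => AS; apply: pU.
  exists (B%:C)%C; split; first by rewrite complex_real.
  move=> x Bx z Az; apply: le_trans (ltW Bx).
  suff : `|z : C| <= (B%:C)%C by [].
  rewrite nmE lecR leNgt; apply/negP => /hB Sz.
  by apply: AS; exists z.
- exists (interior S); first exact: open_interior.
  apply/seteqP; split=> [z [Az Sz]|z [Az /nbhs_singleton Sz]]; split=> //.
  have [d d0 hd] := winding_loc (AT _ Az).
  apply/near_nmP; exists d => // x; rewrite nmB => /hd; exact.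
- exists (closure S); first exact: closed_closure.
  apply/seteqP; split=> [z [Az Sz]|z [Az cz]]; split=> //.
    exact: subset_closure.
  have [d d0 hd] := winding_loc (AT _ Az).
  have [x [Sx]] : S `&` [set x | nm (x - z) < d] !=set0.
    apply: cz; apply/near_nmP; exists d => // x; by rewrite nmB.
  move=> /= /hd hx; have [l hl] := cint_ext_exists (AT _ Az).
  by rewrite /S/= (rs_int_unique Sx (hx _ hl)).
Qed.

(** The value is prescribed by [counterclockwise]; what remains is that the integral exists, so that
    [contour_int] is a limit and not the default 0. *)
Lemma winding_interior p : counterclockwise c -> curve_interior c p ->
  rs_int (fun t => (c t - p)^-1) c (two_pi_i R).
Proof.
move=> cc pI; have := cc _ pI.
have [l hl] : exists l, rs_int (fun t => (c t - p)^-1) c l.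
  by apply: cint_ext_exists; apply/avoidsP; case: pI.
rewrite /winding_number (_ : contour_int _ c = l); last first.
  by apply: contour_int_eq; apply/contour_intE.
(* If [two_pi_i] were 0, the winding number would be 0 instead of 1. *)
have [->|i0] := eqVneq (two_pi_i R) 0.
  by rewrite invr0 mul0r => /esym/eqP; rewrite oner_eq0.
by move=> h; rewrite -[two_pi_i R]mulr1 -h mulVKf.
Qed.
End Winding.

(** * Rational functions under x -> s / x *)

Section Reflection.
Variables (R : realType) (c : R -> cplx R) (M : R) (s : cplx R).
Local Notation C := (cplx R).
Implicit Types (F G f g : C -> C).
Hypotheses (cw : wcont c) (cl : c 0 = c 1) (cM : variation_le c M).
Hypotheses (s0 : s != 0) (cc : counterclockwise c) (c0 : curve_interior c 0).

(** Poles allowed in the substitution x -> s/x: the curve separates [p] from its image. The pole 0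
    is allowed as well, its image being at infinity. *)
Definition paired (p : C) := p = 0 \/ p != 0 /\
  (curve_interior c p /\ curve_exterior c (s / p) \/
   curve_exterior c p /\ curve_interior c (s / p)).

(** A domain common to all rational functions considered, independent of their lists of poles; it
    contains the curve and its image under x -> s/x. *)
Definition offpoles (x : C) := forall p, paired p -> x != p.

Lemma paired_avoids p : paired p -> avoids c p.
Proof.
by case=> [->|[_ [[h _]|[h _]]]]; apply/avoidsP; [case: c0|case: h|case: h].
Qed.

Lemma paired_refl p : p != 0 -> paired p -> paired (s / p).
Proof.
move=> p0 [->|[_ h]]; first by rewrite invr0 mulr0; left.
right; split; first by rewrite mulf_neq0 ?invr_neq0.
by rewrite invf_div mulrCA divff// mulr1; case: h => -[h1 h2]; [right|left].
Qed.

Lemma trace_offpoles : ontrace c offpoles.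
Proof. by move=> t t01 p /paired_avoids; exact. Qed.

Lemma offpoles_neq0 x : offpoles x -> x != 0.
Proof. by apply; left. Qed.

Lemma trace_neq0 : ontrace c (fun x => x != 0).
Proof. by case: c0 => /avoidsP. Qed.

Lemma trace_refl_offpoles : ontrace c (fun x => offpoles (s / x)).
Proof.
move=> t t01 p; have ct0 := trace_neq0 t01.
case: (eqVneq p 0) => [-> _|p0 /(paired_refl p0) hp].
  by rewrite mulf_neq0 ?invr_neq0.
have := trace_offpoles t01 hp; apply: contra => /eqP <-.
by rewrite invf_div mulrCA divff// mulr1.
Qed.

(* Invariance of the form F(x) dx under x -> s / x, up to orientation. *)
Definition refl_inv F := exists l, rs_int (F \o c) c l /\
  rs_int (fun t => F (s / c t) * (s / c t ^+ 2)) c l.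

Lemma refl_inv_ext F G : (forall x, offpoles x -> F x = G x) -> refl_inv F -> refl_inv G.
Proof.
move=> FG [l [h1 h2]]; exists l; split.
  by apply: rs_int_ext h1 => t t01 /=; rewrite FG//; exact: trace_offpoles.
by apply: rs_int_ext h2 => t t01 /=; rewrite FG//; exact: trace_refl_offpoles.
Qed.

Lemma refl_invD F G : refl_inv F -> refl_inv G -> refl_inv (fun x => F x + G x).
Proof.
move=> [l [h1 h2]] [m [k1 k2]]; exists (l + m); split; first exact: rs_intD.
by apply: rs_int_ext (rs_intD h2 k2) => t _; rewrite -mulrDl.
Qed.

Lemma refl_invZ (a : C) F : refl_inv F -> refl_inv (fun x => a * F x).
Proof.
move=> [l [h1 h2]]; exists (a * l); split; first exact: rs_intZ.
by apply: rs_int_ext (rs_intZ a h2) => t _; rewrite mulrA.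
Qed.

Lemma refl_inv_sum (I : Type) (r : seq I) (F : I -> C -> C) :
  (forall i, refl_inv (F i)) -> refl_inv (fun x => \sum_(i <- r) F i x).
Proof.
move=> h; elim: r => [|i r IH].
  exists 0; split.
    by apply: rs_int_ext (rs_int0 c) => t _ /=; rewrite big_nil.
  by apply: rs_int_ext (rs_int0 c) => t _ /=; rewrite big_nil mul0r.
by apply: refl_inv_ext (refl_invD (h i) IH) => x _; rewrite big_cons.
Qed.

Lemma refl_inv_xn n : refl_inv (fun x => x ^+ n).
Proof.
exists 0; split; first exact: (cint_xn cw cl cM).
have h0 : avoids c 0 by apply: paired_avoids; left.
have := rs_intZ (s ^+ n.+1) (cint_subV cw cl cM n h0); rewrite mulr0.
apply: rs_int_ext => t t01; have ct0 := trace_neq0 t01.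
rewrite subr0 !exprS expr0 exprMn; set x := (c t)^-1 ^+ n.
by field.
Qed.

(** Poles of higher order are exact on both sides. For a simple pole the pulled back form gives 2 pi
    i minus the integral at [s / p]: this is 2 pi i - 0 if [p] is inside and 2 pi i - 2 pi i if it
    is outside, as for [p] itself. *)
Lemma refl_inv_pole n p : paired p -> refl_inv (fun x => (x - p)^-1 ^+ n.+1).
Proof.
move=> pp; have pa := paired_avoids pp.
have h0 : avoids c 0 by apply: paired_avoids; left.
case: n => [|n]; last first.
  exists 0; split; first exact: (cint_subV cw cl cM n pa).
  apply: (cint_pull cw cl cM) => // t t01.
  exact: trace_refl_offpoles.
have [l0 hl0] : exists l, rs_int (fun t => (c t - 0)^-1) c l.
  exact: (cint_ext_exists cw cM).
have W0 := winding_interior cw cM cc c0.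
case: pp => [->|[p0 h]].
  exists l0; split; first by apply: rs_int_ext hl0 => t _ /=; rewrite expr1.
  apply: rs_int_ext hl0 => t t01; have ct0 := trace_neq0 t01.
  by rewrite expr1 !subr0; field; rewrite s0 ct0.
have pull : forall l1, rs_int (fun t => (c t - s / p)^-1) c l1 ->
    rs_int (fun t => (s / c t - p)^-1 ^+ 1 * (s / c t ^+ 2)) c (two_pi_i R - l1).
  move=> l1 hl1; have := rs_intD W0 (rs_intZ (-1) hl1); rewrite mulN1r.
  apply: rs_int_ext => t t01; have ct0 := trace_neq0 t01.
  have := trace_refl_offpoles t01 (or_intror (conj p0 h)).
  rewrite -subr_eq0 => h1.
  have h2 : c t - s / p != 0.
    apply: contra h1; rewrite !subr_eq0 => /eqP ->.
    by rewrite invf_div mulrCA divff// mulr1.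
  have e1 : s / c t - p = - p * (c t - s / p) / c t by field; rewrite ct0 p0.
  have e2 : s = p * (c t - (c t - s / p)) by field; rewrite p0.
  rewrite expr1 subr0 e1 [X in _ = _ * (X / _)]e2.
  by move: h2; move: (c t - s / p) => d d0; field; rewrite ct0 p0 d0.
case: h => -[h1 h2].
  exists (two_pi_i R); split; first exact: (winding_interior cw cM cc h1).
  by rewrite -[X in rs_int _ _ X]subr0; apply: pull; exact: (winding_exterior cw cl cM h2).
exists 0; split; first exact: (winding_exterior cw cl cM h1).
by rewrite -(subrr (two_pi_i R)); apply: pull; exact: (winding_interior cw cM cc h2).
Qed.

(** Partial fractions by induction on the number of poles. Two distinct poles p, p' are split by
    1/((x - p)(x - p')) = (1/(x - p) - 1/(x - p'))/(p - p'); if all poles equal p, writing x^(k+1) =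
    (x - p) x^k + p x^k lowers the exponent or the number of poles. *)
Lemma refl_inv_mono n (ps : seq C) k : size ps = n -> (forall p, p \in ps -> paired p) ->
  refl_inv (fun x => x ^+ k / \prod_(p <- ps) (x - p)).
Proof.
elim: n ps k => [|n IH] ps k.
  move=> /size0nil -> _; apply: refl_inv_ext (refl_inv_xn k) => x _.
  by rewrite big_nil divr1.
case: ps => [//|p ps] [sps] hps.
have pp : paired p by apply: hps; rewrite mem_head.
have [/all_pred1P eqp|] := boolP (all (pred1 p) ps).
  rewrite [size _]/= sps in eqp; rewrite eqp.
  have prodE x m : \prod_(q <- nseq m p) (x - q) = (x - p) ^+ m.
    by rewrite big_nseq; elim: m => //= m ->; rewrite exprS.
  elim: k => [|k IHk].
    apply: refl_inv_ext (refl_inv_pole n pp) => x _.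
    by rewrite -[p :: nseq n p]/(nseq n.+1 p) prodE expr0 div1r exprVn.
  have h1 : refl_inv (fun x => x ^+ k / \prod_(q <- nseq n p) (x - q)).
    apply: IH; first by rewrite size_nseq.
    by move=> q; rewrite mem_nseq => /andP[_ /eqP ->].
  apply: refl_inv_ext (refl_invD h1 (refl_invZ p IHk)) => x ox.
  have xp : x - p != 0 by rewrite subr_eq0 ox.
  rewrite -[p :: nseq n p]/(nseq n.+1 p) !prodE [x ^+ k.+1]exprS [_ ^+ n.+1]exprS.
  have : (x - p) ^+ n != 0 by rewrite expf_neq0.
  move: ((x - p) ^+ n) => y y0; field; by rewrite xp y0.
case/allPn => p' p'ps /= pp'.
have p'p : paired p' by apply: hps; rewrite inE p'ps orbT.
have sr : size (rem p' ps) = n.-1 by rewrite size_rem// sps.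
have n0 : (0 < n)%N by rewrite -sps; case: (ps) p'ps.
have hr q : q \in rem p' ps -> paired q.
  by move=> /mem_rem h; apply: hps; rewrite inE h orbT.
have h1 : refl_inv (fun x => x ^+ k / \prod_(q <- p :: rem p' ps) (x - q)).
  apply: IH; first by rewrite /= sr prednK.
  by move=> q; rewrite inE => /predU1P[->|/hr].
have h2 : refl_inv (fun x => x ^+ k / \prod_(q <- p' :: rem p' ps) (x - q)).
  apply: IH; first by rewrite /= sr prednK.
  by move=> q; rewrite inE => /predU1P[->|/hr].
apply: refl_inv_ext (refl_invZ (p - p')^-1 (refl_invD h1 (refl_invZ (-1) h2))) => x ox.
have xp : x - p != 0 by rewrite subr_eq0 ox.
have xp' : x - p' != 0 by rewrite subr_eq0 ox.
have pd : p - p' != 0 by rewrite subr_eq0 eq_sym.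
rewrite [in RHS]big_cons (perm_big _ (perm_to_rem p'ps)) !big_cons.
have : \prod_(q <- rem p' ps) (x - q) != 0.
  rewrite prodf_seq_neq0; apply/allP => q /hr qp /=.
  by rewrite subr_eq0 ox.
move: (\prod_(q <- _) _) => y y0.
by field; rewrite xp xp' pd y0.
Qed.

Definition rational F := exists (ps : seq C) (num : {poly C}),
  (forall p, p \in ps -> paired p) /\
  forall x, offpoles x -> F x = num.[x] / \prod_(p <- ps) (x - p).

Lemma rational_refl_inv F : rational F -> refl_inv F.
Proof.
case=> ps [num [hps hF]].
apply: (@refl_inv_ext (fun x => \sum_(i < size num) num`_i * (x ^+ i / \prod_(p <- ps) (x - p)))).
  move=> x ox; rewrite hF// horner_coef mulr_suml.
  by apply: eq_bigr => i _; rewrite mulrA.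
by apply: refl_inv_sum => i; apply: refl_invZ; exact: refl_inv_mono.
Qed.

Lemma rational_ext F G : (forall x, offpoles x -> F x = G x) -> rational F -> rational G.
Proof.
by move=> FG [ps [num [h1 h2]]]; exists ps, num; split=> // x ox; rewrite -FG// h2.
Qed.

Lemma rational_cst (a : C) : rational (fun=> a).
Proof. by exists [::], a%:P; split=> // x _; rewrite big_nil hornerC divr1. Qed.

Lemma rational_id : rational id.
Proof. by exists [::], 'X; split=> // x _; rewrite big_nil hornerX divr1. Qed.

Lemma rational_subV p : paired p -> rational (fun x => (x - p)^-1).
Proof.
move=> pp; exists [:: p], 1; split=> [q|x _]; first by rewrite inE => /eqP ->.
by rewrite big_seq1 hornerC div1r.
Qed.

Lemma rationalM F G : rational F -> rational G -> rational (fun x => F x * G x).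
Proof.
move=> [ps [n [h1 h2]]] [qs [m [k1 k2]]]; exists (ps ++ qs), (n * m); split=> [p|x ox].
  by rewrite mem_cat => /orP[/h1|/k1].
by rewrite h2// k2// big_cat/= hornerM invfM mulrACA.
Qed.

Lemma rationalD F G : rational F -> rational G -> rational (fun x => F x + G x).
Proof.
move=> [ps [n [h1 h2]]] [qs [m [k1 k2]]].
exists (ps ++ qs), (n * \prod_(q <- qs) ('X - q%:P) + m * \prod_(p <- ps) ('X - p%:P)).
have nz (rs : seq C) x : offpoles x -> (forall p, p \in rs -> paired p) ->
    \prod_(p <- rs) (x - p) != 0.
  move=> ox hr; rewrite prodf_seq_neq0; apply/allP => p /hr pp /=.
  by rewrite subr_eq0 ox.
split=> [p|x ox]; first by rewrite mem_cat => /orP[/h1|/k1].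
rewrite h2// k2// big_cat/= hornerD !hornerM !horner_prod.
under [X in _ = (_ * X + _) / _]eq_bigr do rewrite hornerXsubC.
under [X in _ = (_ + _ * X) / _]eq_bigr do rewrite hornerXsubC.
by rewrite addf_div ?nz.
Qed.

Lemma rational_prod (I : Type) (r : seq I) (F : I -> C -> C) :
  (forall i, rational (F i)) -> rational (fun x => \prod_(i <- r) F i x).
Proof.
move=> h; elim: r => [|i r IH].
  by apply: rational_ext (rational_cst 1) => x _; rewrite big_nil.
by apply: rational_ext (rationalM (h i) IH) => x _; rewrite big_cons.
Qed.

Lemma rational_sum (I : Type) (r : seq I) (F : I -> C -> C) :
  (forall i, rational (F i)) -> rational (fun x => \sum_(i <- r) F i x).
Proof.
move=> h; elim: r => [|i r IH].
  by apply: rational_ext (rational_cst 0) => x _; rewrite big_nil.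
by apply: rational_ext (rationalD (h i) IH) => x _; rewrite big_cons.
Qed.

Lemma rational_inv : rational (fun x => x^-1).
Proof.
apply: rational_ext (rational_subV (or_introl (erefl 0))) => x _.
by rewrite subr0.
Qed.

Lemma rationalX F n : rational F -> rational (fun x => F x ^+ n).
Proof.
move=> hF; elim: n => [|n IH]; first exact: rational_cst.
by apply: rational_ext (rationalM hF IH) => x _; rewrite exprS.
Qed.

Lemma rational_exprz (k : int) : rational (fun x => x ^ k).
Proof.
case: k => n; first exact: rationalX rational_id.
apply: rational_ext (rationalX n.+1 rational_inv) => x _.
by rewrite NegzE -exprz_inv -exprnP.
Qed.

Lemma rational_inv_lin (e : C) : e != 0 -> paired e^-1 -> rational (fun x => (1 - e * x)^-1).
Proof.
move=> e0 pe; have := rationalM (rational_cst (- e^-1)) (rational_subV pe).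
apply: rational_ext => x ox.
have -> : 1 - e * x = - e * (x - e^-1) by field.
by rewrite invfM invrN.
Qed.

Lemma rational_inv_linV (e : C) : paired e -> rational (fun x => (1 - e / x)^-1).
Proof.
move=> pe; have := rationalM rational_id (rational_subV pe).
apply: rational_ext => x ox.
have x0 := offpoles_neq0 ox; have xe : x - e != 0 by rewrite subr_eq0 ox.
have -> : 1 - e / x = (x - e) / x by field.
by rewrite invf_div.
Qed.
End Reflection.

(** * Infinite q-products and symmetric weights *)

Section QPochhammer.
Variables (R : realType) (q : cplx R).
Local Notation C := (cplx R).
Hypothesis q1 : nm q < 1.
Local Notation r := (nm q).

Definition qpoch (n : nat) (y : C) : C := \prod_(j < n) (1 - y * q ^+ j).

(** Tail constant on the disc |y| <= B: the bound exp(B/(1 - r)) of the partial products times the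
    sum of the series B r^j. *)
Definition qbound (B : R) : R := expR (B / (1 - r)) * B / (1 - r).

Lemma r1_gt0 : 0 < 1 - r. Proof. by rewrite subr_gt0. Qed.

Lemma geo_le1 n : 0 <= r ^+ n <= 1.
Proof. by rewrite exprn_ge0 ?nm_ge0// exprn_ile1 ?nm_ge0// ltW. Qed.

Lemma geo_sum n : \sum_(j < n) r ^+ j = (1 - r ^+ n) / (1 - r).
Proof.
elim: n => [|n IH]; first by rewrite big_ord0 expr0 subrr mul0r.
rewrite big_ord_recr/= IH exprS; have := r1_gt0.
by move: (r ^+ n) => x h; field; rewrite gt_eqF.
Qed.

Lemma qpoch_bound B n y : nm y <= B -> nm (qpoch n y) <= expR (B / (1 - r)).
Proof.
move=> yB; have B0 : 0 <= B by rewrite (le_trans (nm_ge0 y)).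
have h : nm (qpoch n y) <= expR (B * \sum_(j < n) r ^+ j).
  rewrite mulr_sumr /qpoch; elim: n => [|n IH].
    by rewrite !big_ord0 expR0 nm1.
  rewrite !big_ord_recr/= expRD nmM ler_pM ?nm_ge0//.
  apply: le_trans (expR_ge1Dx _); apply: le_trans (nmD _ _) _.
  by rewrite nm1 lerD2l nmN nmM nmX ler_wpM2r ?exprn_ge0 ?nm_ge0.
apply: le_trans h _; rewrite ler_expR ler_wpM2l// geo_sum.
rewrite -[leRHS]mul1r ler_wpM2r ?invr_ge0 ?(ltW r1_gt0)//.
by rewrite gerBl; case/andP: (geo_le1 n).
Qed.

Lemma qpochS n y : qpoch n.+1 y = qpoch n y * (1 - y * q ^+ n).
Proof. by rewrite /qpoch big_ord_recr. Qed.

Lemma qpoch_cauchy B m k y : nm y <= B ->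
  nm (qpoch (m + k) y - qpoch m y) <= qbound B * r ^+ m.
Proof.
move=> yB; have B0 : 0 <= B by rewrite (le_trans (nm_ge0 y)).
have E0 : 0 <= expR (B / (1 - r)) by exact: expR_ge0.
(* With the extra factor 1 - r^k the induction closes with equality, since each new factor costs at
   most exp(B/(1 - r)) B r^(m + k). *)
have h : nm (qpoch (m + k) y - qpoch m y) <= qbound B * r ^+ m * (1 - r ^+ k).
  elim: k => [|k IH]; first by rewrite addn0 subrr nm0 expr0 subrr mulr0.
  rewrite addnS qpochS (_ : _ - _ = (qpoch (m + k) y - qpoch m y) -
    qpoch (m + k) y * (y * q ^+ (m + k))); last by ring.
  apply: le_trans (nmD _ _) _; rewrite nmN !nmM nmX.
  have : nm (qpoch (m + k) y) * (nm y * r ^+ (m + k)) <= expR (B / (1 - r)) * (B * r ^+ (m + k)).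
    apply: ler_pM; [exact: nm_ge0|by rewrite mulr_ge0 ?exprn_ge0 ?nm_ge0|exact: qpoch_bound|].
    by rewrite ler_wpM2r ?exprn_ge0 ?nm_ge0.
  move=> h2; apply: le_trans (lerD IH h2) _.
  rewrite le_eqVlt; apply/orP; left; apply/eqP.
  rewrite /qbound exprD exprS; have := r1_gt0.
  move: (r ^+ m) (r ^+ k) (expR _) => a b e rr; field.
  by rewrite gt_eqF.
apply: le_trans h _; have /andP[k0 k1] := geo_le1 k; have /andP[m0 m1] := geo_le1 m.
rewrite ler_piMr// ?gerBl//.
by rewrite mulr_ge0// /qbound divr_ge0 ?mulr_ge0// ltW// r1_gt0.
Qed.

Lemma geo_small (K e : R) : 0 < e -> exists N, forall n, (N <= n)%N -> K * r ^+ n < e.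
Proof.
move=> e0; have : (fun n : nat => K * r ^+ n) @ \oo --> (K * 0).
  apply: cvgM; first exact: cvg_cst.
  by apply: cvg_expr; rewrite ger0_norm// nm_ge0.
move/cvgrPdist_lt => /(_ e e0)[N _ hN]; exists N => n /hN.
by rewrite mulr0 sub0r normrN; apply: le_lt_trans; exact: ler_norm.
Qed.

Lemma qpinf_lim y : forall e : R, 0 < e -> exists N, forall n, (N <= n)%N ->
  nm (qpoch n y - qpinf q y) < e.
Proof.
have [l hl] : exists l : C, forall e : R, 0 < e ->
     exists N, forall n, (N <= n)%N -> nm (qpoch n y - l) < e.
  apply: cplx_complete => e e0; have [N hN] := geo_small (qbound (nm y)) e0.
  exists N => m n Nm Nn; wlog mn : m n Nm Nn / (n <= m)%N.
    move=> h; case: (leqP n m) => [|/ltnW] nm; first exact: h.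
    by rewrite nmB; exact: h.
  rewrite -(subnKC mn); apply: le_lt_trans (hN n Nn).
  exact: qpoch_cauchy.
suff -> : qpinf q y = l by [].
apply: cvg_lim => //; apply/cvg_nmP => e /hl[N hN]; exists N => // n /= Nn.
by rewrite nmB; exact: hN.
Qed.

Lemma qpinf_tail B n y : nm y <= B -> nm (qpoch n y - qpinf q y) <= qbound B * r ^+ n.
Proof.
move=> yB; apply/ler_addgt0Pr => e e0; have [N hN] := qpinf_lim y e0.
apply: le_trans (nm_distD (qpoch (n + N) y) _ _) _.
rewrite nmB lerD//; first exact: qpoch_cauchy.
by rewrite ltW// hN// leq_addl.
Qed.

Lemma qpochD n k y : qpoch (n + k) y = qpoch n y * qpoch k (y * q ^+ n).
Proof.
elim: k => [|k IH]; first by rewrite addn0 /qpoch [X in _ = _ * X]big_ord0 mulr1.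
by rewrite addnS !qpochS IH exprD; ring.
Qed.

Lemma qpinf_split n y : qpinf q y = qpoch n y * qpinf q (y * q ^+ n).
Proof.
apply: nm_lim_unique => e e0.
have e2 : 0 < e / 2 by rewrite divr_gt0.
have p1 : 0 < nm (qpoch n y) + 1 by rewrite ltr_wpDl ?nm_ge0.
have [N hN] := qpinf_lim y e2.
have [N' hN'] := qpinf_lim (y * q ^+ n) (divr_gt0 e2 p1).
apply: le_trans (nm_distD (qpoch (n + (N + N')) y) _ _) _.
rewrite [leRHS]splitr lerD//.
  by rewrite nmB ltW// hN// addnCA leq_addr.
rewrite qpochD -mulrBr nmM.
apply: le_trans (_ : nm (qpoch n y) * (e / 2 / (nm (qpoch n y) + 1)) <= _).
  by rewrite ler_wpM2l ?nm_ge0// ltW// hN'// leq_addl.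
rewrite mulrCA ger_pMr// ler_pdivrMr// mul1r lerDl//.
Qed.

Lemma qpinfS y : qpinf q y = (1 - y) * qpinf q (y * q).
Proof. by rewrite (qpinf_split 1) /qpoch big_ord1 expr0 mulr1 expr1. Qed.

Lemma qpinf_eq0 y j : y * q ^+ j = 1 -> qpinf q y = 0.
Proof.
by move=> h; rewrite (qpinf_split j.+1) qpochS h subrr mulr0 mul0r.
Qed.

(** Split off N factors, nonzero by assumption. The remaining product is taken at z = y q^N, so
    small that its distance to 1 is at most K |z| < 1. *)
Lemma qpinf_neq0 y : (forall j, y * q ^+ j != 1) -> qpinf q y != 0.
Proof.
move=> h; pose K := expR (1 / (1 - r)) / (1 - r).
have K0 : 0 < K by rewrite divr_gt0 ?expR_gt0 ?r1_gt0.
have m0 : 0 < Num.min 1 K^-1 by rewrite lt_min ltr01 invr_gt0.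
have [N hN] := geo_small (nm y) m0.
have := hN N (leqnn N); rewrite lt_min => /andP[y1 yK]; rewrite (qpinf_split N) mulf_neq0//.
  by rewrite /qpoch prodf_seq_neq0; apply/allP => j _ /=; rewrite subr_eq0 eq_sym.
set z := y * q ^+ N.
have zE : nm z = nm y * r ^+ N by rewrite nmM nmX.
have := @qpinf_tail (nm z) 0 z (lexx _).
rewrite /qpoch big_ord0 expr0 mulr1 => hz.
apply/negP => /eqP z0; move: hz; rewrite z0 subr0 nm1 leNgt => /negP; apply.
apply: (@le_lt_trans _ _ (K * nm z)).
  rewrite /qbound /K mulrAC ler_wpM2r ?nm_ge0// ler_wpM2r ?invr_ge0 ?(ltW r1_gt0)//.
  rewrite ler_expR ler_wpM2r ?invr_ge0 ?(ltW r1_gt0)// ltW// zE//.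
by rewrite mulrC -ltr_pdivlMr// div1r zE.
Qed.

Lemma qpoch_continuous n : continuous (qpoch n).
Proof.
elim: n => [|n IH] y.
  have -> : qpoch 0 = fun=> 1 by apply/funext => z; rewrite /qpoch big_ord0.
  exact: cst_continuous.
have -> : qpoch n.+1 = fun z => qpoch n z * (1 - z * q ^+ n).
  by apply/funext => z; rewrite qpochS.
apply: continuousM; first exact: IH.
apply: continuousB; first exact: cst_continuous.
exact: mulrr_continuous.
Qed.

Lemma qpinf_continuous : continuous (qpinf q).
Proof.
move=> y; have [+ _] := @cvg_nmP R C (nbhs y) _ (qpinf q) (qpinf q y).
apply=> e e0.
have e3 : 0 < e / 3 by rewrite divr_gt0.
have [N hN] := geo_small (qbound (nm y + 1)) e3.
have hc : {for y, continuous (qpoch N)} by exact: qpoch_continuous.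
have /cvg_nmP/(_ _ e3)/near_nmP[d d0 hd] := hc.
apply/near_nmP; exists (Num.min d 1); first by rewrite lt_min d0 ltr01.
move=> x; rewrite lt_min => /andP[/hd xd x1].
have b1 : nm y <= nm y + 1 by rewrite lerDl.
have b2 : nm x <= nm y + 1.
  have := nmD y (x - y); rewrite addrC subrK nmB; move: x1; lra.
have := qpinf_tail N b1; have := qpinf_tail N b2; have := hN N (leqnn N).
have := nm_distD (qpoch N y) (qpinf q y) (qpinf q x).
have := nm_distD (qpoch N x) (qpoch N y) (qpinf q x).
rewrite [nm (qpinf q y - qpoch N y)]nmB; move: xd; lra.
Qed.
End QPochhammer.

(** * Uniform convergence on the curve *)

Section UniformLimits.
Variables (R : realType) (c : R -> cplx R) (M : R).
Local Notation C := (cplx R).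
Implicit Types (F G : C -> C) (f g : nat -> C -> C).
Hypotheses (cw : wcont c) (cM : variation_le c M).

Lemma wcontM (phi psi : R -> C) : wcont phi -> wcont psi -> wcont (fun t => phi t * psi t).
Proof.
move=> hp hq; have [B B0 hB] := wcont_bounded hp; have [D D0 hD] := wcont_bounded hq.
move=> t t01 e e0.
have k0 : 0 < e / (B + D) by rewrite divr_gt0// addr_gt0.
have [d d0 hd] := hp t t01 _ k0; have [d' d'0 hd'] := hq t t01 _ k0.
exists (Num.min d d'); first by rewrite lt_min d0.
move=> u u01; rewrite lt_min => /andP[/(hd _ u01) h1 /(hd' _ u01) h2].
rewrite (_ : _ - _ = phi t * (psi t - psi u) + (phi t - phi u) * psi u); last by ring.
apply: le_lt_trans (nmD _ _) _; rewrite !nmM.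
have -> : e = B * (e / (B + D)) + (e / (B + D)) * D.
  by field; rewrite gt_eqF// addr_gt0.
apply: le_lt_trans (_ : B * nm (psi t - psi u) + nm (phi t - phi u) * D < _).
  by rewrite lerD// ?ler_wpM2r ?ler_wpM2l ?nm_ge0 ?hB ?hD.
by rewrite ltrD// ?ltr_pM2l ?ltr_pM2r.
Qed.

(** Continuity of the limit is included because it supplies the upper and lower bounds on the curve
    that products and inverses need. *)
Definition ulim f F := wcont (F \o c) /\
  forall e : R, 0 < e -> exists N, forall n, (N <= n)%N ->
    ontrace c (fun x => nm (f n x - F x) < e).

Lemma ulim_cst F : wcont (F \o c) -> ulim (fun=> F) F.
Proof. by move=> Fc; split=> // e e0; exists 0%N => n _ t _; rewrite subrr nm0. Qed.

Lemma ulimM f F g G : ulim f F -> ulim g G ->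
  ulim (fun n x => f n x * g n x) (fun x => F x * G x).
Proof.
move=> [Fc hf] [Gc hg]; split; first exact: (wcontM Fc Gc).
have [B B0 hB] := wcont_bounded Fc; have [D D0 hD] := wcont_bounded Gc.
move=> e e0; have BD : 0 < B + D + 1 by rewrite !addr_gt0.
have k0 : 0 < Num.min 1 (e / (B + D + 1)) by rewrite lt_min ltr01 divr_gt0.
have [N hN] := hf _ k0; have [N' hN'] := hg _ k0.
exists (maxn N N') => n; rewrite geq_max => /andP[/hN h1 /hN' h2] t t01.
have /= := h1 t t01; rewrite lt_min => /andP[l1 l2].
have /= := h2 t t01; rewrite lt_min => /andP[m1 m2].
rewrite (_ : _ - _ = (f n (c t) - F (c t)) * (g n (c t) - G (c t)) +
  (f n (c t) - F (c t)) * G (c t) + F (c t) * (g n (c t) - G (c t))); last by ring.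
apply: le_lt_trans (nmD _ _) _; apply: le_lt_trans (lerD (nmD _ _) (lexx _)) _.
rewrite !nmM; have -> : e = e / (B + D + 1) * 1 + e / (B + D + 1) * D + B * (e / (B + D + 1)).
  by field; rewrite gt_eqF.
apply: le_lt_trans (_ : _ <= nm (f n (c t) - F (c t)) * 1 + nm (f n (c t) - F (c t)) * D
   + B * nm (g n (c t) - G (c t))) _.
  rewrite lerD ?lerD ?ler_wpM2l ?ler_wpM2r ?nm_ge0 ?(ltW m1)//; [exact: hD|exact: hB].
by rewrite ltrD ?ltrD ?ltr_pM2l ?ltr_pM2r.
Qed.

Lemma ulimV f F : ulim f F -> ontrace c (fun x => F x != 0) ->
  ulim (fun n x => (f n x)^-1) (fun x => (F x)^-1).
Proof.
move=> [Fc hf] F0; split.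
  by apply: (wcont_comp Fc) => t t01; apply: inv_continuous; exact: F0.
have [m m0 hm] := wcont_lower Fc F0.
move=> e e0.
have k0 : 0 < Num.min (m / 2) (e * (m / 2) * m) by rewrite lt_min !mulr_gt0// ?divr_gt0.
have [N hN] := hf _ k0; exists N => n /hN h t t01.
have /= := h t t01; rewrite lt_min => /andP[h1 h2].
have mF := hm t t01; rewrite /= in mF.
have mf : m / 2 <= nm (f n (c t)).
  by have := nm_distD (f n (c t)) (F (c t)) 0; rewrite !subr0 nmB; move: mF h1; lra.
have m20 : 0 < m / 2 by rewrite divr_gt0.
have f0 : f n (c t) != 0 by rewrite -nm_gt0 (lt_le_trans _ mf).
have F00 := F0 t t01.
rewrite (_ : _ - _ = - (f n (c t) - F (c t)) / (f n (c t) * F (c t))); last first.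
  by field; rewrite f0 F00.
rewrite nmM nmN nmV nmM ltr_pdivrMr ?mulr_gt0 ?nm_gt0//.
apply: lt_le_trans h2 _; rewrite -mulrA; apply: ler_wpM2l; first exact: ltW.
by apply: ler_pM => //; exact: ltW.
Qed.

Lemma ulim_prod (I : eqType) (r : seq I) (f : I -> nat -> C -> C) (F : I -> C -> C) :
  (forall i, i \in r -> ulim (f i) (F i)) ->
  ulim (fun n x => \prod_(i <- r) f i n x) (fun x => \prod_(i <- r) F i x).
Proof.
elim: r => [|i r IH] h.
  under [X in ulim X]eq_fun => n do under eq_fun do rewrite big_nil.
  under [X in ulim _ X]eq_fun do rewrite big_nil.
  apply: ulim_cst => t t01 e e0; exists 1 => // u _ _ /=.
  by rewrite subrr nm0.
under [X in ulim X]eq_fun => n do under eq_fun do rewrite big_cons.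
under [X in ulim _ X]eq_fun do rewrite big_cons.
apply: ulimM; first by apply: h; rewrite mem_head.
by apply: IH => j jr; apply: h; rewrite inE jr orbT.
Qed.

Lemma ulim_qpinf (q : C) (alpha : C -> C) : nm q < 1 ->
  ontrace c (fun x => {for x, continuous alpha}) ->
  ulim (fun n x => qpoch q n (alpha x)) (fun x => qpinf q (alpha x)).
Proof.
move=> q1 ac; have wa : wcont (alpha \o c) by exact: wcont_comp.
split.
  by apply: (wcont_comp wa (f := qpinf q)) => t t01; exact: qpinf_continuous.
have [B B0 hB] := wcont_bounded wa => e e0.
have [N hN] := geo_small q1 (qbound q B) e0; exists N => n /hN h t t01.
by apply: le_lt_trans h; apply: qpinf_tail => //; exact: hB.
Qed.

Lemma ulim_rs_int f F l : ulim f F -> (forall n, rs_int (f n \o c) c l) ->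
  rs_int (F \o c) c l.
Proof.
move=> [Fc hf] h; apply: rs_int_approx cM _ => e e0.
have [N hN] := hf e e0; exists (f N \o c), l; split=> //.
  by rewrite subrr nm0.
by move=> t t01 /=; rewrite nmB ltW// hN.
Qed.
End UniformLimits.

(** * Weights invariant under x -> s/x *)

Section SymmetricWeight.
Variables (R : realType) (c : R -> cplx R) (M : R) (q s nu : cplx R) (es : seq (cplx R)).
Local Notation C := (cplx R).
Hypotheses (cw : wcont c) (cl : c 0 = c 1) (cM : variation_le c M).
Hypotheses (s0 : s != 0) (cc : counterclockwise c) (c0 : curve_interior c 0).
Hypotheses (q0 : q != 0) (q1 : nm q < 1).
Hypothesis es0 : forall e, e \in es -> e != 0.
Hypothesis esP : forall e, e \in es -> forall j : nat,
  curve_interior c (s * e * q ^+ j) /\ curve_exterior c (e * q ^+ j)^-1.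

(** The common shape of [Delta] times the coefficient of T1 (s = 1, nu = q) and of [Delta] times
    that of T0 (s = q, nu = 1). *)
Definition sym_weight (x : C) : C :=
  qpinf q (nu * x ^+ 2) * qpinf q (nu * (s / x) ^+ 2) *
  (\prod_(e <- es) (qpinf q (e * x) * qpinf q (e * (s / x))))^-1.

Definition sym_weight_trunc n (x : C) : C :=
  qpoch q n (nu * x ^+ 2) * qpoch q n (nu * (s / x) ^+ 2) *
  (\prod_(e <- es) (qpoch q n (e * x) * qpoch q n (e * (s / x))))^-1.

Let trace0 t : 0 <= t <= 1 -> c t != 0.
Proof. exact: (trace_neq0 c0). Qed.

Lemma es_paired e j : e \in es -> paired c s (e * q ^+ j)^-1 /\ paired c s (s * e * q ^+ j).
Proof.
move=> ees; have [h1 h2] := esP ees j.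
have e0 := es0 ees.
have eq0 : e * q ^+ j != 0 by rewrite mulf_neq0 ?expf_neq0.
split; right; (split; first by rewrite ?invr_eq0// -mulrA mulf_neq0).
  by right; rewrite invrK mulrA.
left; split=> //.
suff -> : s / (s * e * q ^+ j) = (e * q ^+ j)^-1 by [].
by rewrite -mulrA [(s * _)^-1]invfM mulrA divff// mul1r.
Qed.

Lemma continuous_divl (x : C) : x != 0 -> {for x, continuous (fun y : C => s / y)}.
Proof.
by move=> x0; apply: continuousM; [exact: cst_continuous|exact: inv_continuous].
Qed.

Lemma continuous_sqr (x : C) : {for x, continuous (fun y : C => y ^+ 2)}.
Proof.
have -> : (fun y : C => y ^+ 2) = (fun y => y * y) by apply/funext => y; rewrite expr2.
by apply: continuousM; exact: cvg_id.
Qed.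

Lemma sym_weight_den_neq0 : ontrace c (fun x =>
  \prod_(e <- es) (qpinf q (e * x) * qpinf q (e * (s / x))) != 0).
Proof.
move=> t t01; have ct0 := trace0 t01.
rewrite prodf_seq_neq0; apply/allP => e ees /=; have e0 := es0 ees.
apply: mulf_neq0; apply: qpinf_neq0 => // j; apply/negP => /eqP h.
  have [/(paired_avoids c0)/(_ t t01)/eqP + _] := es_paired j ees; apply.
  have eq0 : e * q ^+ j != 0 by rewrite mulf_neq0 ?expf_neq0.
  by apply: (mulfI eq0); rewrite divff// -h; ring.
have [_ /(paired_avoids c0)/(_ t t01)/eqP] := es_paired j ees; apply.
by rewrite -[LHS]mul1r -h; field.
Qed.

Lemma sym_weight_ulim : ulim c sym_weight_trunc sym_weight.
Proof.
apply: ulimM; first apply: ulimM.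
- apply: ulim_qpinf => // t t01; apply: continuousM; first exact: cst_continuous.
  exact: continuous_sqr.
- apply: ulim_qpinf => // t t01.
  have -> : (fun x : C => nu * (s / x) ^+ 2) = (fun x => nu * (s / x * (s / x))).
    by apply/funext => x; rewrite expr2.
  apply: continuousM; first exact: cst_continuous.
  by apply: continuousM; exact: (continuous_divl (trace0 t01)).
- apply: ulimV; last exact: sym_weight_den_neq0.
  apply: ulim_prod => e ees; apply: ulimM; apply: ulim_qpinf => // t t01.
    by apply: mulrl_continuous.
  apply: continuousM; first exact: cst_continuous.
  exact: (continuous_divl (trace0 t01)).
Qed.

Lemma sym_weight_trunc_rational n : rational c s (sym_weight_trunc n).
Proof.
have hq (alpha : C -> C) : (forall j, rational c s (fun x => 1 - alpha x * q ^+ j)) ->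
    rational c s (fun x => qpoch q n (alpha x)).
  move=> h; exact: (rational_prod (index_enum 'I_n) (fun j : 'I_n => h j)).
have rc := rational_cst c s; have rx := rational_id c s; have ri := rational_inv c s.
have rsx : rational c s (fun x => s / x) by apply: rationalM (rc s) ri.
have r1 (F : C -> C) a b : rational c s F -> rational c s (fun x => 1 - a * F x * b).
  move=> hF; apply: rational_ext (rationalD (rc 1) (rationalM (rc (- (a * b))) hF)) => x _.
  by ring.
apply: rationalM; first apply: rationalM.
- by apply: hq => j; apply: r1; exact: rationalX.
- by apply: hq => j; apply: r1; exact: rationalX.
apply: rational_ext (_ : rational c s (fun x => \prod_(e <- es) \prod_(j < n)
  ((1 - e * q ^+ j * x)^-1 * (1 - s * e * q ^+ j / x)^-1))).
  move=> x _; rewrite -prodfV; apply: eq_bigr => e _.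
  rewrite /qpoch -big_split/= -prodfV; apply: eq_bigr => j _.
  by rewrite invfM; congr (_^-1 * _^-1); ring.
pose G (j : nat) e x := (1 - e * q ^+ j * x)^-1 * (1 - s * e * q ^+ j / x)^-1.
(* [rational_prod] asks for rationality of every factor, so the factor is set to 1 off [es], where
   nothing is known about the poles. *)
pose H e x := if e \in es then \prod_(j < n) G j e x else 1.
apply: (@rational_ext _ _ _ (fun x => \prod_(e <- es) H e x)) => [x _|].
  by rewrite big_seq [RHS]big_seq; apply: eq_bigr => e ees; rewrite /H ees.
suff rH e : rational c s (H e) by exact: (rational_prod es rH).
rewrite /H; case: (boolP (e \in es)) => [ees|_]; last exact: rc.
suff rG (j : 'I_n) : rational c s (G j e) by exact: (rational_prod (index_enum 'I_n) rG).
have [p1 p2] := es_paired j ees.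
apply: rationalM; last exact: rational_inv_linV.
by apply: rational_inv_lin => //; apply: mulf_neq0; [exact: es0|exact: expf_neq0].
Qed.

Lemma sym_weight_trunc_refl n x : x != 0 -> sym_weight_trunc n (s / x) = sym_weight_trunc n x.
Proof.
move=> x0; have sK : s / (s / x) = x by field; rewrite x0 s0.
rewrite /sym_weight_trunc sK.
congr (_ * _^-1); first by rewrite mulrC.
by apply: eq_bigr => e _; rewrite mulrC.
Qed.

(** For each truncation the substitution preserves the integral, the truncated weight and, up to
    orientation, dx/x, but changes the sign of [H]; the integral equals its opposite. Uniform
    convergence then gives the full weight. *)
Lemma sym_weight_int_odd (H : C -> C) : rational c s H -> wcont (H \o c) ->
  ontrace c (fun x => H (s / x) = - H x) ->
  rs_int (fun t => sym_weight (c t) * (H (c t) / c t)) c 0.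
Proof.
move=> rH cH Hodd.
have wi : wcont ((fun x => x^-1) \o c).
  by apply: wcont_comp => // t t01; apply: inv_continuous; exact: trace0.
have := ulimM sym_weight_ulim (ulim_cst (F := fun x => H x / x) (wcontM cH wi)).
move=> /(ulim_rs_int cM); apply => n.
have := rationalM (sym_weight_trunc_rational n) (rationalM rH (rational_inv c s)).
move=> /(rational_refl_inv cw cl cM s0 cc c0)[l [h1 h2]].
suff l0 : l = 0 by move: h1; rewrite l0.
have : rs_int (fun t => -1 * (sym_weight_trunc n (c t) * (H (c t) / c t))) c l.
  apply: rs_int_ext h2 => t t01; have ct0 := trace0 t01.
  rewrite sym_weight_trunc_refl// Hodd//.
  by field; rewrite s0 ct0.
move=> /(rs_int_unique (rs_intZ (-1) h1)); rewrite mulN1r => /eqP.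
by rewrite eqNr => /eqP.
Qed.
End SymmetricWeight.

(** * Laurent polynomials *)

Section LaurentPolynomials.
Variable R : realType.
Local Notation C := (cplx R).
Implicit Types (f g h : laurent R) (x s : C).

Lemma leval_mmap f x : leval f x = mmap (@idfun C) (fun k => x ^ k) f.
Proof. by rewrite mmapE. Qed.

Lemma levalD f g x : leval (f + g) x = leval f x + leval g x.
Proof. by rewrite !leval_mmap mmapD. Qed.

Lemma levalB f g x : leval (f - g) x = leval f x - leval g x.
Proof. by rewrite !leval_mmap mmapB. Qed.

Lemma levalZ (a : C) f x : leval (a *: f) x = a * leval f x.
Proof.
rewrite !leval_mmap (mmapEw (msuppZ_le _ _)) mmapE mulr_sumr.
by apply: eq_bigr => k _; rewrite mcoeffZ mulrA.
Qed.

Lemma leval0 x : leval (0 : laurent R) x = 0.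
Proof. by rewrite leval_mmap mmap0. Qed.

Lemma leval_sum (I : Type) (r : seq I) (F : I -> laurent R) x :
  leval (\sum_(i <- r) F i) x = \sum_(i <- r) leval (F i) x.
Proof.
elim: r => [|i r IH]; first by rewrite !big_nil leval0.
by rewrite !big_cons levalD IH.
Qed.

Definition lmon (k : int) : laurent R := mkmalgU k 1.

Lemma mcoeff_lmon k j : mcoeff j (lmon k) = (k == j)%:R :> C.
Proof. by rewrite /lmon mcoeffU. Qed.

Lemma leval_lmon k x : leval (lmon k) x = x ^ k.
Proof. by rewrite leval_mmap mmapU mul1r. Qed.

Lemma lone_lmon : lone R = lmon 0. Proof. by []. Qed.

Lemma leval_lone x : leval (lone R) x = 1.
Proof. by rewrite lone_lmon leval_lmon expr0z. Qed.

Lemma mcoeff_sum (I : Type) (r : seq I) (F : I -> laurent R) k :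
  mcoeff k (\sum_(i <- r) F i) = \sum_(i <- r) mcoeff k (F i) :> C.
Proof. exact: raddf_sum. Qed.

(** Linear extension of a map given on monomials; shifts, reflections and products are instances. *)
Definition lext (F : int -> laurent R) f : laurent R :=
  \sum_(k <- msupp f) mcoeff k f *: F k.

Lemma leval_lext F f x : leval (lext F f) x = \sum_(k <- msupp f) mcoeff k f * leval (F k) x.
Proof. by rewrite /lext leval_sum; apply: eq_bigr => k _; rewrite levalZ. Qed.

Lemma mcoeff_lext_bij (u : int -> int) (a : int -> C) f j i :
  injective u -> u j = i ->
  mcoeff i (lext (fun k => a k *: lmon (u k)) f) = mcoeff j f * a j.
Proof.
move=> ui uj; rewrite /lext mcoeff_sum.
rewrite (eq_bigr (fun k => mcoeff k f * (a k * (k == j)%:R))); last first.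
  by move=> k _; rewrite !mcoeffZ mcoeff_lmon -uj (inj_eq ui).
have [jf|jf] := boolP (j \in msupp f); last first.
  rewrite (mcoeff_outdom jf) mul0r big1_seq// => k /andP[_ kf].
  by case: (eqVneq k j) kf jf => [-> ->//|_ _ _]; rewrite !mulr0.
rewrite (bigD1_seq j) ?fset_uniq//= eqxx mulr1 big1 ?addr0// => k /negPf kj.
by rewrite kj !mulr0.
Qed.

Definition lshift (n : int) := lext (fun k => 1 *: lmon (k + n)).

Lemma leval_lshift n f x : x != 0 -> leval (lshift n f) x = x ^ n * leval f x.
Proof.
move=> x0; rewrite leval_lext mulr_sumr; apply: eq_bigr => k _.
by rewrite scale1r leval_lmon expfzDr//; ring.
Qed.

Lemma mcoeff_lshift n f i : mcoeff i (lshift n f) = mcoeff (i - n) f.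
Proof.
by rewrite (@mcoeff_lext_bij (fun k => k + n) _ _ (i - n)) ?mulr1 ?subrK//; exact: addIr.
Qed.

Definition lrefl (s : C) := lext (fun k => s ^ k *: lmon (- k)).

Lemma leval_lrefl s f x : leval (lrefl s f) x = leval f (s / x).
Proof.
rewrite leval_lext; apply: eq_bigr => k _.
by rewrite levalZ leval_lmon -exprz_inv expfzMl.
Qed.

Lemma mcoeff_lrefl s f i : mcoeff i (lrefl s f) = mcoeff (- i) f * s ^ (- i).
Proof. by rewrite (@mcoeff_lext_bij -%R _ _ (- i)) ?opprK//; exact: oppr_inj. Qed.

Definition lmul f g : laurent R := lext (fun k => lshift k g) f.

Lemma leval_lmul f g x : x != 0 -> leval (lmul f g) x = leval f x * leval g x.
Proof.
move=> x0; rewrite leval_lext [leval f x]/leval mulr_suml; apply: eq_bigr => k _.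
by rewrite leval_lshift// mulrA.
Qed.

(** After multiplication by a power of x this is a polynomial, and enough of the integers 1, 2, 3,
    ... lie off [E] to exceed its number of roots. Operator identities can thus be checked pointwise
    away from the zeros of denominators. *)
Lemma leval_eq0 (E : seq C) f :
  (forall x, x != 0 -> x \notin E -> leval f x = 0) -> f = 0.
Proof.
move=> h; apply/malgP => k; rewrite mcoeff0.
pose N := (\sum_(j <- msupp f) `|j|)%N.
have jN j : j \in msupp f -> 0 <= j + N%:Z.
  move=> jf; have : (`|j| <= N)%N by rewrite /N (big_rem _ jf) leq_addr.
  lia.
pose p : {poly C} := \sum_(j <- msupp f) mcoeff j f *: 'X^`|(j + N%:Z)%R|%N.
have pE x : x != 0 -> p.[x] = x ^ N%:Z * leval f x.
  move=> x0; rewrite horner_sum mulr_sumr big_seq [RHS]big_seq.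
  apply: eq_bigr => j /jN j0; rewrite hornerZ hornerXn.
  rewrite mulrCA -expfzDr//; congr (_ * _).
  by rewrite exprnP gez0_abs// addrC.
have p0 : p = 0.
  apply/eqP; apply/negPn/negP => p0.
  pose u n : C := n.+1%:R.
  have ui : injective u by move=> m n /(mulrIn (oner_neq0 _)) [].
  pose L := (size E + size p)%N.
  pose rs := [seq x <- [seq u i | i <- iota 0 L] | x \notin E].
  have rsu : uniq rs by rewrite filter_uniq// map_inj_uniq// iota_uniq.
  have rsr : all (root p) rs.
    apply/allP => x; rewrite mem_filter => /andP[xE /mapP[i _ xi]].
    have x0 : x != 0 by rewrite xi pnatr_eq0.
    by rewrite /root pE// h// mulr0.
  have := max_poly_roots p0 rsr rsu; rewrite ltnNge => /negP; apply.
  have e1 : size [seq u i | i <- iota 0 L] = L by rewrite size_map size_iota.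
  have : (size [seq x <- [seq u i | i <- iota 0 L] | x \in E] <= size E)%N.
    apply: uniq_leq_size; first by rewrite filter_uniq// map_inj_uniq// iota_uniq.
    by move=> x; rewrite mem_filter => /andP[].
  have := count_predC (fun x => x \in E) [seq u i | i <- iota 0 L].
  rewrite e1 /rs !size_filter /L.
  rewrite (@eq_count _ (predC (fun x => x \in E)) (fun x => x \notin E))//.
  move=> h1 h2; rewrite -(leq_add2l (count (fun x => x \in E) [seq u i | i <- iota 0 L])).
  by rewrite h1 leq_add2r.
have [kf|kf] := boolP (k \in msupp f); last exact: mcoeff_outdom.
have : p`_(`|(k + N%:Z)%R|%N) = 0 by rewrite p0 coef0.
rewrite coef_sum (bigD1_seq k) ?fset_uniq//= coefZ coefXn eqxx mulr1 big_seq_cond big1 ?addr0//.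
move=> j /andP[jf jk]; rewrite coefZ coefXn.
case: eqP => [e|_]; last by rewrite mulr0.
case/eqP: jk; have := jN _ jf; have := jN _ kf; move: e; lia.
Qed.

Lemma leval_inj (E : seq C) f g :
  (forall x, x != 0 -> x \notin E -> leval f x = leval g x) -> f = g.
Proof.
move=> h; apply/eqP; rewrite -subr_eq0; apply/eqP; apply: (@leval_eq0 E) => x x0 xE.
by rewrite levalB h// subrr.
Qed.

(** The divisibility that makes T1 and T0 preserve Laurent polynomials. On positive powers it is the
    factorisation of a difference of powers, s/x - x being (s - x^2)/x; a power -m reduces to m
    through the factor -s^-m. *)
Lemma ldiv_exists s f : s != 0 -> exists g, forall x, x != 0 ->
  leval f (s / x) - leval f x = (s - x ^+ 2) * leval g x.
Proof.
move=> s0.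
have pos (n : nat) : exists g, forall x, x != 0 ->
    (s / x) ^+ n - x ^+ n = (s - x ^+ 2) * leval g x.
  exists (\sum_(i < n) s ^+ (n.-1 - i) *: lmon (i%:Z - (n.-1 - i)%:Z - 1)) => x x0.
  rewrite subrXX leval_sum (_ : s / x - x = (s - x ^+ 2) * x^-1); last by field.
  rewrite -mulrA; congr (_ * _); rewrite mulr_sumr; apply: eq_bigr => i _.
  rewrite levalZ leval_lmon !expfzDr// -exprnN exprN1 -exprnP exprMn -exprVn.
  by ring.
have mon (k : int) : exists g, forall x, x != 0 ->
    (s / x) ^ k - x ^ k = (s - x ^+ 2) * leval g x.
  case: k => n; first exact: pos.
  have [g hg] := pos n.+1; exists (- (s ^- n.+1) *: g) => x x0.
  rewrite levalZ mulrCA -hg// !NegzE -!exprnN -!exprVn invf_div !exprMn !exprVn.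
  by field; rewrite !expf_neq0.
have /choice[G hG] := mon; exists (lext G f) => x x0.
rewrite leval_lext mulr_sumr -sumrB; apply: eq_bigr => k _.
by rewrite -mulrBr hG// mulrCA.
Qed.
End LaurentPolynomials.

(* Locked copies: conversion tests between distinct terms [a *: f] of malg do
   not terminate in reasonable time. *)
HB.lock Definition lev (R : realType) (f : laurent R) (x : cplx R) : cplx R := leval f x.
HB.lock Definition lco (R : realType) (k : int) (f : laurent R) : cplx R := mcoeff k f.
HB.lock Definition lsc (R : realType) (a : cplx R) (f : laurent R) : laurent R := a *: f.
HB.lock Definition lad (R : realType) (f g : laurent R) : laurent R := f + g.
HB.lock Definition lsb (R : realType) (f g : laurent R) : laurent R := f - g.
HB.lock Definition lsh (R : realType) (n : int) (f : laurent R) : laurent R := lshift n f.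
HB.lock Definition lrf (R : realType) (s : cplx R) (f : laurent R) : laurent R := lrefl s f.
HB.lock Definition lml (R : realType) (f g : laurent R) : laurent R := lmul f g.
HB.lock Definition lmn (R : realType) (k : int) : laurent R := lmon R k.

Section LockedOperations.
Variable R : realType.
Local Notation C := (cplx R).
Implicit Types (f g h : laurent R) (x s a : C) (k n : int).

Lemma levE f x : lev f x = leval f x. Proof. by rewrite lev.unlock. Qed.

Lemma lcoE k f : lco k f = mcoeff k f. Proof. by rewrite lco.unlock. Qed.

Lemma lscE a f : lsc a f = a *: f. Proof. by rewrite lsc.unlock. Qed.

Lemma lev_sc a f x : lev (lsc a f) x = a * lev f x.
Proof. rewrite !lev.unlock lsc.unlock; exact: levalZ. Qed.

Lemma lev_ad f g x : lev (lad f g) x = lev f x + lev g x.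
Proof. rewrite !lev.unlock lad.unlock; exact: levalD. Qed.

Lemma lev_sb f g x : lev (lsb f g) x = lev f x - lev g x.
Proof. rewrite !lev.unlock lsb.unlock; exact: levalB. Qed.

Lemma lev_sh n f x : x != 0 -> lev (lsh n f) x = x ^ n * lev f x.
Proof. rewrite !lev.unlock lsh.unlock; exact: leval_lshift. Qed.

Lemma lev_rf s f x : lev (lrf s f) x = lev f (s / x).
Proof. rewrite !lev.unlock lrf.unlock; exact: leval_lrefl. Qed.

Lemma lev_ml f g x : x != 0 -> lev (lml f g) x = lev f x * lev g x.
Proof. rewrite !lev.unlock lml.unlock; exact: leval_lmul. Qed.

Lemma lev_mn k x : lev (lmn R k) x = x ^ k.
Proof. rewrite !lev.unlock lmn.unlock; exact: leval_lmon. Qed.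

Lemma lev_one x : lev (lone R) x = 1.
Proof. rewrite !lev.unlock; exact: leval_lone. Qed.

Lemma lco_sc k a f : lco k (lsc a f) = a * lco k f.
Proof. rewrite !lco.unlock lsc.unlock; exact: mcoeffZ. Qed.

Lemma lco_ad k f g : lco k (lad f g) = lco k f + lco k g.
Proof. rewrite !lco.unlock lad.unlock; exact: mcoeffD. Qed.

Lemma lco_sb k f g : lco k (lsb f g) = lco k f - lco k g.
Proof. rewrite !lco.unlock lsb.unlock; exact: mcoeffB. Qed.

Lemma lco_sh k n f : lco k (lsh n f) = lco (k - n) f.
Proof. rewrite !lco.unlock lsh.unlock; exact: mcoeff_lshift. Qed.

Lemma lco_rf k s f : lco k (lrf s f) = lco (- k) f * s ^ (- k).
Proof. rewrite !lco.unlock lrf.unlock; exact: mcoeff_lrefl. Qed.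

Lemma lco_one k : lco k (lone R) = (k == 0)%:R.
Proof. by rewrite !lco.unlock lone_lmon mcoeff_lmon eq_sym. Qed.

Lemma lco_zero k : lco k (0 : laurent R) = 0.
Proof. rewrite !lco.unlock; exact: mcoeff0. Qed.

Lemma lcoP f g : (forall k, lco k f = lco k g) -> f = g.
Proof. by move=> h; apply/malgP => k; have := h k; rewrite !lco.unlock. Qed.

Lemma lev_inj (E : seq C) f g :
  (forall x, x != 0 -> x \notin E -> lev f x = lev g x) -> f = g.
Proof.
by move=> h; apply: (@leval_inj _ E) => x x0 xE; have := h x x0 xE; rewrite !lev.unlock.
Qed.

Lemma lco_finite f : exists N : nat, forall j, (N < `|j|)%N -> lco j f = 0.
Proof.
exists (\sum_(j <- msupp f) `|j|)%N => j; rewrite ltnNge lco.unlock => hj.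
by apply: mcoeff_outdom; apply: contra hj => jg; rewrite (big_rem _ jg) leq_addr.
Qed.

Lemma lev_div_exists s f : s != 0 -> exists g, forall x, x != 0 ->
  lev f (s / x) - lev f x = (s - x ^+ 2) * lev g x.
Proof. rewrite lev.unlock; exact: ldiv_exists. Qed.
End LockedOperations.

(** * Difference-reflection operators and their intertwiners *)

Section HeckeOperators.
Variable R : realType.
Local Notation C := (cplx R).
Implicit Types (f g h : laurent R) (x s k : C) (t : par R).

Lemma sqr_neqP' (sq x : C) : x \notin [:: sq; - sq] -> x ^+ 2 != sq ^+ 2.
Proof. by rewrite eqf_sqr !inE. Qed.

(* T acts as the Demazure-Lusztig operator attached to x -> sq^2 / x. *)
Definition hecke_op (sq k : C) (w : C -> C) (T : laurent R -> laurent R) :=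
  forall f x, x != 0 -> x ^+ 2 != sq ^+ 2 ->
    lev (T f) x = k * lev f x + k^-1 * w x * (lev f (sq ^+ 2 / x) - lev f x).

(** The inverse of T, as dictated by the quadratic relation T^2 = (k - 1/k) T + 1. *)
Definition heckeV k (T : laurent R -> laurent R) f := lsb (T f) (lsc (k - k^-1) f).

Section Generic.
Variables (sq k : C) (w : C -> C) (T : laurent R -> laurent R).
Hypotheses (sq0 : sq != 0) (k0 : k != 0) (hT : hecke_op sq k w T).
Hypothesis hw : forall x, x != 0 -> x ^+ 2 != sq ^+ 2 -> w x + w (sq ^+ 2 / x) = 1 + k ^+ 2.

Lemma heckeD f g : T (lad f g) = lad (T f) (T g).
Proof.
apply: (@lev_inj _ [:: sq; - sq]) => x x0 /sqr_neqP' xs.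
rewrite !(lev_ad, hT)//; ring.
Qed.

Lemma heckeB f g : T (lsb f g) = lsb (T f) (T g).
Proof.
apply: (@lev_inj _ [:: sq; - sq]) => x x0 /sqr_neqP' xs.
rewrite !(lev_sb, hT)//; ring.
Qed.

Lemma heckeZ a f : T (lsc a f) = lsc a (T f).
Proof.
apply: (@lev_inj _ [:: sq; - sq]) => x x0 /sqr_neqP' xs.
rewrite !(lev_sc, hT)//; ring.
Qed.

Lemma hecke_one : T (lone R) = lsc k (lone R).
Proof.
apply: (@lev_inj _ [:: sq; - sq]) => x x0 /sqr_neqP' xs.
by rewrite hT// lev_sc !lev_one subrr !mulr0 addr0.
Qed.

Lemma refl_neq0 x : x != 0 -> sq ^+ 2 / x != 0.
Proof. by move=> x0; rewrite mulf_neq0 ?invr_eq0// expf_neq0. Qed.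

Lemma refl_sqr x : x != 0 -> x ^+ 2 != sq ^+ 2 -> (sq ^+ 2 / x) ^+ 2 != sq ^+ 2.
Proof.
move=> x0; apply: contra => /eqP h; apply/eqP.
have s2 : sq ^+ 2 != 0 by rewrite expf_neq0.
by apply: (mulfI s2); rewrite -{1}h; field.
Qed.

(** Of the coefficient [w], only the relation w(x) + w(s/x) = 1 + k^2 enters, with s the square of
    [sq]. *)
Lemma hecke_quad f : T (T f) = lad (lsc (k - k^-1) (T f)) f.
Proof.
apply: (@lev_inj _ [:: sq; - sq]) => x x0 /sqr_neqP' xs.
have xx := refl_neq0 x0; have xxs := refl_sqr x0 xs.
rewrite lev_ad lev_sc hT// !(hT _ x0 xs) (hT _ xx xxs).
have -> : sq ^+ 2 / (sq ^+ 2 / x) = x by field; rewrite x0 sq0.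
have -> : w (sq ^+ 2 / x) = 1 + k ^+ 2 - w x by rewrite -(hw x0 xs); ring.
move: (w x) (lev f x) (lev f _) k k0; clear => W F G k k0.
by field.
Qed.

Lemma heckeK f : T (heckeV k T f) = f.
Proof.
rewrite /heckeV heckeB heckeZ hecke_quad; apply: lcoP => j.
by rewrite !(lco_sb, lco_ad, lco_sc) addrC addKr.
Qed.

Lemma heckeVK f : heckeV k T (T f) = f.
Proof.
rewrite /heckeV hecke_quad; apply: lcoP => j.
by rewrite !(lco_sb, lco_ad, lco_sc) addrC addKr.
Qed.

Lemma heckeVZ a f : heckeV k T (lsc a f) = lsc a (heckeV k T f).
Proof.
rewrite /heckeV heckeZ; apply: lcoP => j; rewrite !(lco_sb, lco_sc).
by ring.
Qed.

Lemma heckeVB f g : heckeV k T (lsb f g) = lsb (heckeV k T f) (heckeV k T g).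
Proof.
rewrite /heckeV heckeB; apply: lcoP => j; rewrite !(lco_sb, lco_sc).
by ring.
Qed.

End Generic.

Definition w1 t x : C := (1 - k1 t * u1 t * x) * (1 + k1 t * (u1 t)^-1 * x) / (1 - x ^+ 2).

Definition w0 t x : C := (1 - qh t * k0 t * u0 t * x^-1) * (1 + qh t * k0 t * (u0 t)^-1 * x^-1)
        / (1 - qq t * x ^- 2).

(** T1 and T0 are chosen by [xget]; their defining formulas hold once some Laurent polynomial with
    the prescribed values is exhibited. *)
Lemma lev_xget (Q : C -> Prop) (F : C -> C) x :
  (exists g, forall y, y != 0 -> Q y -> leval g y = F y) -> x != 0 -> Q x ->
  lev (xget 0 [set g | forall y, y != 0 -> Q y -> leval g y = F y]) x = F x.
Proof.
move=> h x0 Qx; rewrite levE.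
exact: (@xgetPex _ 0 [set g | forall y, y != 0 -> Q y -> leval g y = F y] h x x0 Qx).
Qed.

Lemma T1_hecke t : hecke_op 1 (k1 t) (w1 t) (T1 t).
Proof.
move=> f x x0; rewrite expr1n div1r !levE -[leval (T1 t f) x]levE => x1.
apply: (@lev_xget (fun y => y ^+ 2 != 1) (fun y => k1 t * leval f y + (k1 t)^-1 * w1 t y *
  (leval f y^-1 - leval f y))) => //.
have [g hg] := lev_div_exists f (oner_neq0 C).
exists (lad (lsc (k1 t) f) (lsc (k1 t)^-1 (lml (lml (lsb (lmn R 0) (lsc (k1 t * u1 t) (lmn R 1)))
  (lad (lmn R 0) (lsc (k1 t * (u1 t)^-1) (lmn R 1)))) g))) => y y0 y1.
rewrite -!levE !(lev_ad, lev_sb, lev_sc, lev_mn, lev_ml _ _ y0).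
rewrite -[y^-1]div1r hg// expr0z expr1z /w1.
have d0 : 1 - y ^+ 2 != 0 by rewrite subr_eq0 eq_sym.
move: (lev g y) (lev f y) (u1 t)^-1 (k1 t)^-1 => G F U K.
by field.
Qed.

Lemma T0_hecke t : qh t != 0 -> hecke_op (qh t) (k0 t) (w0 t) (T0 t).
Proof.
move=> q0 f x x0 x1; rewrite !levE -[leval (T0 t f) x]levE.
apply: (@lev_xget (fun y => y ^+ 2 != qq t) (fun y => k0 t * leval f y + (k0 t)^-1 * w0 t y *
  (leval f (qq t / y) - leval f y))) => //.
have qq0 : qq t != 0 by rewrite expf_neq0.
have [g hg] := lev_div_exists f qq0.
exists (lsb (lsc (k0 t) f) (lsc (k0 t)^-1 (lml (lml (lml (lsb (lmn R 0) (lsc (qh t * k0 t * u0 t) (lmn R (-1))))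
  (lad (lmn R 0) (lsc (qh t * k0 t * (u0 t)^-1) (lmn R (-1))))) g) (lmn R 2)))) => y y0 y1.
rewrite -!levE !(lev_ad, lev_sb, lev_sc, lev_mn, lev_ml _ _ y0).
rewrite hg// expr0z exprN1 -exprnP /w0.
have d0 : y ^+ 2 - qq t != 0 by rewrite subr_eq0.
have -> : 1 - qq t * y ^- 2 = (y ^+ 2 - qq t) / y ^+ 2 by field.
move: (lev g y) (lev f y) (u0 t)^-1 (k0 t)^-1 d0 => G F U K.
move: (qq t) => q d0; field.
by rewrite y0 d0.
Qed.

Lemma w1_sum t x : k1 t != 0 -> u1 t != 0 -> x != 0 -> x ^+ 2 != 1 ^+ 2 ->
  w1 t x + w1 t (1 ^+ 2 / x) = 1 + k1 t ^+ 2.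
Proof.
move=> k10 u10 x0; rewrite expr1n => x1.
have d0 : 1 - x ^+ 2 != 0 by rewrite subr_eq0 eq_sym.
have d1 : x ^+ 2 - 1 != 0 by rewrite subr_eq0.
by rewrite /w1; field; rewrite d0 d1 x0 u10.
Qed.

Lemma w0_sum t x : qh t != 0 -> k0 t != 0 -> u0 t != 0 -> x != 0 -> x ^+ 2 != qh t ^+ 2 ->
  w0 t x + w0 t (qh t ^+ 2 / x) = 1 + k0 t ^+ 2.
Proof.
move=> q0 k00 u00 x0 x1.
have d0 : qh t ^+ 2 - x ^+ 2 != 0 by rewrite subr_eq0 eq_sym.
have d1 : x ^+ 2 - qh t ^+ 2 != 0 by rewrite subr_eq0.
by rewrite /w0 /qq; field; rewrite d0 d1 x0 u00 q0.
Qed.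
End HeckeOperators.

HB.lock Definition opT1 (R : realType) (t : par R) (f : laurent R) : laurent R := T1 t f.
HB.lock Definition opT0 (R : realType) (t : par R) (f : laurent R) : laurent R := T0 t f.

(** * Relations between X, T0 and T1, and the intertwiners *)

Section Intertwiners.
Variables (R : realType) (t : par R).
Local Notation C := (cplx R).
Implicit Types (f g h : laurent R) (x : C) (a gm : C).

Definition par_neq0 := [/\ k0 t != 0, k1 t != 0, u0 t != 0, u1 t != 0 & qh t != 0].
Hypothesis nz : par_neq0.

Definition opY f := opT1 t (opT0 t f).
Definition T1V := heckeV (k1 t) (opT1 t).
Definition T0V := heckeV (k0 t) (opT0 t).
Definition YopV f := T0V (T1V f).
Definition Uop f := lsh (-1) (T1V f).

Lemma opYE f : Yop t f = opY f.
Proof. by rewrite /opY opT1.unlock opT0.unlock. Qed.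

Let nz_k0 : k0 t != 0. Proof. by case: nz. Qed.
Let nz_k1 : k1 t != 0. Proof. by case: nz. Qed.
Let nz_u0 : u0 t != 0. Proof. by case: nz. Qed.
Let nz_u1 : u1 t != 0. Proof. by case: nz. Qed.
Let nz_qh : qh t != 0. Proof. by case: nz. Qed.

Lemma opT1_hecke : hecke_op 1 (k1 t) (w1 t) (opT1 t).
Proof. rewrite opT1.unlock; exact: T1_hecke. Qed.
Lemma opT0_hecke : hecke_op (qh t) (k0 t) (w0 t) (opT0 t).
Proof. rewrite opT0.unlock; exact: T0_hecke. Qed.

Let h1 := opT1_hecke.
Let h0 := opT0_hecke.
Let s1 := fun x => @w1_sum R t x nz_k1 nz_u1.
Let s0 := fun x => @w0_sum R t x nz_qh nz_k0 nz_u0.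

Lemma T1D f g : opT1 t (lad f g) = lad (opT1 t f) (opT1 t g). Proof. exact: (heckeD h1). Qed.
Lemma T1Z a f : opT1 t (lsc a f) = lsc a (opT1 t f). Proof. exact: (heckeZ h1). Qed.
Lemma T0D f g : opT0 t (lad f g) = lad (opT0 t f) (opT0 t g). Proof. exact: (heckeD h0). Qed.
Lemma T0Z a f : opT0 t (lsc a f) = lsc a (opT0 t f). Proof. exact: (heckeZ h0). Qed.

Lemma T1K f : T1V (opT1 t f) = f.
Proof. exact: (heckeVK (oner_neq0 _) nz_k1 h1 s1). Qed.
Lemma T1VK f : opT1 t (T1V f) = f.
Proof. exact: (heckeK (oner_neq0 _) nz_k1 h1 s1). Qed.
Lemma T0K f : T0V (opT0 t f) = f.
Proof. exact: (heckeVK nz_qh nz_k0 h0 s0). Qed.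
Lemma T0VK f : opT0 t (T0V f) = f.
Proof. exact: (heckeK nz_qh nz_k0 h0 s0). Qed.

Lemma T1VZ a f : T1V (lsc a f) = lsc a (T1V f). Proof. exact: (heckeVZ h1). Qed.
Lemma T0VZ a f : T0V (lsc a f) = lsc a (T0V f). Proof. exact: (heckeVZ h0). Qed.
Lemma T1VB f g : T1V (lsb f g) = lsb (T1V f) (T1V g). Proof. exact: (heckeVB h1). Qed.
Lemma T0VB f g : T0V (lsb f g) = lsb (T0V f) (T0V g). Proof. exact: (heckeVB h0). Qed.

Lemma YopK f : YopV (opY f) = f. Proof. by rewrite /YopV /opY T1K T0K. Qed.
Lemma YopVK f : opY (YopV f) = f. Proof. by rewrite /opY /YopV T0VK T1VK. Qed.
Lemma YopVZ a f : YopV (lsc a f) = lsc a (YopV f). Proof. by rewrite /YopV T1VZ T0VZ. Qed.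
Lemma YopVB f g : YopV (lsb f g) = lsb (YopV f) (YopV g). Proof. by rewrite /YopV T1VB T0VB. Qed.
Lemma YopD f g : opY (lad f g) = lad (opY f) (opY g). Proof. by rewrite /opY T0D T1D. Qed.
Lemma YopZ a f : opY (lsc a f) = lsc a (opY f). Proof. by rewrite /opY T0Z T1Z. Qed.

Lemma lscA a b f : lsc a (lsc b f) = lsc (a * b) f.
Proof. by apply: lcoP => k; rewrite !lco_sc mulrA. Qed.

Lemma lsc1 f : lsc 1 f = f.
Proof. by apply: lcoP => k; rewrite lco_sc mul1r. Qed.

Lemma lshZ n a f : lsh n (lsc a f) = lsc a (lsh n f).
Proof. by apply: lcoP => k; rewrite lco_sc !lco_sh lco_sc. Qed.

Lemma Yop_one : opY (lone R) = lsc (k0 t * k1 t) (lone R).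
Proof. by rewrite /opY (hecke_one h0) T1Z (hecke_one h1) lscA. Qed.

Let goodx x := x \notin [:: 1; -1; qh t; - qh t].

Let goodxP x : goodx x -> x ^+ 2 != 1 ^+ 2 /\ x ^+ 2 != qh t ^+ 2.
Proof.
rewrite /goodx !inE !negb_or => /and4P[x1 x2 x3 x4].
by split; rewrite eqf_sqr negb_or ?x1 ?x2 ?x3 ?x4.
Qed.

(* The quadratic relation of X^-1 T1^-1. *)
Lemma Uop_relation f : lsb (Uop f) (opT1 t (lsh 1 f)) = lsc (u1 t - (u1 t)^-1) f.
Proof.
apply: (@lev_inj _ [:: 1; -1; qh t; - qh t]) => x x0 /goodxP[x1 _].
rewrite lev_sb lev_sc lev_sh// lev_sb lev_sc !h1//.
have y0 : 1 ^+ 2 / x != 0 by rewrite expr1n div1r invr_eq0.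
rewrite !lev_sh// !expr1z /w1; rewrite expr1n in x1 *.
have d0 : 1 - x ^+ 2 != 0 by rewrite subr_eq0 eq_sym.
move: (lev f x) (lev f _) => F G; rewrite exprN1.
by move: x0 d0 nz_k1 nz_u1; move: (k1 t) (u1 t)=> k u *; field; apply/and4P.
Qed.

(* The quadratic relation of X^-1 T0. *)
Lemma T0V_relation f : T0V (lsh 1 f) =
  lad (lsc (qh t * (u0 t - (u0 t)^-1)) f) (lsc (qq t) (lsh (-1) (opT0 t f))).
Proof.
apply: (@lev_inj _ [:: 1; -1; qh t; - qh t]) => x x0 /goodxP[_ x1].
rewrite lev_ad !lev_sc lev_sh// /T0V /heckeV lev_sb lev_sc !h0//.
have y0 : qh t ^+ 2 / x != 0 by rewrite mulf_neq0 ?invr_eq0// expf_neq0.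
rewrite !lev_sh// !expr1z /w0 /qq exprN1.
have d0 : x ^+ 2 - qh t ^+ 2 != 0 by rewrite subr_eq0.
move: (lev f x) (lev f _) => F G.
move: x0 d0 nz_k0 nz_u0; move: (k0 t) (u0 t) (qh t)=> k u q x0 d0 k0 u0.
by field; rewrite x0 d0 k0 u0.
Qed.

Lemma YopV_eig f gm : gm != 0 -> opY f = lsc gm f -> YopV f = lsc gm^-1 f.
Proof.
by move=> g0 h; rewrite -{1}[f]lsc1 -(mulVf g0) -lscA -h YopVZ YopK.
Qed.

Lemma Yop_eig_of_V f gm : gm != 0 -> YopV f = lsc gm f -> opY f = lsc gm^-1 f.
Proof.
by move=> g0 h; rewrite -{1}[f]lsc1 -(mulVf g0) -lscA -h YopZ YopVK.
Qed.

(** If Y f = gm f then T0 f = gm T1^-1 f, so Y^-1 T1 f = T0^-1 f is gm T1 f plus a multiple of f;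
    [alphaT] removes that multiple. [alphaU] does the same for X^-1 T1^-1. *)
Definition alphaT gm : C :=
  - ((k1 t - (k1 t)^-1) * gm + (k0 t - (k0 t)^-1)) / (gm^-1 - gm).

Definition alphaU gm : C :=
  ((u1 t - (u1 t)^-1) / gm + qh t * (u0 t - (u0 t)^-1)) / (gm^-1 - qq t * gm).

Lemma T0_eig f gm : opY f = lsc gm f -> opT0 t f = lsc gm (T1V f).
Proof. by move=> hf; rewrite -T1VZ -hf /opY T1K. Qed.

Lemma Yop_T1_intertwines f gm : gm != 0 -> gm ^+ 2 != 1 -> opY f = lsc gm f ->
  opY (lsb (opT1 t f) (lsc (alphaT gm) f)) =
  lsc gm^-1 (lsb (opT1 t f) (lsc (alphaT gm) f)).
Proof.
move=> g0 g1 hf; apply: Yop_eig_of_V => //.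
rewrite YopVB YopVZ (YopV_eig g0 hf) /YopV T1K /T0V /heckeV (T0_eig hf).
have d1 : 1 - gm ^+ 2 != 0 by rewrite subr_eq0 eq_sym.
apply: lcoP => k; rewrite !(lco_sb, lco_sc) /alphaT.
move: (lco k (opT1 t f)) (lco k f) d1 g0 nz_k0 nz_k1 => A B.
move: (k0 t) (k1 t)=> k0 k1 d1 g0 n0 n1.
by field; rewrite n0 n1 g0 mulNr -expr2 d1.
Qed.

Lemma Yop_Uop_intertwines f gm : gm != 0 -> qq t * gm ^+ 2 != 1 -> opY f = lsc gm f ->
  opY (lsb (Uop f) (lsc (alphaU gm) f)) =
  lsc (qq t * gm)^-1 (lsb (Uop f) (lsc (alphaU gm) f)).
Proof.
move=> g0 g1 hf; have q0 : qq t != 0 by rewrite expf_neq0.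
apply: Yop_eig_of_V; first by rewrite mulf_neq0.
(* By [Uop_relation], U f is T1 (x f) plus a multiple of f, and Y^-1 T1 = T0^-1. *)
have Uf : YopV (Uop f) = lad (lsc (u1 t - (u1 t)^-1) (YopV f)) (T0V (lsh 1 f)).
  rewrite -YopVZ -(Uop_relation f) YopVB {3}/YopV T1K.
  by apply: lcoP => k; rewrite !(lco_ad, lco_sb) subrK.
rewrite YopVB Uf YopVZ (YopV_eig g0 hf) T0V_relation (T0_eig hf) lshZ -/(Uop f).
have d1 : 1 - qq t * gm ^+ 2 != 0 by rewrite subr_eq0 eq_sym.
apply: lcoP => k; rewrite !(lco_sb, lco_ad, lco_sc) /alphaU.
move: (lco k (Uop f)) (lco k f) d1 g0 nz_u0 nz_u1 q0 => A B.
move: (qq t) (qh t) (u0 t) (u1 t)=> q qh u0 u1 d1 g0 n0 n1 q0.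
by field; rewrite n0 n1 g0 mulNr -mulrA -expr2 d1.
Qed.

Definition evpt : C := (k1 t)^-1 * (u1 t)^-1.

(** The coefficient of the reflection vanishes at 1/(k1 u1), and the condition on [pa] keeps this
    point away from the zeros of 1 - x^2. *)
Lemma T1_evpt f : pa t * pa t != 1 -> lev (opT1 t f) evpt = k1 t * lev f evpt.
Proof.
move=> a1; have e0 : evpt != 0 by rewrite mulf_neq0 ?invr_neq0.
rewrite h1//; last first.
  rewrite expr1n; apply: contra a1 => /eqP e; apply/eqP.
  transitivity (evpt ^+ 2)^-1; last by rewrite e invr1.
  rewrite /evpt /pa; move: nz_k1 nz_u1; move: (k1 t) (u1 t).
  by move=> k u k0 u0; field; rewrite k0 u0.
rewrite /w1 (_ : 1 - k1 t * u1 t * evpt = 0) ?mul0r ?mulr0 ?mul0r ?addr0//.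
rewrite /evpt; move: nz_k1 nz_u1; move: (k1 t) (u1 t).
by move=> k u k0 u0; field; rewrite k0 u0.
Qed.

Lemma Uop_evpt f : pa t * pa t != 1 -> lev (Uop f) evpt = u1 t * lev f evpt.
Proof.
move=> a1; have e0 : evpt != 0 by rewrite mulf_neq0 ?invr_neq0.
rewrite lev_sh// /T1V /heckeV lev_sb lev_sc T1_evpt// exprN1.
move: (lev f _) => F; rewrite /evpt; move: nz_k1 nz_u1; move: (k1 t) (u1 t).
by move=> k u k0 u0; field; rewrite k0 u0.
Qed.

(** The factor by which the intertwiner multiplies the value at [evpt]. Its zeros and poles in [gm]
    are expressed by dual parameters, so genericity of the latter keeps it nonzero along the
    chain. *)
Lemma alphaT_k1 gm : gm != 0 -> gm ^+ 2 != 1 -> k1 t - alphaT gm =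
  k1 t * (1 - gm / pa (dual_par t)) * (1 - gm / pb (dual_par t)) / (1 - gm ^+ 2).
Proof.
move=> g0 g1; rewrite /alphaT /pa /pb /=.
have d0 : 1 - gm ^+ 2 != 0 by rewrite subr_eq0 eq_sym.
move: d0 g0 nz_k0 nz_k1; move: (k0 t) (k1 t)=> k0 k1 d0 g0 n0 n1.
by field; rewrite d0 n0 n1 g0.
Qed.

Lemma alphaU_u1 gm : gm != 0 -> qq t * gm ^+ 2 != 1 -> u1 t - alphaU gm =
  (u1 t)^-1 * (1 - pc (dual_par t) * gm) * (1 - pd (dual_par t) * gm) / (1 - qq t * gm ^+ 2).
Proof.
move=> g0 g1; rewrite /alphaU /pc /pd /=.
have : 1 - qq t * gm ^+ 2 != 0 by rewrite subr_eq0 eq_sym.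
rewrite /qq => d0.
move: d0 g0 nz_u0 nz_u1; move: (u0 t) (u1 t) (qh t)=> k0 k1 q d0 g0 n0 n1.
by field; rewrite exprMn d0 n0 n1 g0.
Qed.

(* Leading terms: X^n |-> k1^-1 X^-n + ..., X^-n |-> k1 X^n + (k1 - k1^-1) X^-n + ... *)
Lemma T1_leading f (n : nat) : (forall k, (n < `|k|)%N -> lco k f = 0) ->
  [/\ forall k, (n < `|k|)%N -> lco k (opT1 t f) = 0,
      lco n%:Z (opT1 t f) = k1 t * lco (- n%:Z) f &
      lco (- n%:Z) (opT1 t f) =
        (k1 t)^-1 * lco n%:Z f + (k1 t - (k1 t)^-1) * lco (- n%:Z) f].
Proof.
move=> fn; pose g := lsb (opT1 t f) (lsc (k1 t) f); pose d := lsb (lrf 1 f) f.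
pose a := k1 t * u1 t; pose b := - (k1 t * (u1 t)^-1).
have gd : lsb g (lsh 2 g) =
    lsc (k1 t)^-1 (lad (lsb d (lsc (a + b) (lsh 1 d))) (lsc (a * b) (lsh 2 d))).
  apply: (@lev_inj _ [:: 1; -1; qh t; - qh t]) => x x0 /goodxP[x1 _].
  rewrite /g /d !(lev_sb, lev_ad, lev_sc, lev_sh _ _ x0) h1//.
  rewrite lev_rf expr1n /w1 expr1z -exprnP; rewrite expr1n in x1.
  have d0 : 1 - x ^+ 2 != 0 by rewrite subr_eq0 eq_sym.
  move: (lev f x) (lev f _) => F G; rewrite /a /b; move: d0 nz_k1 nz_u1.
  move: (k1 t) (u1 t)=> k u d0 k0 u0.
  by field; rewrite d0 k0 u0.
have gE j : lco j g - lco (j - 2) g =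
    (k1 t)^-1 * (lco j d - (a + b) * lco (j - 1) d + (a * b) * lco (j - 2) d).
  have := congr1 (lco j) gd.
  by rewrite !(lco_sb, lco_ad, lco_sc, lco_sh).
have dE j : lco j d = lco (- j) f - lco j f.
  by rewrite lco_sb lco_rf exp1rz mulr1.
have d0 j : (n < `|j|)%N -> lco j d = 0.
  by move=> nj; rewrite dE !fn ?abszN// subrr.
have [N hN] := lco_finite g.
(* Beyond the range of [d] the relation makes the coefficients of [g] periodic with step 2; only
   finitely many being nonzero, they all vanish there. The same argument serves [ghigh]. *)
have glow j : j < - n%:Z -> lco j g = 0.
  move=> jn; have h (i : nat) : lco j g = lco (j - (2 * i)%N%:Z) g.
    elim: i => [|i ->]; first by rewrite subr0.
    have := gE (j - (2 * i)%N%:Z); rewrite !d0; try lia.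
    rewrite !mulr0 subr0 addr0 mulr0 => /eqP; rewrite subr_eq0 => /eqP ->.
    by congr lco; lia.
  by rewrite (h N.+1) hN//; lia.
have ghigh j : n%:Z < j -> lco j g = 0.
  move=> jn; have h (i : nat) : lco j g = lco (j + (2 * i)%N%:Z) g.
    elim: i => [|i ->]; first by rewrite addr0.
    have := gE (j + (2 * i.+1)%N%:Z); rewrite !d0; try lia.
    rewrite !mulr0 subr0 addr0 mulr0 => /eqP; rewrite subr_eq0 => /eqP ->.
    by congr lco; lia.
  by rewrite (h N.+1) hN//; lia.
have g1 : lco (- n%:Z) g = (k1 t)^-1 * lco (- n%:Z) d.
  have := gE (- n%:Z); rewrite (glow (- n%:Z - 2)); last by lia.
  rewrite (d0 (- n%:Z - 1)); last by lia.
  by rewrite (d0 (- n%:Z - 2)); [rewrite !mulr0 !subr0 addr0|lia].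
have g2 : lco n%:Z g = k1 t * lco n%:Z d.
  have := gE (n%:Z + 2); rewrite (ghigh (n%:Z + 2)); last by lia.
  rewrite (d0 (n%:Z + 2)); last by lia.
  rewrite (d0 (n%:Z + 2 - 1)); last by lia.
  rewrite addrK mulr0 subrr !add0r => /eqP; rewrite eqr_oppLR => /eqP ->.
  rewrite /a /b; move: (lco n%:Z d) nz_k1 nz_u1; move: (k1 t) (u1 t)=> k u D k0 u0.
  by field; rewrite k0 u0.
have TE k : lco k (opT1 t f) = lco k g + k1 t * lco k f.
  by rewrite lco_sb lco_sc subrK.
split.
- move=> k nk; rewrite TE fn// mulr0 addr0.
  case: (ltrP k 0) => k0; first by apply: glow; lia.
  by apply: ghigh; lia.
- by rewrite TE g2 dE; ring.
- by rewrite TE g1 dE opprK; ring.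
Qed.
End Intertwiners.

(** * The basis of eigenfunctions of Y *)

Section Ranks.

Definition unrank (r : nat) : int := if odd r then Negz r./2 else Posz r./2.

Lemma unrankK r : mrank (unrank r) = r.
Proof.
rewrite /unrank; case: ifP => ro /=.
  by rewrite -[RHS]odd_double_half ro add1n.
by rewrite -[RHS]odd_double_half ro add0n.
Qed.

Lemma mrankK m : unrank (mrank m) = m.
Proof. by case: m => n; rewrite /unrank /= odd_double /= ?doubleK// uphalf_double. Qed.

Lemma mrank_gt_abs (n : nat) k : (n < `|k|)%N -> (n.*2 < mrank k)%N.
Proof. case: k => m /=; rewrite -?muln2; lia. Qed.
End Ranks.

Section EigenBasis.
Variables (R : realType) (t : par R).
Local Notation C := (cplx R).
Implicit Types (f g h : laurent R) (x : C).
Local Notation q := (qq t).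
Local Notation ta := (pa (dual_par t)).

(** The algebraic part of genericity. Unlike |q| < 1 it is stable under inverting the parameters, so
    that a single construction serves both E and E'. *)
Definition alg_generic := [/\ par_neq0 t, (forall n : nat, q ^+ n.+1 != 1),
  pa t * pa t != 1 &
  forall e, e \in pabcd (dual_par t) -> forall j : nat,
     ta * e * q ^+ j != 1].
Hypothesis ag : alg_generic.

Let nz : par_neq0 t. Proof. by case: ag. Qed.
Let nz_k0 : k0 t != 0. Proof. by case: nz. Qed.
Let nz_k1 : k1 t != 0. Proof. by case: nz. Qed.
Let nz_u0 : u0 t != 0. Proof. by case: nz. Qed.
Let nz_u1 : u1 t != 0. Proof. by case: nz. Qed.
Let nz_qh : qh t != 0. Proof. by case: nz. Qed.
Let nz_q : q != 0. Proof. by rewrite expf_neq0. Qed.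
Let taE : ta = k0 t * k1 t. Proof. by rewrite /pa/= mulrC. Qed.
Let ta0 : ta != 0. Proof. by rewrite taE mulf_neq0. Qed.

Definition lamb (r : nat) : C := gam t (unrank r).

Lemma lamb_even r : ~~ odd r -> lamb r = ta * q ^+ r./2.
Proof. by move=> /negPf ro; rewrite /lamb /gam /unrank ro /epsi /= expr1z -exprnP taE. Qed.

Lemma lamb_odd r : odd r -> lamb r = (ta * q ^+ r./2.+1)^-1.
Proof.
move=> ro; rewrite /lamb /gam /unrank ro /epsi /= exprN1 NegzE -exprnN taE.
by rewrite [RHS]invfM.
Qed.

Lemma lamb_neq0 r : lamb r != 0.
Proof.
by case: (boolP (odd r)) => [/lamb_odd|/lamb_even] ->;
  rewrite ?invr_eq0 mulf_neq0// expf_neq0.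
Qed.

Lemma lamb_even_next r : ~~ odd r -> lamb r.+1 = (q * lamb r)^-1.
Proof.
move=> ro; rewrite lamb_odd ?oddS// lamb_even// mulrCA -exprS; congr (_ * _ ^+ _.+1)^-1.
by rewrite /= uphalf_half (negPf ro).
Qed.

Lemma lamb_odd_next r : odd r -> lamb r.+1 = (lamb r)^-1.
Proof.
move=> ro; rewrite lamb_even ?oddS ?ro// lamb_odd// invrK; congr (_ * _ ^+ _).
by rewrite /= uphalf_half ro add1n.
Qed.

Lemma lamb0 : lamb 0 = k0 t * k1 t.
Proof. by rewrite lamb_even// expr0 mulr1 taE. Qed.

Let qinj (i j : nat) : q ^+ i = q ^+ j -> i = j.
Proof.
have [_ q1 _ _] := ag.
wlog ij : i j / (i <= j)%N => [h|].
  by case: (leqP i j) => [|/ltnW] ij e; [exact: h|symmetry; apply: h].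
move=> e; apply/eqP; rewrite eqn_leq ij /= leqNgt; apply/negP => ij'.
have /eqP := q1 (j - i).-1; apply; rewrite prednK ?subn_gt0//.
have qi : q ^+ i != 0 by rewrite expf_neq0.
by apply: (mulfI qi); rewrite -exprD subnKC// mulr1.
Qed.

(** Equal parities reduce to injectivity of the powers of q; for opposite parities equality would
    read ta^2 q^n = 1. *)
Lemma lamb_inj : injective lamb.
Proof.
have [_ _ _ tq] := ag.
have ne i j : ~~ odd i -> odd j -> lamb i <> lamb j.
  move=> io jo; rewrite lamb_even// lamb_odd// => e.
  have /eqP := tq ta (mem_head _ _) (i./2 + j./2.+1)%N; apply.
  have tq0 : ta * q ^+ j./2.+1 != 0 by rewrite mulf_neq0// expf_neq0.
  rewrite (_ : ta * ta * _ = (ta * q ^+ i./2) * (ta * q ^+ j./2.+1)); last by rewrite exprD; ring.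
  by rewrite e mulVf.
move=> i j; case: (boolP (odd i)) => io; case: (boolP (odd j)) => jo e.
- move: e; rewrite !lamb_odd// => /invr_inj/(mulfI ta0)/qinj[] h.
  by rewrite -(odd_double_half i) -(odd_double_half j) io jo h.
- by have := ne _ _ jo io (esym e).
- by have := ne _ _ io jo e.
- move: e; rewrite !lamb_even// => /(mulfI ta0)/qinj h.
  by rewrite -(odd_double_half i) -(odd_double_half j) (negPf io) (negPf jo) h.
Qed.

Lemma lamb_even_ne1 r e : ~~ odd r -> e \in pabcd (dual_par t) -> 1 - e * lamb r != 0.
Proof.
have [_ _ _ tq] := ag => ro /tq h; rewrite subr_eq0 eq_sym lamb_even//.
by rewrite mulrA [e * _]mulrC.
Qed.

Lemma lamb_odd_ne1 r e : odd r -> e != 0 -> e \in pabcd (dual_par t) -> 1 - lamb r / e != 0.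
Proof.
have [_ _ _ tq] := ag => ro e0 /tq /(_ r./2.+1) h; rewrite subr_eq0 eq_sym.
rewrite lamb_odd// -invfM invr_eq1.
by rewrite mulrAC.
Qed.

Lemma lamb_even_sqr r : ~~ odd r -> q * lamb r ^+ 2 != 1.
Proof.
have [_ _ _ tq] := ag => ro; have := tq ta (mem_head _ _) (r./2 + r./2).+1.
by rewrite lamb_even// exprS exprD; apply: contra => /eqP <-; apply/eqP; ring.
Qed.

Lemma lamb_odd_sqr r : odd r -> lamb r ^+ 2 != 1.
Proof.
have [_ _ _ tq] := ag => ro; have := tq ta (mem_head _ _) (r./2.+1 + r./2.+1)%N.
rewrite lamb_odd// exprVn invr_eq1 exprD.
by apply: contra => /eqP <-; apply/eqP; ring.
Qed.

(* The eigenvalues form the chain gm -> (q gm)^-1 -> q gm -> ..., each step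
   being realised by an intertwiner built on U or on T1. *)
Fixpoint eigf (r : nat) : laurent R :=
  if r is r'.+1 then
    if odd r' then lsb (opT1 t (eigf r')) (lsc (alphaT t (lamb r')) (eigf r'))
    else lsb (Uop t (eigf r')) (lsc (alphaU t (lamb r')) (eigf r'))
  else lone R.

Lemma eigf_eig r : opY t (eigf r) = lsc (lamb r) (eigf r).
Proof.
elim: r => [|r IH] /=; first by rewrite Yop_one// lamb0.
case: ifP => ro.
  rewrite Yop_T1_intertwines ?lamb_neq0 ?lamb_odd_sqr//.
  by rewrite lamb_odd_next.
by rewrite Yop_Uop_intertwines ?lamb_neq0 ?lamb_even_sqr ?lamb_even_next ?ro.
Qed.

(** U moves the leading monomial from x^n to x^-(n+1) and T1 moves it from x^-n to x^n. Each step
    thus climbs exactly one place in the order, and the eigenfunctions form a triangular basis. *)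
Lemma eigf_lead r : lco (unrank r) (eigf r) != 0 /\
  forall k, (r < mrank k)%N -> lco k (eigf r) = 0.
Proof.
elim: r => [|r [IH1 IH2]].
  rewrite lco_one oner_eq0; split=> // k kr.
  by rewrite lco_one; case: eqP kr => // ->.
rewrite /=; case: (boolP (odd r)) => ro.
  have re : r.+1 = (r./2.+1).*2 by rewrite doubleS -[in LHS](odd_double_half r) ro.
  have [|l1 l2 _] := @T1_leading R t nz (eigf r) r./2.+1.
    by move=> k /mrank_gt_abs; rewrite -re => /ltnW; exact: IH2.
  have ur : unrank r.+1 = (r./2.+1)%:Z by rewrite /unrank /= ro /= uphalf_half ro.
  split.
    rewrite lco_sb lco_sc ur l2 (IH2 (r./2.+1)%:Z) ?mulr0 ?subr0; last by rewrite /= -re.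
    by rewrite mulf_neq0//; move: IH1; rewrite /unrank ro NegzE.
  move=> k kr; rewrite lco_sb lco_sc (IH2 k) ?mulr0 ?subr0; last exact: ltnW.
  apply: l1; move: kr; rewrite re; case: k => m /=; rewrite -!muln2; lia.
have re : r = (r./2).*2 by rewrite -[in LHS](odd_double_half r) (negPf ro).
have [|l1 _ l2] := @T1_leading R t nz (eigf r) r./2.
  by move=> k /mrank_gt_abs; rewrite -re; exact: IH2.
have UE k : lco k (Uop t (eigf r)) =
    lco (k + 1) (opT1 t (eigf r)) - (k1 t - (k1 t)^-1) * lco (k + 1) (eigf r).
  by rewrite /Uop lco_sh opprK lco_sb lco_sc.
have ur : unrank r.+1 = - (r./2.+1)%:Z.
  by rewrite /unrank /= ro /= uphalf_half (negPf ro) NegzE.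
split.
  rewrite lco_sb lco_sc UE ur (IH2 (- (r./2.+1)%:Z)); last first.
    by rewrite -NegzE /= -re.
  rewrite (_ : - (r./2.+1)%:Z + 1 = - r./2%:Z); last by lia.
  rewrite l2 mulr0 subr0 addrK mulf_neq0 ?invr_neq0//.
  by move: IH1; rewrite /unrank (negPf ro).
move=> k kr; rewrite lco_sb lco_sc (IH2 k) ?mulr0 ?subr0; last exact: ltnW.
have kb : (r./2 < `|(k + 1)%R|)%N.
  move: kr; rewrite [in X in (X < _)%N]re; case: k => m /=; rewrite -!muln2; lia.
by rewrite UE l1// IH2 ?mulr0 ?subr0// re; exact: mrank_gt_abs.
Qed.

(** Each step multiplies the value at [evpt] by [k1 - alphaT] or [u1 - alphaU], whose factorisations
    are nonzero by genericity. *)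
Lemma eigf_evpt r : lev (eigf r) (evpt t) != 0.
Proof.
have [_ _ a1 _] := ag.
elim: r => [|r IH]; first by rewrite lev_one oner_eq0.
rewrite /=; case: (boolP (odd r)) => ro.
  rewrite lev_sb lev_sc T1_evpt// -mulrBl alphaT_k1 ?lamb_neq0 ?lamb_odd_sqr//.
  have tb0 : pb (dual_par t) != 0 by rewrite oppr_eq0 mulf_neq0 ?invr_eq0.
  rewrite !mulf_neq0 ?invr_neq0 ?lamb_odd_ne1 ?inE ?eqxx ?orbT//.
  by rewrite subr_eq0 eq_sym lamb_odd_sqr.
rewrite lev_sb lev_sc Uop_evpt// -mulrBl alphaU_u1 ?lamb_neq0 ?lamb_even_sqr//.
rewrite !mulf_neq0 ?invr_neq0 ?lamb_even_ne1 ?inE ?eqxx ?orbT//.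
by rewrite subr_eq0 eq_sym lamb_even_sqr.
Qed.

Fixpoint lcomb (a : nat -> C) (E : nat -> laurent R) (r : nat) : laurent R :=
  if r is r'.+1 then lad (lcomb a E r') (lsc (a r') (E r')) else 0.

Lemma lco_comb k a E r : lco k (lcomb a E r) = \sum_(i < r) a i * lco k (E i).
Proof.
elim: r => [|r IH]; first by rewrite big_ord0 lco_zero.
by rewrite big_ord_recr /= lco_ad IH lco_sc.
Qed.

Lemma lsc0 f : lsc 0 f = 0.
Proof. by apply: lcoP => k; rewrite lco_sc lco_zero mul0r. Qed.

Lemma opY_comb a r : opY t (lcomb a eigf r) = lcomb (fun i => a i * lamb i) eigf r.
Proof.
elim: r => [|r IH] /=; first by rewrite -[in LHS](lsc0 0) YopZ// lsc0.
by rewrite YopD// IH YopZ// eigf_eig lscA.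
Qed.

Lemma eigf_expand r f : (forall k, (r <= mrank k)%N -> lco k f = 0) ->
  exists a, f = lcomb a eigf r.
Proof.
elim: r f => [|r IH] f hf.
  by exists (fun=> 0); apply: lcoP => k; rewrite lco_zero hf.
have [l1 l2] := eigf_lead r.
pose b := lco (unrank r) f / lco (unrank r) (eigf r).
have [k kr|a ha] := IH (lsb f (lsc b (eigf r))).
  rewrite lco_sb lco_sc; move: kr; rewrite leq_eqVlt => /predU1P[kr|kr].
    have -> : k = unrank r by rewrite kr mrankK.
    by rewrite /b divfK// subrr.
  by rewrite hf// l2// mulr0 subrr.
exists (fun i => if i == r then b else a i); apply: lcoP => k.
rewrite lco_comb big_ord_recr/= eqxx.
have := congr1 (lco k) ha; rewrite lco_sb lco_sc lco_comb => /eqP.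
rewrite subr_eq => /eqP ->; congr (_ + _); apply: eq_bigr => i _.
by rewrite ltn_eqF.
Qed.

Lemma eigf_free a r : lcomb a eigf r = 0 -> forall i, (i < r)%N -> a i = 0.
Proof.
elim: r => // r IH h; have [l1 l2] := eigf_lead r.
have ar : a r = 0.
  have := congr1 (lco (unrank r)) h; rewrite lco_zero lco_comb big_ord_recr/=.
  rewrite big1 ?add0r => [/eqP|i _]; first by rewrite mulf_eq0 (negPf l1) orbF => /eqP.
  by rewrite (eigf_lead i).2 ?mulr0// unrankK.
have h' : lcomb a eigf r = 0.
  by rewrite -h /= ar lsc0; apply: lcoP => k; rewrite lco_ad lco_zero addr0.
by move=> i; rewrite ltnS leq_eqVlt => /predU1P[->//|]; exact: IH.
Qed.

Lemma rank_bound f : exists r, forall k, (r <= mrank k)%N -> lco k f = 0.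
Proof.
have [N hN] := lco_finite f; exists (N.*2.+1) => k kr; apply: hN.
by move: kr; case: k => m /=; rewrite -!muln2; lia.
Qed.

Lemma eig_unique f r : opY t f = lsc (lamb r) f -> exists b, f = lsc b (eigf r).
Proof.
have [N /eigf_expand[a ->]] := rank_bound f.
rewrite opY_comb => h.
have h0 : lcomb (fun i => a i * (lamb i - lamb r)) eigf N = 0.
  apply: lcoP => k; rewrite lco_zero lco_comb.
  have := congr1 (lco k) h; rewrite lco_sc !lco_comb mulr_sumr => /eqP.
  rewrite -subr_eq0 -sumrB => /eqP h1; rewrite -[RHS]h1; apply: eq_bigr => i _; ring.
have az i : (i < N)%N -> i != r -> a i = 0.
  move=> iN ir; have /eqP := eigf_free h0 iN; rewrite mulf_eq0 subr_eq0.
  by rewrite (inj_eq lamb_inj) (negPf ir) orbF => /eqP.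
exists (if (r < N)%N then a r else 0); apply: lcoP => k; rewrite lco_comb lco_sc.
case: ifP => rN.
  rewrite (bigD1 (Ordinal rN))//= big1 ?addr0// => i ir.
  by rewrite az ?mul0r.
rewrite mul0r big1// => i _; rewrite az ?mul0r//.
by apply/eqP => e; move: rN; rewrite -e ltn_ord.
Qed.

Definition Eb (r : nat) : laurent R := lsc (lev (eigf r) (evpt t))^-1 (eigf r).

Lemma Eb_evpt r : lev (Eb r) (evpt t) = 1.
Proof. by rewrite lev_sc mulVf// eigf_evpt. Qed.

Lemma Eb_eig r : opY t (Eb r) = lsc (lamb r) (Eb r).
Proof. by rewrite /Eb YopZ// eigf_eig !lscA mulrC. Qed.

(** Since the value at [evpt] fixes an eigenfunction, the intertwiners yield exact recursions for
    [Eb], with no undetermined constants. *)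
Lemma Eb_unique f r : opY t f = lsc (lamb r) f -> f = lsc (lev f (evpt t)) (Eb r).
Proof.
case/eig_unique => b ->; rewrite lev_sc /Eb lscA -mulrA divff ?mulr1//.
exact: eigf_evpt.
Qed.

Lemma Eb0 : Eb 0 = lone R.
Proof. by rewrite /Eb /= lev_one invr1 lsc1. Qed.

Lemma Eb_expand f : exists N a, f = lcomb a Eb N.
Proof.
have [N /eigf_expand[a ->]] := rank_bound f.
exists N, (fun i => a i * lev (eigf i) (evpt t)); apply: lcoP => k.
rewrite !lco_comb; apply: eq_bigr => i _.
by rewrite lco_sc mulrA mulfK// eigf_evpt.
Qed.

(** The target is given by its eigenvalue and not as [r.+1], because for the inverted parameters the
    step is also taken backwards, from r + 1 to r. *)
Lemma T1_Eb r r' : lamb r ^+ 2 != 1 -> lamb r' = (lamb r)^-1 ->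
  opT1 t (Eb r) = lad (lsc (alphaT t (lamb r)) (Eb r))
     (lsc (k1 t - alphaT t (lamb r)) (Eb r')).
Proof.
have [_ _ a1 _] := ag => l1 lr.
have := Yop_T1_intertwines nz (lamb_neq0 r) l1 (Eb_eig r).
rewrite -lr => /Eb_unique; rewrite lev_sb lev_sc T1_evpt// Eb_evpt !mulr1 => h.
by apply: lcoP => k; rewrite lco_ad -h lco_sb addrC subrK.
Qed.

Lemma Uop_Eb r r' : q * lamb r ^+ 2 != 1 -> lamb r' = (q * lamb r)^-1 ->
  Uop t (Eb r) = lad (lsc (alphaU t (lamb r)) (Eb r))
     (lsc (u1 t - alphaU t (lamb r)) (Eb r')).
Proof.
have [_ _ a1 _] := ag => l1 lr.
have := Yop_Uop_intertwines nz (lamb_neq0 r) l1 (Eb_eig r).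
rewrite -lr => /Eb_unique; rewrite lev_sb lev_sc Uop_evpt// Eb_evpt !mulr1 => h.
by apply: lcoP => k; rewrite lco_ad -h lco_sb addrC subrK.
Qed.

Lemma Ppol_eigf r : exists2 b : C, b != 0 & Ppol t (unrank r) = lsc b (eigf r).
Proof.
have [l1 l2] := eigf_lead r.
have [[m1 m2] m3] : [set f | monic_at (unrank r) f /\ Yop t f = gam t (unrank r) *: f]
    (Ppol t (unrank r)).
  apply: (@xgetPex _ 0); exists (lsc (lco (unrank r) (eigf r))^-1 (eigf r)); split; first split.
  - by rewrite -lcoE lco_sc mulVf.
  - by move=> k; rewrite unrankK => kr; rewrite -lcoE lco_sc (l2 k kr) mulr0.
  - by rewrite opYE YopZ// eigf_eig -lscE !lscA mulrC.
have : opY t (Ppol t (unrank r)) = lsc (lamb r) (Ppol t (unrank r)).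
  by rewrite -opYE m3 lscE.
case/eig_unique => b hb; exists b => //; apply/eqP => b0.
move: m1; rewrite -lcoE hb b0 lsc0 lco_zero => /eqP; by rewrite eq_sym oner_eq0.
Qed.

Lemma sigma_index_lamb r : sigma_index t (lamb r) = unrank r.
Proof.
have : [set m | gam t m = lamb r] (sigma_index t (lamb r)).
  by apply: (@xgetPex _ 0); exists (unrank r).
by move=> /=; rewrite -[sigma_index _ _]mrankK => /lamb_inj ->.
Qed.

Lemma sigma'_index_lamb r : sigma'_index t (lamb r)^-1 = unrank r.
Proof.
have : [set m | gam' t m = (lamb r)^-1] (sigma'_index t (lamb r)^-1).
  by apply: (@xgetPex _ 0); exists (unrank r).
by move=> /=; rewrite /gam' -[sigma'_index _ _]mrankK => /invr_inj/lamb_inj ->.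
Qed.

Lemma Epol_Eb r : Epol t (lamb r) = Eb r.
Proof.
rewrite /Epol sigma_index_lamb; have [b b0 ->] := Ppol_eigf r.
rewrite -/(evpt t) -levE -lscE.
by rewrite lev_sc lscA invfM mulrAC mulVf// mul1r.
Qed.
End EigenBasis.

(** * Adjoints with respect to the bilinear form *)

Section LaurentContinuity.
Variable R : realType.
Local Notation C := (cplx R).
Implicit Types (f g h : laurent R) (x : C).

Lemma exprz_continuous (k : int) x : x != 0 -> {for x, continuous (fun y : C => y ^ k)}.
Proof.
move=> x0.
have pos (n : nat) : {for x, continuous (fun y : C => y ^+ n)}.
  elim: n => [|n IH]; first exact: cst_continuous.
  have -> : (fun y : C => y ^+ n.+1) = (fun y => y * y ^+ n).
    by apply/funext => y; rewrite exprS.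
  by apply: (@continuousM _ _ id (fun y : C => y ^+ n)); [exact: cvg_id|exact: IH].
case: k => n; first exact: pos.
have -> : (fun y : C => y ^ Negz n) = (fun y => (y ^+ n.+1)^-1).
  by apply/funext => y; rewrite NegzE exprnN.
apply: (@continuousV _ _ (fun y : C => y ^+ n.+1)); first by rewrite expf_neq0.
exact: pos.
Qed.

Lemma exprz_sum_continuous (a : int -> C) (r : seq int) x : x != 0 ->
  {for x, continuous (fun y : C => \sum_(k <- r) a k * y ^ k)}.
Proof.
move=> x0; elim: r => [|k r IH].
  have -> : (fun y : C => \sum_(k <- [::]) a k * y ^ k) = fun=> 0.
    by apply/funext => y; rewrite big_nil.
  exact: cst_continuous.
have -> : (fun y : C => \sum_(j <- k :: r) a j * y ^ j) =
    fun y => a k * y ^ k + \sum_(j <- r) a j * y ^ j.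
  by apply/funext => y; rewrite big_cons.
apply: continuousD; last exact: IH.
apply: continuousM; first exact: cst_continuous.
exact: exprz_continuous.
Qed.

Lemma lev_continuous f x : x != 0 -> {for x, continuous (lev f)}.
Proof. rewrite lev.unlock; exact: exprz_sum_continuous. Qed.

Lemma lev_rational (c : R -> C) (s : C) f : rational c s (lev f).
Proof.
rewrite lev.unlock; apply: rational_sum => k; apply: rationalM; first exact: rational_cst.
exact: rational_exprz.
Qed.
End LaurentContinuity.

Lemma pa_in (R : realType) (t : par R) : pa t \in pabcd t. Proof. by rewrite !inE eqxx. Qed.
Lemma pb_in (R : realType) (t : par R) : pb t \in pabcd t. Proof. by rewrite !inE eqxx orbT. Qed.
Lemma pc_in (R : realType) (t : par R) : pc t \in pabcd t. Proof. by rewrite !inE eqxx !orbT. Qed.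
Lemma pd_in (R : realType) (t : par R) : pd t \in pabcd t. Proof. by rewrite !inE eqxx !orbT. Qed.

Section GenericParameters.
Variables (R : realType) (t : par R).
Local Notation C := (cplx R).
Hypothesis ht : generic_par t.

Lemma generic_neq0 : par_neq0 t.
Proof.
case: ht => [[h1 h2 h3 h4]] /andP[h5 _] _ _ _; split=> //.
by apply: contraTN h5 => /eqP e; rewrite /qq e expr0n normr0 ltxx.
Qed.

Lemma generic_nmq : nm (qq t) < 1.
Proof. by case: ht => [_ /andP[_ h] _ _ _]; rewrite -ltcR -nmE. Qed.

Lemma pabcd_neq0 e : e \in pabcd t -> e != 0.
Proof.
have [h1 h2 h3 h4 h5] := generic_neq0.
rewrite !inE => /or4P[] /eqP ->; rewrite /pa /pb /pc /pd ?oppr_eq0 ?mulf_neq0 ?invr_eq0//.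
Qed.

Lemma alg_generic_of : alg_generic t.
Proof.
have nz := generic_neq0; have [h1 h2 h3 h4 h5] := nz.
have q0 : qq t != 0 by rewrite expf_neq0.
have [_ _ _ e1 e2] := ht.
split=> //.
- move=> n; apply/negP => /eqP h.
  have := generic_nmq; rewrite -nm_eq0 in q0.
  have : nm (qq t) ^+ n.+1 = 1 by rewrite -nmX h nm1.
  move=> hn q1; have := exprn_ilt1 n.+1 (nm_ge0 (qq t)) q1.
  by rewrite hn ltxx.
- by have := e1 _ _ (mem_head _ _) (mem_head _ _) 0; rewrite expr0z.
- move=> e ee j; have := e2 _ _ (mem_head _ _) ee (- j%:Z).
  apply: contra => /eqP h; apply/eqP.
  have qj : qq t ^+ j != 0 by rewrite expf_neq0.
  by apply: (mulIf qj); rewrite -exprnN mulVf.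
Qed.

Lemma pabcd_inv (s : par R) : pabcd (inv_par s) = [seq e^-1 | e <- pabcd s].
Proof.
rewrite /pabcd /= /pa /pb /pc /pd /=.
by rewrite !invrN !invfM !invrK.
Qed.

Lemma alg_generic_inv : alg_generic (inv_par t).
Proof.
have [nz q1 a1 dq] := alg_generic_of; have [h1 h2 h3 h4 h5] := nz.
have qE : qq (inv_par t) = (qq t)^-1 by rewrite /qq /= exprVn.
split.
- by split; rewrite /= invr_eq0.
- by move=> n; rewrite qE exprVn invr_eq1.
- by rewrite /pa /= -!invfM invr_eq1.
- move=> e; rewrite (_ : dual_par (inv_par t) = inv_par (dual_par t))// pabcd_inv.
  case/mapP => e' ee -> j; rewrite qE exprVn.
  rewrite (_ : pa _ = (pa (dual_par t))^-1); last by rewrite /pa /= invfM.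
  by rewrite -!invfM invr_eq1; exact: dq.
Qed.
End GenericParameters.

(** * The form and the adjoints of T1, T0 and X^-1 T1^-1 *)

Section Adjoint.
Variables (R : realType) (t : par R) (c : R -> cplx R).
Local Notation C := (cplx R).
Implicit Types (f g h : laurent R) (x : C).
Hypotheses (ht : generic_par t) (hc : admissible_contour t c).
Local Notation q := (qq t).
Local Notation t' := (inv_par t).

Let nz := generic_neq0 ht.
Let nz_q : q != 0. Proof. by case: nz => *; rewrite expf_neq0. Qed.
Let q1 := generic_nmq ht.

Lemma contour_wcont : wcont c.
Proof. by case: hc => -[h _ _] _ _ _ _; exact: within_wcont. Qed.

Lemma contour_closed : c 0 = c 1. Proof. by case: hc => -[_ h _]. Qed.

Lemma contour_ccw : counterclockwise c. Proof. by case: hc. Qed.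

Lemma contour0 : curve_interior c 0. Proof. by case: hc. Qed.

Lemma contour_neq0 : ontrace c (fun x => x != 0).
Proof. exact: (trace_neq0 contour0). Qed.

Lemma contour_poles e (j : nat) : e \in pabcd t ->
  curve_interior c (e * q ^+ j) /\ curve_exterior c (e * q ^+ j)^-1.
Proof.
case: hc => _ _ _ _ h ee; have [i1 i2] := h e ee j; split=> //.
by rewrite invfM.
Qed.

Lemma factor_neq0 e (j : nat) : e \in pabcd t ->
  ontrace c (fun x => 1 - e * x * q ^+ j != 0) /\ ontrace c (fun x => 1 - e / x * q ^+ j != 0).
Proof.
move=> ee; have [[i1 _] [i2 _]] := contour_poles j ee.
have e0 := pabcd_neq0 ht ee; have eq0 : e * q ^+ j != 0 by apply: mulf_neq0 => //; exact: expf_neq0.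
split=> s s01; have x0 := contour_neq0 s01; rewrite subr_eq0 eq_sym; apply/negP => /eqP h.
  have /avoidsP/(_ s s01)/eqP := i2; apply; apply: (mulfI eq0).
  by rewrite divff// -h mulrAC.
have /avoidsP/(_ s s01)/eqP := i1; apply.
by rewrite -[LHS]mul1r -h mulrAC mulfVK// mulrAC.
Qed.

Lemma qpinf_trace e : e \in pabcd t ->
  ontrace c (fun x => qpinf q (e * x) != 0) /\ ontrace c (fun x => qpinf q (e / x) != 0).
Proof.
move=> ee; split=> s s01; apply: (qpinf_neq0 q1) => j.
  by have := (factor_neq0 j ee).1 s s01; rewrite subr_eq0 eq_sym.
by have := (factor_neq0 j ee).2 s s01; rewrite subr_eq0 eq_sym.
Qed.

Lemma Delta_factors e s : 0 <= s <= 1 -> let x := c s in e \in pabcd t ->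
  [/\ 1 - e * x != 0, 1 - e / x != 0,
    qpinf q (e * x) = (1 - e * x) * qpinf q (q * e * x) &
    qpinf q (e / x) = (1 - e / x) * qpinf q (q * e / x)] /\
  [/\ qpinf q (e * x) != 0, qpinf q (e / x) != 0,
    qpinf q (q * e * x) != 0 & qpinf q (q * e / x) != 0].
Proof.
move=> s01 x ee; have [f1 f2] := factor_neq0 0 ee; have [n1 n2] := qpinf_trace ee.
move: (f1 _ s01) (f2 _ s01) (n1 _ s01) (n2 _ s01); rewrite expr0 !mulr1 -/x => -> -> m1 m2.
have e1 : qpinf q (e * x) = (1 - e * x) * qpinf q (q * e * x).
  by rewrite (qpinfS q1); congr (_ * qpinf _ _); ring.
have e2 : qpinf q (e / x) = (1 - e / x) * qpinf q (q * e / x).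
  by rewrite (qpinfS q1); congr (_ * qpinf _ _); ring.
split; split=> //.
  by move: m1; rewrite e1 mulf_eq0 negb_or => /andP[].
by move: m2; rewrite e2 mulf_eq0 negb_or => /andP[].
Qed.

Lemma Delta_den_neq0 : ontrace c (fun x => qpinfs q
  [:: pa t * x; pb t * x; pc t * x; pd t * x;
      q * pa t * x^-1; q * pb t * x^-1; pc t * x^-1; pd t * x^-1] != 0).
Proof.
move=> s s01; have fac e := @Delta_factors e _ s01.
have [_ [a1 _ _ a2]] := fac _ (pa_in t); have [_ [b1 _ _ b2]] := fac _ (pb_in t).
have [_ [c1 c2 _ _]] := fac _ (pc_in t); have [_ [d1 d2 _ _]] := fac _ (pd_in t).
rewrite prodf_seq_neq0 /= a1 b1 c1 d1 c2 d2.
by move: a2 b2; rewrite -!mulrA => -> ->.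
Qed.

(** The cancellation is isolated over an abstract field, where the infinite products are mere
    variables for [field]. *)
Lemma w1_Delta_alg (F : fieldType) (a b x2 A B X Y Q P1 P2 P3 P4 P5 P6 : F) :
  1 - a != 0 -> 1 - b != 0 -> 1 - x2 != 0 ->
  A != 0 -> B != 0 -> P1 != 0 -> P2 != 0 -> P3 != 0 -> P4 != 0 -> P5 != 0 -> P6 != 0 ->
  (1 - a) * (1 - b) / (1 - x2) * ((1 - x2) * X * (Y * 1) /
   ((1 - a) * A * ((1 - b) * B * (P1 * (P2 * (P3 * (P4 * (P5 * (P6 * 1)))))))))
  = X * Y * (A * P3 * (B * P4 * (P1 * P5 * (P2 * P6 * 1))))^-1.
Proof.
move=> h1 h2 h3 h4 h5 h6 h7 h8 h9 h10 h11.
by field; rewrite h1 h2 h3 h4 h5 h6 h7 h8 h9 h10 h11.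
Qed.

(** The coefficient of T1 removes the leading factors of the products in x^2, a x and b x. What is
    left pairs each product in x with its image in 1/x. *)
Lemma w1_Delta s : 0 <= s <= 1 -> c s ^+ 2 != 1 ->
  w1 t (c s) * Delta t (c s) = sym_weight q 1 q [:: q * pa t; q * pb t; pc t; pd t] (c s).
Proof.
move=> s01; have := contour_neq0 s01; move xE : (c s) => x x0 x1.
have fac e := @Delta_factors e _ s01; rewrite xE in fac.
have [[a1 _ a2 _] [_ _ a3 a4]] := fac _ (pa_in t); have [[b1 _ b2 _] [_ _ b3 b4]] := fac _ (pb_in t).
have [_ [c1 c2 _ _]] := fac _ (pc_in t); have [_ [d1 d2 _ _]] := fac _ (pd_in t).
have x2 : 1 - x ^+ 2 != 0 by rewrite subr_eq0 eq_sym.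
rewrite /Delta /sym_weight /qpinfs !big_cons !big_nil div1r.
rewrite (qpinfS q1 (x ^+ 2)) a2 b2 /w1 -/(pa t).
have -> : 1 + k1 t * (u1 t)^-1 * x = 1 - pb t * x by rewrite /pb mulNr opprK.
rewrite [x ^+ 2 * q]mulrC -exprVn.
exact: w1_Delta_alg.
Qed.

Lemma w0_Delta_alg (F : fieldType) (a b x2 A B X Y P1 P2 P3 P4 P5 P6 : F) :
  1 - a != 0 -> 1 - b != 0 -> 1 - x2 != 0 ->
  A != 0 -> B != 0 -> P1 != 0 -> P2 != 0 -> P3 != 0 -> P4 != 0 -> P5 != 0 -> P6 != 0 ->
  (1 - a) * (1 - b) / (1 - x2) * (X * ((1 - x2) * Y * 1) /
   (P1 * (P2 * (P3 * (P4 * (P5 * (P6 * ((1 - a) * A * ((1 - b) * B * 1)))))))))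
  = X * Y * (P1 * P5 * (P2 * P6 * (P3 * A * (P4 * B * 1))))^-1.
Proof.
move=> h1 h2 h3 h4 h5 h6 h7 h8 h9 h10 h11.
by field; rewrite h1 h2 h3 h4 h5 h6 h7 h8 h9 h10 h11.
Qed.

Lemma w0_Delta s : 0 <= s <= 1 -> c s ^+ 2 != q ->
  w0 t (c s) * Delta t (c s) = sym_weight q q 1 (pabcd t) (c s).
Proof.
move=> s01; have := contour_neq0 s01; move xE : (c s) => x x0 x1.
have fac e := @Delta_factors e _ s01; rewrite xE in fac.
have [_ [a3 _ _ a4]] := fac _ (pa_in t); have [_ [b3 _ _ b4]] := fac _ (pb_in t).
have [[c1 c2 _ c4] [c5 _ _ c6]] := fac _ (pc_in t); have [[d1 d2 _ d4] [d5 _ _ d6]] := fac _ (pd_in t).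
have x2 : 1 - q * x ^- 2 != 0.
  rewrite subr_eq0 eq_sym; apply: contra x1 => /eqP e; apply/eqP.
  by rewrite -[LHS]mul1r -e mulfVK// expf_neq0.
rewrite /Delta /sym_weight /qpinfs !big_cons !big_nil !mul1r.
rewrite (qpinfS q1 (q * x ^- 2)) c4 d4 /w0 -/(pc t).
have -> : 1 + qh t * k0 t * (u0 t)^-1 * x^-1 = 1 - pd t / x by rewrite /pd mulNr opprK.
have -> : (q / x) ^+ 2 = q * x ^- 2 * q by rewrite exprMn exprVn expr2 mulrAC.
have e (y : C) : y * (q / x) = q * y / x by rewrite mulrA [y * q]mulrC.
rewrite !e.
exact: w0_Delta_alg.
Qed.

Definition form_integrand f g x : C := lev f x * lev g x^-1 * Delta t x / x.

Lemma Delta_continuous : ontrace c (fun x => {for x, continuous (Delta t)}).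
Proof.
move=> s s01; have x0 := contour_neq0 s01.
have cq (a : C -> C) : {for c s, continuous a} -> {for c s, continuous (fun x => qpinf q (a x))}.
  move=> ac; apply: (@continuous_comp _ _ _ a (qpinf q)); first exact: ac.
  exact: qpinf_continuous.
have ci : {for c s, continuous (fun x : C => x^-1)} by exact: inv_continuous.
have ca (e : C) : {for c s, continuous (fun x => e * x)} by exact: mulrl_continuous.
have cb (e : C) : {for c s, continuous (fun x => e * x^-1)}.
  by apply: continuousM; [exact: cst_continuous|exact: ci].
have c2 : {for c s, continuous (fun x : C => q * x ^- 2)}.
  apply: continuousM; first exact: cst_continuous.
  by apply: (@exprz_continuous R (- 2%:Z) _ x0).
rewrite /Delta /qpinfs; apply: continuousM.
  rewrite (_ : (fun x => _) = (fun x => qpinf q (x ^+ 2) * qpinf q (q * x ^- 2))); last first.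
    by apply/funext => x; rewrite !big_cons big_nil mulr1.
  by apply: continuousM; apply: cq; [exact: continuous_sqr|exact: c2].
rewrite (_ : (fun x => _) = (fun x => (qpinf q (pa t * x) * qpinf q (pb t * x) *
   qpinf q (pc t * x) * qpinf q (pd t * x) * qpinf q (q * pa t * x^-1) *
   qpinf q (q * pb t * x^-1) * qpinf q (pc t * x^-1) * qpinf q (pd t * x^-1))^-1)); last first.
  by apply/funext => x; rewrite !big_cons big_nil mulr1 !mulrA.
have A e := cq _ (ca e); have B e := cq _ (cb e).
apply: continuousV; last first.
  exact: (continuousM (continuousM (continuousM (continuousM (continuousM
    (continuousM (continuousM (A _) (A _)) (A _)) (A _)) (B _)) (B _)) (B _)) (B _)).
by have := Delta_den_neq0 s01; rewrite /qpinfs !big_cons big_nil mulr1 !mulrA.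
Qed.

Lemma two_pi_i_neq0 : two_pi_i R != 0.
Proof.
rewrite eq_complex /= eqxx /= mulf_eq0 pnatr_eq0 /=.
by rewrite gt_eqF// pi_gt0.
Qed.

Lemma form_continuous f g : ontrace c (fun x => {for x, continuous (form_integrand f g)}).
Proof.
move=> s s01; have x0 := contour_neq0 s01.
have ci : {for c s, continuous (fun x : C => x^-1)} by exact: inv_continuous.
have cf := @lev_continuous R f _ x0.
have xi0 : (c s)^-1 != 0 by rewrite invr_eq0.
have cg : {for c s, continuous (fun x => lev g x^-1)}.
  by apply: (@continuous_comp _ _ _ (fun x : C => x^-1) (lev g)); [exact: ci|exact: lev_continuous].
exact: (continuousM (continuousM (continuousM cf cg) (Delta_continuous s01)) ci).
Qed.

(** The integral defining the form exists, so [contour_int] is not its default value; bilinearity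
    rests on this. *)
Lemma form_int f g : rs_int (form_integrand f g \o c) c (two_pi_i R * aw_form t c f g).
Proof.
have [_ /rectifiable_nm[M cM] _ _ _] := hc.
have [l hl] := cint_exists contour_wcont cM (@form_continuous f g).
rewrite /aw_form (_ : (fun x => _) = form_integrand f g); last first.
  by apply/funext => x; rewrite /form_integrand !levE.
rewrite (@contour_int_eq _ _ _ l); last by apply/contour_intE.
by rewrite mulVKf// two_pi_i_neq0.
Qed.

Lemma form_eqP f g (b : C) : rs_int (form_integrand f g \o c) c b ->
  aw_form t c f g = (two_pi_i R)^-1 * b.
Proof.
move=> h; have := rs_int_unique h (form_int f g) => ->.
by rewrite mulKf// two_pi_i_neq0.
Qed.

Lemma form_lin a f g f1 g1 f2 g2 :
  (forall x, lev f x * lev g x^-1 = lev f1 x * lev g1 x^-1 + a * (lev f2 x * lev g2 x^-1)) ->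
  aw_form t c f g = aw_form t c f1 g1 + a * aw_form t c f2 g2.
Proof.
move=> h.
rewrite (@form_eqP _ _ (two_pi_i R * aw_form t c f1 g1 + a * (two_pi_i R * aw_form t c f2 g2))).
  by rewrite [a * (_ * _)]mulrCA -mulrDr mulKf// two_pi_i_neq0.
apply: rs_int_ext (rs_intD (form_int f1 g1) (rs_intZ a (form_int f2 g2))) => s _ /=.
by rewrite /form_integrand h; ring.
Qed.

Lemma form_adl f f' g : aw_form t c (lad f f') g = aw_form t c f g + aw_form t c f' g.
Proof. by rewrite (@form_lin 1 _ _ f g f' g) ?mul1r// => x; rewrite lev_ad; ring. Qed.

Lemma form_adr f g g' : aw_form t c f (lad g g') = aw_form t c f g + aw_form t c f g'.
Proof. by rewrite (@form_lin 1 _ _ f g f g') ?mul1r// => x; rewrite lev_ad; ring. Qed.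

Lemma form_sbl f f' g : aw_form t c (lsb f f') g = aw_form t c f g - aw_form t c f' g.
Proof. by rewrite (@form_lin (-1) _ _ f g f' g) ?mulN1r// => x; rewrite lev_sb; ring. Qed.

Lemma form_sbr f g g' : aw_form t c f (lsb g g') = aw_form t c f g - aw_form t c f g'.
Proof. by rewrite (@form_lin (-1) _ _ f g f g') ?mulN1r// => x; rewrite lev_sb; ring. Qed.

Lemma form_scl a f g : aw_form t c (lsc a f) g = a * aw_form t c f g.
Proof.
rewrite (@form_lin (a - 1) _ _ f g f g) => [|x]; first by ring.
by rewrite lev_sc; ring.
Qed.

Lemma form_scr a f g : aw_form t c f (lsc a g) = a * aw_form t c f g.
Proof.
rewrite (@form_lin (a - 1) _ _ f g f g) => [|x]; first by ring.
by rewrite lev_sc; ring.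
Qed.

Lemma form_diff f g f' g' : rs_int (fun s => form_integrand f g (c s) - form_integrand f' g' (c s)) c 0 ->
  aw_form t c f g = aw_form t c f' g'.
Proof.
move=> h; have := rs_intD (form_int f' g') h; rewrite addr0.
have -> : (fun s => (form_integrand f' g' \o c) s + (form_integrand f g (c s) - form_integrand f' g' (c s)))
    = form_integrand f g \o c by apply/funext => s /=; rewrite addrC subrK.
by move/form_eqP ->; rewrite mulKf// two_pi_i_neq0.
Qed.

Lemma form_shift (n : int) f g : aw_form t c (lsh n f) g = aw_form t c f (lsh (- n) g).
Proof.
apply: form_diff; apply: rs_int_ext (rs_int0 c) => s s01.
have x0 := contour_neq0 s01; have xi0 : (c s)^-1 != 0 by rewrite invr_eq0.
rewrite /form_integrand !lev_sh// -exprz_inv invrK; ring.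
Qed.

Let wc := contour_wcont.
Let cl := contour_closed.

Lemma refl_wcont (H : C -> C) : ontrace c (fun x => {for x, continuous H}) -> wcont (H \o c).
Proof. by move=> h; apply: wcont_comp. Qed.

(** With p = sq^2, the two integrands differ by w Delta / (k x) times f(p/x) g(1/x) - f(x) g(x/p).
    The last expression is odd under x -> p/x while w Delta is symmetric, so the difference
    integrates to zero. *)
Lemma hecke_adjoint (sq k nu : C) (w w' : C -> C) (T T' : laurent R -> laurent R)
    (es : seq C) f g :
  sq != 0 -> k != 0 -> hecke_op sq k w T -> hecke_op sq^-1 k^-1 w' T' ->
  (forall x, x != 0 -> x ^+ 2 != sq ^+ 2 -> w' x^-1 = k^-1 * k^-1 * w x) ->
  (forall e, e \in es -> e != 0) ->
  (forall e, e \in es -> forall j : nat,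
    curve_interior c (sq ^+ 2 * e * q ^+ j) /\ curve_exterior c (e * q ^+ j)^-1) ->
  (forall x, x != 0 -> x ^+ 2 = sq ^+ 2 -> Delta t x = 0) ->
  (forall s, 0 <= s <= 1 -> c s ^+ 2 != sq ^+ 2 ->
    w (c s) * Delta t (c s) = sym_weight q (sq ^+ 2) nu es (c s)) ->
  aw_form t c (T f) g = aw_form t c f (heckeV k^-1 T' g).
Proof.
move=> sq0 nk hT hT' hw es0 esP Delta0 wD; set p := sq ^+ 2 in hw esP Delta0 wD *.
have p0 : p != 0 by rewrite expf_neq0.
(* [h] is f(x) g(x/p), and [H] is h(p/x) - h(x), which is odd by construction. *)
pose h := lml f (lrf p (lrf 1 g)); pose H := lev (lsb (lrf p h) h).
have [_ /rectifiable_nm[M cM] _ _ _] := hc.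
have cH : ontrace c (fun x => {for x, continuous H}).
  by move=> s s01; apply: lev_continuous; exact: contour_neq0.
have HE (x : C) : x != 0 -> H x = lev f (p / x) * lev g x^-1 - lev f x * lev g (x / p).
  move=> x0; have px0 : p / x != 0 by apply: mulf_neq0; rewrite ?invr_eq0.
  rewrite /H lev_sb lev_rf !lev_ml// !lev_rf div1r.
  have -> : p / (p / x) = x by rewrite invf_div mulrCA divff ?mulr1.
  by rewrite div1r invf_div.
have odd : ontrace c (fun x => H (p / x) = - H x).
  move=> s s01; have x0 := contour_neq0 s01.
  have px0 : p / c s != 0 by apply: mulf_neq0; rewrite ?invr_eq0.
  rewrite (HE _ x0) (HE _ px0).
  have -> : p / (p / c s) = c s by rewrite invf_div mulrCA divff ?mulr1.
  rewrite invf_div.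
  have -> : p / c s / p = (c s)^-1 by rewrite mulrAC divff// mul1r.
  by rewrite opprB.
have := @sym_weight_int_odd R c M q p nu es wc cl cM p0 contour_ccw contour0 nz_q q1
  es0 esP H (lev_rational c p _) (refl_wcont cH) odd.
move=> /(rs_intZ k^-1); rewrite mulr0 => hz.
apply: form_diff; apply: rs_int_ext hz => s s01.
have x0 := contour_neq0 s01; have xi0 : (c s)^-1 != 0 by rewrite invr_eq0.
rewrite /form_integrand HE//; have [x1|x1] := eqVneq (c s ^+ 2) p.
  have -> : p / c s = c s by rewrite -x1 expr2 mulfK.
  have -> : c s / p = (c s)^-1 by rewrite -x1 expr2 invfM mulrA divff// mul1r.
  by rewrite Delta0//; ring.
rewrite -wD// /heckeV lev_sb lev_sc.
have xi1 : (c s)^-1 ^+ 2 != sq^-1 ^+ 2 by rewrite !exprVn (inj_eq invr_inj).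
rewrite (hT f _ x0 x1) (hT' g _ xi0 xi1) hw// -/p.
have -> : sq^-1 ^+ 2 / (c s)^-1 = c s / p by rewrite invrK exprVn mulrC.
rewrite !invrK; move: (w (c s)) (Delta t (c s)) => W D.
move: (lev f _) (lev f _) (lev g _) (lev g _) => F F' G G'.
by move: (c s) x0 => x x0; field; rewrite nk x0.
Qed.

Lemma T1_adjoint f g : aw_form t c (opT1 t f) g = aw_form t c f (T1V t' g).
Proof.
have [nk0 nk1 nu0 nu1 nqh] := nz.
have h1' : hecke_op 1^-1 (k1 t)^-1 (w1 t') (opT1 t') by rewrite invr1; exact: (opT1_hecke t').
apply: (@hecke_adjoint 1 (k1 t) q (w1 t) (w1 t') (opT1 t) (opT1 t')
  [:: q * pa t; q * pb t; pc t; pd t] f g (oner_neq0 _) nk1 (opT1_hecke t) h1'); rewrite ?expr1n.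
- move=> x x0 x1; rewrite /w1 /=.
  have d0 : 1 - x ^+ 2 != 0 by rewrite subr_eq0 eq_sym.
  have d1 : x ^+ 2 - 1 != 0 by rewrite subr_eq0.
  move: (k1 t) (u1 t) nk1 nu1 => k u nk nu; field; by rewrite x0 d0 d1 nk nu.
- move=> e; rewrite !inE => /or4P[] /eqP ->; rewrite ?mulf_neq0//;
  by apply: (pabcd_neq0 ht); rewrite !inE eqxx ?orbT.
- move=> e ee j; rewrite mul1r; move: ee; rewrite !inE => /or4P[] /eqP ->.
  + by rewrite mulrAC -exprS mulrC; exact: (contour_poles _ (pa_in t)).
  + by rewrite mulrAC -exprS mulrC; exact: (contour_poles _ (pb_in t)).
  + exact: (contour_poles _ (pc_in t)).
  + exact: (contour_poles _ (pd_in t)).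
- move=> x x0 x1; rewrite /Delta /qpinfs big_cons (@qpinf_eq0 R q q1 (x ^+ 2) 0) ?mul0r ?mul0r//.
  by rewrite expr0 mulr1.
- exact: w1_Delta.
Qed.

Lemma T0_adjoint f g : aw_form t c (opT0 t f) g = aw_form t c f (T0V t' g).
Proof.
have [nk0 nk1 nu0 nu1 nqh] := nz.
have nz' : par_neq0 t' by split; rewrite /= invr_eq0.
apply: (@hecke_adjoint (qh t) (k0 t) 1 (w0 t) (w0 t') (opT0 t) (opT0 t') (pabcd t) f g
  nqh nk0 (opT0_hecke nz) (opT0_hecke nz')).
- move=> x x0 x1; rewrite /w0 /qq /=.
  have d0 : x ^+ 2 - qh t ^+ 2 != 0 by rewrite subr_eq0.
  have d1 : qh t ^+ 2 - x ^+ 2 != 0 by rewrite subr_eq0 eq_sym.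
  move: (k0 t) (u0 t) (qh t) nk0 nu0 nqh d0 d1 => k u p nk nu np d0 d1.
  by field; rewrite x0 d0 d1 nk nu np.
- by move=> e; exact: (pabcd_neq0 ht).
- move=> e ee j; split; last exact: (contour_poles j ee).2.
  by rewrite mulrAC -exprS mulrC; exact: (contour_poles j.+1 ee).1.
- move=> x x0 x1; rewrite /Delta /qpinfs !big_cons big_nil (@qpinf_eq0 R q q1 (q * x ^- 2) 0).
    by rewrite mul0r mulr0 mul0r.
  by rewrite expr0 mulr1 x1 divff.
- exact: w0_Delta.
Qed.

Lemma Y_adjoint f g : aw_form t c (opY t f) g = aw_form t c f (YopV t' g).
Proof. by rewrite /opY /YopV T1_adjoint T0_adjoint. Qed.

Let nz' : par_neq0 t'. Proof. by case: nz => *; split; rewrite /= invr_eq0. Qed.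

(* U' is the operator X^-1 T1^-1 for the inverted parameters; the right-hand
   side is its inverse. *)
Lemma Uop_adjoint f g : aw_form t c (Uop t f) g =
  aw_form t c f (lsb (Uop t' g) (lsc ((u1 t)^-1 - u1 t) g)).
Proof.
have := Uop_relation nz' g; rewrite [u1 t']/= invrK => rel.
have -> : lsb (Uop t' g) (lsc ((u1 t)^-1 - u1 t) g) = opT1 t' (lsh 1 g).
  by rewrite -rel; apply: lcoP => k; rewrite !lco_sb opprB addrC subrK.
rewrite /Uop form_shift opprK /T1V /heckeV form_sbl form_scl T1_adjoint.
rewrite /T1V /heckeV form_sbr form_scr /= invrK.
by ring.
Qed.
End Adjoint.

(** * Residues at simple poles *)

Section CircleIntegral.
Variable R : realType.
Local Notation C := (cplx R).

Lemma mvt_trig (f f' : R -> R) : (forall x : R, is_derive x (1 : R) f (f' x)) ->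
  forall x y : R, exists2 z, `|z - x| <= `|y - x| & f y - f x = f' z * (y - x).
Proof.
move=> fd; have fc : continuous f.
  by move=> x; apply: differentiable_continuous; apply/derivable1_diffP; exact: ex_derive.
have main (x y : R) : x < y -> exists2 z, x < z < y & f y - f x = f' z * (y - x).
  move=> xy; have [|z] := @MVT _ f f' x y xy (fun z _ => fd z).
    by apply: continuous_subspaceT.
  by rewrite in_itv /= => zxy e; exists z.
move=> x y; case: (ltgtP x y) => [xy|xy|->].
- have [z /andP[z1 z2] e] := main _ _ xy; exists z => //.
  by rewrite !ger0_norm; lra.
- have [z /andP[z1 z2] e] := main _ _ xy; exists z; last lra.
  by rewrite !ler0_norm; lra.
- by exists y; rewrite ?subrr ?mulr0.
Qed.

Lemma sin_lip (x y : R) : `|sin y - sin x| <= `|y - x|.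
Proof.
have [z _ ->] := @mvt_trig sin cos (fun x => is_derive_sin x) x y.
rewrite normrM ler_piMl// ler_norml cos_geN1 cos_le1//.
Qed.

Lemma cos_lip (x y : R) : `|cos y - cos x| <= `|y - x|.
Proof.
have [z _ ->] := @mvt_trig cos (fun x => - sin x) (fun x => is_derive_cos x) x y.
by rewrite normrM normrN ler_piMl// ler_norml sin_geN1 sin_le1.
Qed.

Lemma sin_taylor (w x y : R) :
  `|sin y - sin x - cos w * (y - x)| <= (`|x - w| + `|y - x|) * `|y - x|.
Proof.
have [z zx ->] := @mvt_trig sin cos (fun x => is_derive_sin x) x y.
rewrite -mulrBl normrM ler_wpM2r// (le_trans (cos_lip _ _))//.
rewrite -(subrKA x) (le_trans (ler_normD _ _))// addrC lerD//.
Qed.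

Lemma cos_taylor (w x y : R) :
  `|cos y - cos x + sin w * (y - x)| <= (`|x - w| + `|y - x|) * `|y - x|.
Proof.
have [z zx ->] := @mvt_trig cos (fun x => - sin x) (fun x => is_derive_cos x) x y.
rewrite mulNr addrC -mulrBl normrM ler_wpM2r// distrC (le_trans (sin_lip _ _))//.
rewrite -(subrKA x) (le_trans (ler_normD _ _))// addrC lerD//.
Qed.

Definition unit_circle (t : R) : C := Complex (cos (2 * pi * t)) (sin (2 * pi * t)).

Lemma unit_circle_nm t : nm (unit_circle t) = 1.
Proof. by rewrite /nm normc_def /= cos2Dsin2 sqrtr1. Qed.

Lemma unit_circle_neq0 t : unit_circle t != 0.
Proof. by rewrite -nm_gt0 unit_circle_nm. Qed.

(** The modulus is bounded by the sum of the two coordinates, whence 4 pi instead of 2 pi. *)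
Lemma unit_circle_lip s t : nm (unit_circle t - unit_circle s) <= 4 * pi * `|t - s|.
Proof.
rewrite (_ : unit_circle t - unit_circle s = Complex (cos (2 * pi * t) - cos (2 * pi * s))
  (sin (2 * pi * t) - sin (2 * pi * s)))//.
apply: le_trans (nm_ReIm _) _; rewrite /=.
have e : `|2 * pi * t - 2 * pi * s| = 2 * pi * `|t - s|.
  by rewrite -mulrBr normrM gtr0_norm// mulr_gt0// pi_gt0.
have := sin_lip (2 * pi * s) (2 * pi * t); have := cos_lip (2 * pi * s) (2 * pi * t).
rewrite e; lra.
Qed.

(** First-order expansion of exp(2 pi i t) with the derivative taken at a tag [w]. The constant is
    twice (2 pi)^2, one share for each coordinate. *)
Lemma unit_circle_taylor w s t :
  nm (unit_circle t - unit_circle s - two_pi_i R * unit_circle w * ((t - s)%:C)%C) <=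
  8 * pi ^+ 2 * (`|s - w| + `|t - s|) * `|t - s|.
Proof.
pose p := 2 * pi : R; have p0 : 0 < p by rewrite mulr_gt0// pi_gt0.
rewrite (_ : _ - _ = Complex
  (cos (p * t) - cos (p * s) + sin (p * w) * (p * t - p * s))
  (sin (p * t) - sin (p * s) - cos (p * w) * (p * t - p * s))); last first.
  rewrite /unit_circle /two_pi_i /real_complex_def -/p.
  apply/eqP; rewrite eq_complex /=; apply/andP; split; apply/eqP; ring.
apply: le_trans (nm_ReIm _) _; rewrite /=.
have e u v : `|p * u - p * v| = p * `|u - v|.
  by rewrite -mulrBr normrM gtr0_norm.
have := sin_taylor (p * w) (p * s) (p * t); have := cos_taylor (p * w) (p * s) (p * t).
rewrite !e => h1 h2; apply: le_trans (lerD h1 h2) _.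
by rewrite le_eqVlt; apply/orP; left; apply/eqP; rewrite /p; ring.
Qed.

Lemma circleE (y : C) r t : circle y r t = y + (r%:C)%C * unit_circle t.
Proof. by []. Qed.

Lemma circle_variation (y : C) r : 0 < r -> variation_le (circle y r) (4 * pi * r).
Proof.
move=> r0 s sp; apply: le_trans (_ : \sum_(i < size s) 4 * pi * r *
   (subdiv_pt s i.+1 - subdiv_pt s i) <= _).
  apply: ler_sum => i _; rewrite !circleE opprD addrACA subrr add0r -mulrBr nmM.
  rewrite nm_real gtr0_norm//.
  have := unit_circle_lip (subdiv_pt s i) (subdiv_pt s i.+1).
  rewrite ger0_norm; last by rewrite subr_ge0 ltW// subdiv_pt_lt.
  move=> h; rewrite (_ : 4 * pi * r * _ = r * (4 * pi * (subdiv_pt s i.+1 - subdiv_pt s i))); last by ring.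
  by rewrite ler_wpM2l// ltW.
rewrite -mulr_sumr -(big_mkord xpredT (fun i => subdiv_pt s i.+1 - subdiv_pt s i)).
rewrite (telescope_sumr (subdiv_pt s))// subdiv_pt_size// subdiv_pt0 subr0 mulr1//.
Qed.

Lemma circle_ucont (y : C) r : 0 < r -> ucont (circle y r).
Proof.
move=> r0 e e0; have p0 : 0 < 4 * pi * r by rewrite !mulr_gt0// pi_gt0.
exists (e / (4 * pi * r)); first by rewrite divr_gt0.
move=> s t _ _ st; rewrite !circleE opprD addrACA subrr add0r -mulrBr nmM.
rewrite nm_real gtr0_norm//.
move: st; rewrite ltr_pdivlMr// => st; apply: le_lt_trans st.
have h := unit_circle_lip t s; apply: le_trans (ler_wpM2l (ltW r0) h) _.
by rewrite le_eqVlt; apply/orP; left; apply/eqP; ring.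
Qed.

(** Each term of the sum is 2 pi i times the increment of the parameter, up to a quadratic error.
    Both distances in the Taylor bound are at most the mesh, which doubles 8 pi^2 to [K]. *)
Lemma circle_winding (y : C) r : 0 < r ->
  rs_int (fun t => (circle y r t - y)^-1) (circle y r) (two_pi_i R).
Proof.
move=> r0 e e0; pose K : R := 16 * pi ^+ 2.
have K0 : 0 < K by rewrite mulr_gt0// exprn_gt0// pi_gt0.
exists (e / (2 * K)); first by rewrite divr_gt0// mulr_gt0.
move=> s tau [sp sh]; rewrite /rsum.
have -> : two_pi_i R = \sum_(i < size s) two_pi_i R *
    ((subdiv_pt s i.+1 - subdiv_pt s i)%:C)%C.
  rewrite -mulr_sumr -rmorph_sum /=.
  rewrite -(big_mkord xpredT (fun i => subdiv_pt s i.+1 - subdiv_pt s i)).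
  by rewrite (telescope_sumr (subdiv_pt s))// subdiv_pt_size// subdiv_pt0 subr0 rmorph1 mulr1.
rewrite -sumrB; apply: le_lt_trans (nm_sum _ _ _) _.
apply: (@le_lt_trans _ _ (\sum_(i < size s) (e / 2) * (subdiv_pt s i.+1 - subdiv_pt s i))).
  apply: ler_sum => i _; have [d1 /andP[d2 d3]] := sh i (ltn_ord i).
  have rc : (r%:C)%C != 0 :> C by rewrite -nm_gt0 nm_real gtr0_norm.
  have u0 := unit_circle_neq0 (tau i).
  have -> : (circle y r (tau i) - y)^-1 * (circle y r (subdiv_pt s i.+1) - circle y r (subdiv_pt s i))
      - two_pi_i R * ((subdiv_pt s i.+1 - subdiv_pt s i)%:C)%C =
    (unit_circle (tau i))^-1 * (unit_circle (subdiv_pt s i.+1) - unit_circle (subdiv_pt s i) -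
      two_pi_i R * unit_circle (tau i) * ((subdiv_pt s i.+1 - subdiv_pt s i)%:C)%C).
    rewrite !circleE; move: (unit_circle (tau i)) (unit_circle (subdiv_pt s i.+1))
      (unit_circle (subdiv_pt s i)) u0 => a u b a0.
    move: (two_pi_i R) (((subdiv_pt s i.+1 - subdiv_pt s i)%:C)%C : C) => p z.
    move: ((r%:C)%C : C) rc => rho rho0.
    have -> : y + rho * a - y = rho * a by ring.
    by field; rewrite rho0 a0.
  rewrite nmM nmV unit_circle_nm invr1 mul1r.
  apply: le_trans (unit_circle_taylor _ _ _) _.
  set D := subdiv_pt s i.+1 - subdiv_pt s i in d1 *.
  have D0 : 0 <= D by rewrite subr_ge0 ltW// subdiv_pt_lt.
  rewrite (ger0_norm D0) ler_wpM2r//.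
  have wD : `|subdiv_pt s i - tau i| <= D by rewrite ler0_norm /D; lra.
  apply: (@le_trans _ _ (8 * pi ^+ 2 * (2 * (e / (2 * K))))).
    rewrite ler_wpM2l ?mulr_ge0 ?exprn_ge0 ?pi_ge0//; lra.
  rewrite le_eqVlt; apply/orP; left; apply/eqP; rewrite /K.
  have := pi_gt0 R; move: (pi : R) => P P0; field; exact: lt0r_neq0.
rewrite -mulr_sumr -(big_mkord xpredT (fun i => subdiv_pt s i.+1 - subdiv_pt s i)).
rewrite (telescope_sumr (subdiv_pt s))// subdiv_pt_size// subdiv_pt0 subr0 mulr1; lra.
Qed.

(** Write f as H(y)/(x - y) plus (H(x) - H(y))/(x - y). The first part gives exactly H(y); the
    second has size eta/r on a circle of length at most 4 pi r, a bound that does not depend on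
    r. *)
Lemma residue_pole (f H : C -> C) (y : C) (d : R) : 0 < d ->
  (forall x, nm (x - y) < d -> {for x, continuous H}) ->
  (forall x, nm (x - y) < d -> x != y -> f x = H x / (x - y)) ->
  residue f y = H y.
Proof.
move=> d0 Hc fE; apply: cvg_lim => //.
apply/cvg_nmP => e e0.
have p4 : 0 < 4 * pi + 1 :> R by rewrite addr_gt0// mulr_gt0// pi_gt0.
have np : 0 < nm (two_pi_i R)^-1 + 1 by rewrite ltr_wpDl ?nm_ge0.
pose eta := e / (nm (two_pi_i R)^-1 + 1) / (4 * pi + 1).
have eta0 : 0 < eta by rewrite /eta divr_gt0// divr_gt0.
have Hy : {for y, continuous H} by apply: Hc; rewrite subrr nm0.
have /cvg_nmP/(_ _ eta0)/near_nmP[d1 d10 hd1] := Hy.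
near=> r.
have r0 : 0 < r by near: r; exact: nbhs_right_gt.
have rd : r < d by near: r; exact: nbhs_right_lt.
have rd1 : r < d1 by near: r; exact: nbhs_right_lt.
have onc t : nm (circle y r t - y) = r.
  by rewrite circleE addrAC subrr add0r nmM unit_circle_nm mulr1 nm_real gtr0_norm.
have ne t : circle y r t - y != 0 by rewrite -nm_gt0 onc.
have cwc : wcont (circle y r).
  move=> t t01 e1 e10; have [d2 d20 h2] := circle_ucont y r0 e10.
  by exists d2 => // u u01; apply: h2.
have fc t : {for circle y r t, continuous (fun x => H x / (x - y))}.
  apply: continuousM; first by apply: Hc; rewrite onc.
  apply: (@continuousV _ _ (fun x => x - y)); first exact: ne.
  by apply: continuousB; [exact: cvg_id|exact: cst_continuous].
have [l hl] := cint_exists cwc (circle_variation y r0) (fun t _ => fc t).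
have fl : rs_int (f \o circle y r) (circle y r) l.
  apply: rs_int_ext hl => t _ /=; rewrite fE// ?onc//.
  by rewrite -subr_eq0.
rewrite (@contour_int_eq _ _ _ l); last by apply/contour_intE.
have hI := rs_intD hl (rs_intZ (- H y) (circle_winding y r0)).
have er0 : 0 <= eta / r by rewrite divr_ge0// ltW.
have := @rs_int_bound R _ _ _ _ (eta / r) (circle_variation y r0) hI er0 _.
have hB t : 0 <= t <= 1 -> nm (H (circle y r t) / (circle y r t - y) + - H y / (circle y r t - y)) <= eta / r.
  move=> _; rewrite -mulrDl nmM nmV onc ler_wpM2r ?invr_ge0 ?(ltW r0)// nmB ltW//.
  by apply: hd1; rewrite nmB onc.
move=> /(_ hB).
have -> : eta / r * (4 * pi * r) = eta * (4 * pi) by field; rewrite gt_eqF.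
move=> hb; have -> : H y - (two_pi_i R)^-1 * l = - ((two_pi_i R)^-1 * (l + - H y * two_pi_i R)).
  have := two_pi_i_neq0 R; move: (two_pi_i R) (H y) => p h p0; by field.
rewrite nmN nmM; apply: le_lt_trans (ler_wpM2l (nm_ge0 _) hb) _.
have -> : e = (nm (two_pi_i R)^-1 + 1) * (eta * (4 * pi + 1)).
  rewrite /eta; have := lt0r_neq0 np; have := lt0r_neq0 p4.
  by move: (nm _ + 1) (4 * pi + 1) => a b b0 a0; field; rewrite a0 b0.
have h1 : eta * (4 * pi) < eta * (4 * pi + 1) by rewrite ltr_pM2l// ltrDl.
have h2 : 0 <= eta * (4 * pi) by apply: mulr_ge0; [exact: ltW|rewrite mulr_ge0 ?pi_ge0].
have h3 : 0 <= nm (two_pi_i R)^-1 by exact: nm_ge0.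
by apply: ltr_pM => //; rewrite ltrDl.
Unshelve. all: by end_near. Qed.

Lemma near_notin (E : seq C) (y : C) : exists2 d : R, 0 < d &
  forall x, nm (x - y) < d -> x != y -> x \notin E.
Proof.
elim: E => [|z E [d d0 hd]]; first by exists 1.
have [->|zy] := eqVneq z y.
  by exists d => // x xy xny; rewrite inE negb_or xny hd.
exists (Num.min d (nm (z - y))); first by rewrite lt_min d0 nm_gt0 subr_eq0.
move=> x; rewrite lt_min => /andP[x1 x2] xny; rewrite inE negb_or hd// andbT.
by apply: contraTN x2 => /eqP ->; rewrite ltxx.
Qed.

Lemma simple_poleP (f : C -> C) (y : C) : y != 0 -> has_simple_pole f y ->
  exists (h : C -> C) (d : R), [/\ 0 < d, h y != 0, {for y, continuous h},
    forall x, nm (x - y) < d -> x != y -> f x = h x / (x - y) &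
    residue (fun z => f z / z) y = h y / y].
Proof.
move=> y0 [h [hd hy hf]].
have [d1 d10 h1] : exists2 d : R, 0 < d & forall x, nm (y - x) < d -> {for x, continuous h}.
  have /near_nmP[d d0 hdd] := hd; exists d => // x /hdd hx.
  by apply: differentiable_continuous; apply/derivable1_diffP.
have [d2 d20 h2] : exists2 d : R, 0 < d & forall x, nm (y - x) < d -> x != y ->
    f x = h x / (x - y).
  have /near_nmP[d d0 hdd] : \forall x \near y, x != y -> f x = h x / (x - y).
    by move: hf; rewrite near_withinE.
  by exists d.
(* The radius is at most |y| so that dividing by z stays harmless near [y]. *)
exists h, (Num.min (Num.min d1 d2) (nm y)).
have d0 : 0 < Num.min (Num.min d1 d2) (nm y) by rewrite !lt_min d10 d20 nm_gt0.
have hh x : nm (x - y) < Num.min (Num.min d1 d2) (nm y) -> x != y -> f x = h x / (x - y).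
  by rewrite !lt_min nmB => /andP[/andP[_ x2] _]; exact: h2.
split=> //; first by apply: h1; rewrite subrr nm0.
apply: (residue_pole (H := fun x => h x / x) d0) => x xd.
  have x0 : x != 0.
    by apply: contraTneq xd => ->; rewrite sub0r nmN !lt_min ltxx andbF.
  apply: continuousM; last exact: inv_continuous.
  by apply: h1; move: xd; rewrite !lt_min nmB => /andP[/andP[]].
move=> xny; rewrite hh//; ring.
Qed.
End CircleIntegral.

(** * The bilinear form does not vanish *)

Section Nondegenerate.
Variables (R : realType) (t : par R) (c : R -> cplx R).
Local Notation C := (cplx R).
Implicit Types (f g h : laurent R) (x : C).
Hypotheses (ht : generic_par t) (hc : admissible_contour t c).
Local Notation q := (qq t).

Let nz := generic_neq0 ht.
Let nz_qh : qh t != 0. Proof. by case: nz. Qed.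
Let nz_q : q != 0. Proof. exact: expf_neq0. Qed.
Let q1 := generic_nmq ht.
Let wc := contour_wcont hc.
Let cl := contour_closed hc.
Let x0 := contour_neq0 hc.

Lemma cint_laurent f : rs_int (fun s => lev f (c s) / c s) c (two_pi_i R * lco 0 f).
Proof.
have [_ /rectifiable_nm[M cM] cc c0 _] := hc.
have a0 : avoids c 0 by exact: x0.
have mono (k : int) : rs_int (fun s => c s ^ k / c s) c (two_pi_i R * (k == 0)%:R).
  case: k => [[|n]|n].
  - rewrite eqxx mulr1; apply: rs_int_ext (winding_interior wc cM cc c0) => s s01.
    by rewrite subr0 expr0z mul1r.
  - rewrite mulr0; apply: rs_int_ext (cint_xn wc cl cM n) => s s01.
    by rewrite -exprnP exprSr mulfK// x0.
  - rewrite mulr0; apply: rs_int_ext (cint_subV wc cl cM n a0) => s s01.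
    by rewrite subr0 NegzE -exprnN -exprVn -exprSr.
have := rs_int_sum (enum_fset (msupp f)) (fun k => rs_intZ (mcoeff k f) (mono k)).
have -> : \sum_(k <- enum_fset (msupp f)) mcoeff k f * (two_pi_i R * (k == 0)%:R) =
    two_pi_i R * lco 0 f.
  rewrite lcoE; have [f0|f0] := boolP (0 \in msupp f).
    rewrite (bigD1_seq 0) ?fset_uniq//= mulr1 mulrC big1 ?addr0// => k /negPf ->.
    by rewrite !mulr0.
  rewrite (mcoeff_outdom f0) mulr0 big1_seq// => k /andP[_ kf].
  by case: eqP kf f0 => [-> ->//|_ _ _]; rewrite !mulr0.
apply: rs_int_ext => s _.
rewrite levE /leval mulr_suml; apply: eq_bigr => k _.
by rewrite mulrA.
Qed.

(** The truncated theta function (x^2; q)_n (q x^-2; q)_n. One step multiplies by (1 - q^n x^2)(1 -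
    q^(n+1) x^-2), here expanded. *)
Fixpoint theta (n : nat) : laurent R :=
  if n is n'.+1 then lsb (lsb (lsc (1 + q ^+ n' * q ^+ n) (theta n')) (lsc (q ^+ n') (lsh 2 (theta n'))))
    (lsc (q ^+ n) (lsh (- 2) (theta n')))
  else lone R.

Lemma lev_theta n x : x != 0 ->
  lev (theta n) x = qpoch q n (x ^+ 2) * qpoch q n (q * x ^- 2).
Proof.
move=> xn0; elim: n => [|n IH]; first by rewrite lev_one /qpoch !big_ord0 mulr1.
rewrite /= !lev_sb !lev_sc !lev_sh// IH !qpochS -exprnN -exprnP exprS.
have x2 : x ^+ 2 != 0 by rewrite expf_neq0.
set A := qpoch q n (x ^+ 2); set B := qpoch q n (q * x ^- 2).
move: A B (q ^+ n) => A B p; move: (x ^+ 2) x2 => y y0.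
move: (q : C) => r; by field.
Qed.

(* The q-shift x -> qh x links neighbouring Laurent coefficients of theta. *)
Lemma theta_rec n (k : int) : lco k (theta n) * (1 - q ^+ n * qh t ^ k) =
  lco (k - 2) (theta n) * (q ^+ n - qh t ^ (k - 2)).
Proof.
(* Two reflections compose to the dilation x -> qh x. *)
pose S := lrf 1 (lrf (qh t) (theta n)).
have e : lsb (lsh 2 S) (lsc (q ^+ n) S) = lsb (lsc (q ^+ n) (lsh 2 (theta n))) (theta n).
  apply: (@lev_inj _ [::]) => x xn0 _.
  have qx : qh t * x != 0 by exact: mulf_neq0.
  rewrite !lev_sb !lev_sc !lev_sh// !lev_rf !div1r invrK -exprnP.
  rewrite !lev_theta// exprMn -/q.
  have -> : q * (q * x ^+ 2)^-1 = x ^- 2 by rewrite invfM mulrA divff// mul1r.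
  have hA : qpoch q n (q * x ^+ 2) * (1 - x ^+ 2) = qpoch q n (x ^+ 2) * (1 - x ^+ 2 * q ^+ n).
    by rewrite -qpochS -[n.+1]add1n qpochD /qpoch big_ord1 expr0 expr1 mulr1 mulrC [q * _]mulrC.
  have hB : qpoch q n (x ^- 2) * (1 - x ^- 2 * q ^+ n) = (1 - x ^- 2) * qpoch q n (q * x ^- 2).
    by rewrite -qpochS -[n.+1]add1n qpochD /qpoch big_ord1 expr0 expr1 mulr1 [q * _]mulrC.
  have x2 : x ^+ 2 != 0 by rewrite expf_neq0.
  set A := qpoch q n (q * x ^+ 2) in hA *; set B := qpoch q n (x ^- 2) in hB *.
  set P := qpoch q n (x ^+ 2) in hA *; set Q := qpoch q n (q * x ^- 2) in hB *.
  move: A B P Q hA hB => A B P Q; move: (x ^+ 2) x2 (q ^+ n) => y y0 p hA hB.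
  have -> : y * (A * B) - p * (A * B) = A * y * (B * (1 - y^-1 * p)) by field.
  rewrite hB; have -> : A * y * ((1 - y^-1) * Q) = - (A * (1 - y)) * Q by field.
  by rewrite hA; ring.
have := congr1 (lco k) e; rewrite !lco_sb !lco_sc !lco_sh !lco_rf !opprK !exp1rz !mulr1.
move: (lco k _) (lco (k - 2) _) (qh t ^ k) (qh t ^ _) (q ^+ n) => a b u v p h.
have : a * (1 - p * u) - b * (p - v) = (b * v - p * (a * u)) - (p * b - a) by ring.
by rewrite h subrr => /eqP; rewrite subr_eq0 => /eqP.
Qed.

(** The constant term is the central q-binomial coefficient. Passing to n + 1 involves the
    coefficients at 2 and -2, which [theta_rec] for k = 2 and k = 0 expresses through the constant
    one. *)
Lemma theta_coef0 n : lco 0 (theta n) * qpoch q n q ^+ 2 = qpoch q n.*2 q.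
Proof.
have [_ qn1 _ _] := alg_generic_of ht.
elim: n => [|n IH]; first by rewrite lco_one /qpoch !big_ord0 expr1n mulr1.
have d1 : 1 - q ^+ n.+1 != 0 by rewrite subr_eq0 eq_sym.
have q2 : qh t ^ (2 : int) = q by [].
have r1 := theta_rec n 2; have r2 := theta_rec n 0.
rewrite q2 subrr expr0z in r1.
rewrite expr0z mulr1 sub0r (_ : qh t ^ (- 2) = q^-1) // in r2.
have c1 : lco 2 (theta n) = - lco 0 (theta n) * (1 - q ^+ n) / (1 - q ^+ n.+1).
  by apply: (mulIf d1); rewrite divfK// exprSr r1; ring.
have c2 : lco (- 2) (theta n) = - q * lco 0 (theta n) * (1 - q ^+ n) / (1 - q ^+ n.+1).
  apply: (mulIf d1); rewrite divfK// -mulrA r2 exprSr.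
  by move: (lco _ _) (q ^+ n) => a p; move: (q : C) nz_q => r r0; field.
have -> : lco 0 (theta n.+1) = lco 0 (theta n) * ((1 - q ^+ n.*2.+1) * (1 - q ^+ n.*2.+2)) / (1 - q ^+ n.+1) ^+ 2.
  rewrite /= !lco_sb !lco_sc !lco_sh sub0r opprK add0r c1 c2.
  rewrite !exprS -!addnn exprD; move: d1; rewrite exprS.
  move: (lco 0 _) (q ^+ n) => a p; move: (q : C) nz_q => r r0 d1.
  by field.
rewrite doubleS !qpochS -IH -!exprS exprMn.
by move: (1 - q ^+ n.+1) d1 => d d0; field.
Qed.

Lemma form_nondegenerate : ~ (forall f, aw_form t c f (lone R) = 0).
Proof.
move=> hall; have [_ /rectifiable_nm[M cM] cc c0 _] := hc.
pose th (x : C) : C := qpinf q (x ^+ 2) * qpinf q (q * x ^- 2).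
have csq s : 0 <= s <= 1 -> {for c s, continuous (fun x : C => q * x ^- 2)}.
  move=> s01; apply: continuousM; first exact: cst_continuous.
  exact: (@exprz_continuous R (- 2%:Z) _ (x0 s01)).
have wi : wcont ((fun x : C => x^-1) \o c).
  by apply: (wcont_comp wc) => s s01; apply: inv_continuous; exact: x0.
have u1 : ulim c (fun n x => qpoch q n (x ^+ 2) * qpoch q n (q * x ^- 2) * x^-1) (fun x => th x * x^-1).
  apply: ulimM; last exact: ulim_cst.
  apply: ulimM; apply: (ulim_qpinf wc q1) => s s01; [exact: continuous_sqr|exact: csq].
(* The truncated denominator of [Delta] is a Laurent polynomial, hence an admissible [f] in the
   hypothesis; in the limit it cancels the denominator and leaves the theta function. *)
pose den n (x : C) : C := \prod_(e <- pabcd t) qpoch q n (e * x) *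
  \prod_(e <- [:: q * pa t; q * pb t; pc t; pd t]) qpoch q n (e * x^-1).
pose Den (x : C) : C := \prod_(e <- pabcd t) qpinf q (e * x) *
  \prod_(e <- [:: q * pa t; q * pb t; pc t; pd t]) qpinf q (e * x^-1).
have den_laurent n : exists f, forall x, x != 0 -> lev f x = den n x.
  pose isL (F : C -> C) := exists f, forall x, x != 0 -> lev f x = F x.
  have isM F G : isL F -> isL G -> isL (fun x => F x * G x).
    move=> [f hf] [g hg]; exists (lml f g) => x xn0.
    by rewrite lev_ml// hf// hg.
  have is1 : isL (fun=> 1) by exists (lone R) => x _; rewrite lev_one.
  have isP (I : Type) (r : seq I) (F : I -> C -> C) : (forall i, isL (F i)) ->
      isL (fun x => \prod_(i <- r) F i x).
    move=> h; elim: r => [|i r [f hf]].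
      by have [f hf] := is1; exists f => x xn0; rewrite big_nil hf.
    have [g hg] := h i; exists (lml g f) => x xn0.
    by rewrite lev_ml// hg// hf// big_cons.
  have isl (k : int) (e b : C) : isL (fun x => 1 - e * x ^ k * b).
    exists (lsb (lone R) (lsc (e * b) (lmn R k))) => x xn0.
    by rewrite lev_sb lev_sc lev_one lev_mn mulrAC.
  apply: (isM (fun x => \prod_(e <- pabcd t) qpoch q n (e * x))
    (fun x => \prod_(e <- [:: q * pa t; q * pb t; pc t; pd t]) qpoch q n (e * x^-1))).
    apply: (isP _ _ (fun e x => qpoch q n (e * x))) => e.
    by apply: (isP _ _ (fun (j : 'I_n) x => 1 - e * x * q ^+ j)) => j; exact: (isl 1).
  apply: (isP _ _ (fun e x => qpoch q n (e * x^-1))) => e.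
  by apply: (isP _ _ (fun (j : 'I_n) x => 1 - e * x^-1 * q ^+ j)) => j; exact: (isl (- 1)).
have udelta : ulim c (fun n x => den n x * (Delta t x * x^-1)) (fun x => Den x * (Delta t x * x^-1)).
  apply: ulimM.
    apply: ulimM; apply: ulim_prod => e _; apply: (ulim_qpinf wc q1) => s s01.
      exact: mulrl_continuous.
    apply: continuousM; first exact: cst_continuous.
    by apply: inv_continuous; exact: x0.
  apply: ulim_cst; apply: (wcontM (phi := Delta t \o c) _ wi).
  by apply: (wcont_comp wc) => s s01; exact: (Delta_continuous ht hc s01).
have DenDelta s : 0 <= s <= 1 -> Den (c s) * (Delta t (c s) * (c s)^-1) = th (c s) * (c s)^-1.
  move=> s01; rewrite mulrA; congr (_ * _).
  have DD : Den (c s) = qpinfs q [:: pa t * c s; pb t * c s; pc t * c s; pd t * c s;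
      q * pa t * (c s)^-1; q * pb t * (c s)^-1; pc t * (c s)^-1; pd t * (c s)^-1].
    by rewrite /Den /qpinfs !big_cons !big_nil !mulr1 !mulrA.
  have D0 : Den (c s) != 0 by rewrite DD; exact: (Delta_den_neq0 ht hc s01).
  rewrite /Delta -DD mulrCA divff// mulr1 /th /qpinfs !big_cons big_nil mulr1//.
have I0 : rs_int (fun s => th (c s) * (c s)^-1) c 0.
  apply: rs_int_ext (_ : rs_int ((fun x => Den x * (Delta t x * x^-1)) \o c) c 0) => [s s01|].
    exact: DenDelta.
  apply: (ulim_rs_int cM udelta) => n; have [f hf] := den_laurent n.
  have := form_int ht hc f (lone R); rewrite hall mulr0.
  apply: rs_int_ext => s s01; rewrite /= /form_integrand !levE -!levE lev_one hf ?x0//.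
  by rewrite mulr1 mulrA.
have In n : rs_int (fun s => (qpoch q n (c s ^+ 2) * qpoch q n (q * c s ^- 2)) * (c s)^-1) c
    (two_pi_i R * lco 0 (theta n)).
  by apply: rs_int_ext (cint_laurent (theta n)) => s s01; rewrite lev_theta// x0.
have pi0 : 0 < nm (two_pi_i R) by rewrite nm_gt0 two_pi_i_neq0.
(* Truncated and full theta functions are uniformly close on the curve, hence so are their
   integrals, and that of the full one is zero. *)
have coef_small (e : R) : 0 < e -> exists N, forall n, (N <= n)%N -> nm (lco 0 (theta n)) <= e.
  move=> e0; have M0 := variation_ge0 cM; have M1 : 0 < M + 1 by rewrite ltr_wpDl.
  have e1 : 0 < e * nm (two_pi_i R) / (M + 1) by rewrite divr_gt0// mulr_gt0.
  have [_ /(_ _ e1)[N hN]] := u1; exists N => n /hN h.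
  have := rs_intD (In n) (rs_intZ (-1) I0); rewrite mulr0 addr0 => hI.
  have := @rs_int_bound R _ _ _ _ (e * nm (two_pi_i R) / (M + 1)) cM hI (ltW e1) _.
  have hB s : 0 <= s <= 1 -> nm (qpoch q n (c s ^+ 2) * qpoch q n (q * c s ^- 2) * (c s)^-1 +
     -1 * (th (c s) * (c s)^-1)) <= e * nm (two_pi_i R) / (M + 1).
    by move=> s01; rewrite mulN1r ltW// h.
  move=> /(_ hB); rewrite nmM => hb.
  rewrite -(ler_pM2l pi0) (le_trans hb)// mulrAC ler_pdivrMr//.
  by rewrite [e * _]mulrC ler_wpM2l ?mulr_ge0 ?nm_ge0 ?(ltW e0)// lerDl.
have qq0 : qpinf q q != 0.
  apply: (qpinf_neq0 q1) => j; rewrite -exprS.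
  by case: (alg_generic_of ht) => _ h _ _; exact: h.
(* [E] bounds every (q; q)_n. Multiplied by (q; q)_n^2 the constant term is (q; q)_2n, whose limit
   (q; q)_oo is nonzero; this excludes that the constant term becomes small. *)
pose E := expR (1 / (1 - nm q)); have E0 : 0 < E by exact: expR_gt0.
have qb n : nm (qpoch q n q) <= E by apply: qpoch_bound => //; exact: ltW.
pose eps := nm (qpinf q q) / 2.
have eps0 : 0 < eps by rewrite divr_gt0// nm_gt0.
have [N1 h1] := qpinf_lim q1 q eps0.
have [N2 h2] := coef_small (eps / (2 * E ^+ 2)) (divr_gt0 eps0 (mulr_gt0 (ltr0n _ 2) (exprn_gt0 2 E0))).
pose n := maxn N1 N2.
have a1 : nm (qpoch q n.*2 q - qpinf q q) < eps.
  by apply: h1; rewrite -addnn (leq_trans (leq_maxl N1 N2))// leq_addr.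
have a2 : nm (qpoch q n.*2 q) <= eps / 2.
  rewrite -theta_coef0 nmM nmX.
  have -> : eps / 2 = eps / (2 * E ^+ 2) * E ^+ 2 by field; rewrite gt_eqF.
  apply: ler_pM; rewrite ?nm_ge0 ?exprn_ge0 ?nm_ge0//; first by apply: h2; exact: leq_maxr.
  by rewrite lerXn2r ?nnegrE ?nm_ge0 ?(ltW E0).
have := nmD (qpinf q q - qpoch q n.*2 q) (qpoch q n.*2 q); rewrite subrK nmB.
move: a1 a2 eps0; rewrite /eps; lra.
Qed.
End Nondegenerate.

(** * Norms of the eigenfunctions *)

Section Norms.
Variables (R : realType) (t : par R) (c : R -> cplx R).
Local Notation C := (cplx R).
Implicit Types (f g h : laurent R) (x : C).
Hypotheses (ht : generic_par t) (hc : admissible_contour t c).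
Local Notation q := (qq t).
Local Notation t' := (inv_par t).
Local Notation td := (dual_par t).

Let ag := alg_generic_of ht.
Let ag' := alg_generic_inv ht.
Let nz := generic_neq0 ht.
Let nz' : par_neq0 t'. Proof. by case: ag'. Qed.
Let nz_qh : qh t != 0. Proof. by case: nz. Qed.
Let nz_q : q != 0. Proof. exact: expf_neq0. Qed.

Lemma gam_inv m : gam t' m = (gam t m)^-1.
Proof. by rewrite /gam /qq /= -invfM exprVn !exprz_inv invfM !invr_expz. Qed.

Lemma lamb_inv r : lamb t' r = (lamb t r)^-1.
Proof. exact: gam_inv. Qed.

(** The adjoint of Y is the inverse of Y for inverted parameters, with eigenvalue [lamb t s] on the
    second argument; distinct ranks have distinct eigenvalues. *)
Lemma biorthogonal r s : r != s -> aw_form t c (Eb t r) (Eb t' s) = 0.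
Proof.
move=> rs; have := Y_adjoint ht hc (Eb t r) (Eb t' s).
rewrite (Eb_eig ag) (YopV_eig nz' _ (Eb_eig ag' s)) ?lamb_neq0//.
rewrite (form_scl ht hc) (form_scr ht hc) lamb_inv invrK => /eqP.
rewrite -subr_eq0 -mulrBl mulf_eq0 subr_eq0 => /orP[/eqP/(lamb_inj ag) e|/eqP//].
by rewrite e eqxx in rs.
Qed.

Definition norm_form r : C := aw_form t c (Eb t r) (Eb t' r).

Lemma form_T1V f g (a : C) : aw_form t c f g = 0 ->
  aw_form t c f (T1V t' g) = aw_form t c f (opT1 t' g).
Proof. by move=> h; rewrite /T1V /heckeV (form_sbr ht hc) (form_scr ht hc) h mulr0 subr0. Qed.

(** Compute the form of T1 E_r against E'_(r+1) in two ways. Orthogonality keeps only the E_(r+1)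
    component of T1 E_r and, after T1 is moved to the other side, only the E'_r component; it also
    removes the correction between T1 and its inverse. *)
Lemma norm_form_odd r : odd r -> let l := lamb t r in
  k1 t * (1 - l / pa td) * (1 - l / pb td) * norm_form r.+1 =
  (k1 t)^-1 * (1 - pa td * l) * (1 - pb td * l) * norm_form r.
Proof.
move=> ro l; have l0 : l != 0 := lamb_neq0 ag r.
have l2 : l ^+ 2 != 1 := lamb_odd_sqr ag ro.
have ln : lamb t r.+1 = l^-1 by exact: lamb_odd_next.
have n1 : r != r.+1 by rewrite neq_ltn ltnSn.
have := T1_adjoint ht hc (Eb t r) (Eb t' r.+1).
rewrite form_T1V ?biorthogonal// (T1_Eb ag l2 ln).
rewrite (@T1_Eb _ _ ag' r.+1 r); last 2 first.
- by rewrite lamb_inv ln invrK.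
- by rewrite !lamb_inv ln invrK.
rewrite (form_adl ht hc) (form_adr ht hc) 2!(form_scl ht hc) 2!(form_scr ht hc).
rewrite (biorthogonal n1) mulr0 add0r mulr0 add0r -/(norm_form r) -/(norm_form r.+1) lamb_inv ln invrK.
rewrite (alphaT_k1 nz l0 l2) (alphaT_k1 nz' l0 l2).
have l2' : 1 - l ^+ 2 != 0 by rewrite subr_eq0 eq_sym.
have -> : pa (dual_par t') = (pa td)^-1 by rewrite /pa /= invfM.
have -> : pb (dual_par t') = (pb td)^-1 by rewrite /pb /= invrN invfM.
rewrite !invrK => h.
apply: (mulIf (invr_neq0 l2')).
by rewrite [LHS]mulrAC [RHS]mulrAC h ![l * _]mulrC.
Qed.

Lemma norm_form_even r : ~~ odd r -> let l := lamb t r in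
  (u1 t)^-1 * (1 - pc td * l) * (1 - pd td * l) * norm_form r.+1 =
  u1 t * (1 - q * l / pc td) * (1 - q * l / pd td) * norm_form r.
Proof.
move=> re l; have l0 : l != 0 := lamb_neq0 ag r.
have l2 : q * l ^+ 2 != 1 := lamb_even_sqr ag re.
have ln : lamb t r.+1 = (q * l)^-1 by exact: lamb_even_next.
have n1 : r != r.+1 by rewrite neq_ltn ltnSn.
have ql0 : q * l != 0 by exact: mulf_neq0.
have qE : qq t' = q^-1 by rewrite /qq /= exprVn.
have qql : q^-1 * (q * l) ^+ 2 = q * l ^+ 2.
  by move: (q : C) nz_q => p p0; field.
have l2' : qq t' * (q * l) ^+ 2 != 1 by rewrite qE qql.
have := Uop_adjoint ht hc (Eb t r) (Eb t' r.+1).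
rewrite (form_sbr ht hc) (form_scr ht hc) (biorthogonal n1) mulr0 subr0 (Uop_Eb ag l2 ln).
rewrite (@Uop_Eb _ _ ag' r.+1 r); last 2 first.
- by rewrite lamb_inv ln invrK.
- by rewrite !lamb_inv ln invrK qE mulKf.
rewrite (form_adl ht hc) (form_adr ht hc) 2!(form_scl ht hc) 2!(form_scr ht hc).
rewrite (biorthogonal n1) mulr0 add0r mulr0 add0r -/(norm_form r) -/(norm_form r.+1) lamb_inv ln invrK.
rewrite (alphaU_u1 nz l0 l2) (alphaU_u1 nz' ql0 l2') qE qql.
have d2 : 1 - q * l ^+ 2 != 0 by rewrite subr_eq0 eq_sym.
have -> : pc (dual_par t') = (pc td)^-1 by rewrite /pc /= !invfM.
have -> : pd (dual_par t') = (pd td)^-1 by rewrite /pd /= invrN !invfM.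
rewrite invrK => h.
apply: (mulIf (invr_neq0 d2)).
rewrite [LHS]mulrAC [RHS]mulrAC h ![_^-1 * (q * l)]mulrC//.
Qed.
End Norms.

(** * Reflections of Delta and the weights *)

Section DeltaReflections.
Variables (R : realType) (t : par R).
Local Notation C := (cplx R).
Implicit Types (x y : C).
Local Notation q := (qq t).
Hypotheses (nz : par_neq0 t) (q1 : nm q < 1).

Let nz_qh : qh t != 0. Proof. by case: nz. Qed.
Let nz_q : q != 0. Proof. exact: expf_neq0. Qed.

Lemma Delta_inv_alg (F : fieldType) (x a b X Y A B A' B' P1 P2 P3 P4 : F) :
  x != 0 -> 1 - x ^+ 2 != 0 -> 1 - a * x != 0 -> 1 - b * x != 0 -> x - a != 0 -> x - b != 0 ->
  (1 - x ^- 2) * Y * (X * 1) /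
   ((1 - a / x) * A' * ((1 - b / x) * B' * (P3 * (P4 * (A * (B * (P1 * (P2 * 1)))))))) *
   ((x - a) * (x - b)) =
  - ((1 - x ^+ 2) * X * (Y * 1) /
   ((1 - a * x) * A * ((1 - b * x) * B * (P1 * (P2 * (A' * (B' * (P3 * (P4 * 1))))))))) *
   ((1 - a * x) * (1 - b * x)).
Proof.
move=> x0 x2 a1 b1 a2 b2; rewrite !invfM.
move: A^-1 B^-1 A'^-1 B'^-1 P1^-1 P2^-1 P3^-1 P4^-1 => iA iB iA' iB' i1 i2 i3 i4.
have e z : x - z != 0 -> (1 - z / x)^-1 = x / (x - z).
  by move=> xz; field; rewrite x0 xz.
by rewrite !e//; field; rewrite oner_eq0 x0 a1 b1 a2 b2.
Qed.

(** The invariance of Delta(x) (1 - a x)(1 - b x)/(1 - x^2) under x -> 1/x, cleared of denominators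
    so that residues can be taken; the sign comes from 1 - x^2. *)
Lemma Delta_inv x : x != 0 -> x ^+ 2 != 1 ->
  1 - pa t * x != 0 -> 1 - pb t * x != 0 -> x - pa t != 0 -> x - pb t != 0 ->
  Delta t x^-1 * ((x - pa t) * (x - pb t)) =
  - Delta t x * ((1 - pa t * x) * (1 - pb t * x)).
Proof.
move=> x0 x1 a1 b1 a2 b2; have x2 : 1 - x ^+ 2 != 0 by rewrite subr_eq0 eq_sym.
rewrite /Delta /qpinfs !big_cons !big_nil !invrK exprVn invrK.
rewrite (qpinfS q1 (x ^+ 2)) (qpinfS q1 (x ^- 2)).
rewrite (qpinfS q1 (pa t * x)) (qpinfS q1 (pb t * x)).
rewrite (qpinfS q1 (pa t / x)) (qpinfS q1 (pb t / x)).
have e1 (e z : C) : e * z * q = q * e * z by rewrite mulrAC [e * q]mulrC.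
rewrite (e1 (pa t) x) (e1 (pb t) x) (e1 (pa t) x^-1) (e1 (pb t) x^-1).
rewrite [x ^+ 2 * q]mulrC [x ^- 2 * q]mulrC.
exact: Delta_inv_alg.
Qed.

Lemma Delta_qinv_alg (F : fieldType) (r x c d X Y A B A' B' P1 P2 P3 P4 : F) :
  r != 0 -> x != 0 -> r - x ^+ 2 != 0 -> x - c != 0 -> x - d != 0 ->
  r - c * x != 0 -> r - d * x != 0 ->
  Y * ((1 - x ^+ 2 / r) * X * 1) /
   (P3 * (P4 * (A' * (B' * (P1 * (P2 * ((1 - c * x / r) * A * ((1 - d * x / r) * B * 1)))))))) *
   ((r - c * x) * (r - d * x)) =
  - (X * ((1 - r * x ^- 2) * Y * 1) /
   (P1 * (P2 * (A * (B * (P3 * (P4 * ((1 - c / x) * A' * ((1 - d / x) * B' * 1))))))))) *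
   (r * ((x - c) * (x - d))).
Proof.
move=> r0 x0 x2 c1 d1 c2 d2; rewrite !invfM.
move: A^-1 B^-1 A'^-1 B'^-1 P1^-1 P2^-1 P3^-1 P4^-1 => iA iB iA' iB' i1 i2 i3 i4.
have e z : x - z != 0 -> (1 - z / x)^-1 = x / (x - z).
  by move=> xz; field; rewrite x0 xz.
have e' z : r - z != 0 -> (1 - z / r)^-1 = r / (r - z).
  by move=> xz; field; rewrite r0 xz.
by rewrite !e// !e'//; field; rewrite ?oner_eq0 ?r0 ?x0 ?c1 ?d1 ?c2 ?d2.
Qed.

Lemma Delta_qinv x : x != 0 -> q - x ^+ 2 != 0 ->
  x - pc t != 0 -> x - pd t != 0 -> q - pc t * x != 0 -> q - pd t * x != 0 ->
  Delta t (q / x) * ((q - pc t * x) * (q - pd t * x)) =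
  - Delta t x * (q * ((x - pc t) * (x - pd t))).
Proof.
move=> x0 x1 c1 d1 c2 d2.
have e1 (e : C) : q * e * (q / x)^-1 = e * x.
  by move: (q : C) nz_q => r r0; field; rewrite r0 x0.
have e2 : q * (q / x) ^- 2 = x ^+ 2 / q.
  by move: (q : C) nz_q => r r0; field; rewrite r0 x0.
have e3 (e : C) : e * (q / x)^-1 = e * x / q by move: (q : C) nz_q => r r0; field; rewrite r0 x0.
rewrite /Delta /qpinfs !big_cons !big_nil !e1 e2 !e3.
rewrite (qpinfS q1 (x ^+ 2 / q)) divfK// (qpinfS q1 (q * x ^- 2)).
rewrite (qpinfS q1 (pc t * x / q)) (qpinfS q1 (pd t * x / q)) !divfK//.
rewrite (qpinfS q1 (pc t / x)) (qpinfS q1 (pd t / x)).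
have e4 (e : C) : e / x * q = e * (q / x) by rewrite mulrAC mulrA.
have e5 (e : C) : q * e / x = e * (q / x) by rewrite mulrCA mulrA.
have e6 : (q / x) ^+ 2 = q * x ^- 2 * q.
  by move: (q : C) nz_q => r r0; field.
rewrite !e4 !e5 e6.
exact: Delta_qinv_alg.
Qed.
End DeltaReflections.

(** * Residues at two poles exchanged by a reflection *)

Section ResidueReflection.
Variable R : realType.
Local Notation C := (cplx R).
Implicit Types (x y s : C).

Lemma continuous_punctured_eq0 (g : C -> C) y (d : R) : 0 < d ->
  {for y, continuous g} ->
  (forall x, nm (x - y) < d -> x != y -> g x = 0) -> g y = 0.
Proof.
move=> d0 gc hg; apply: nm_lim_unique => e e0.
have /near_nmP[r r0 hr] : \forall x \near y, nm (g y - g x) < e.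
  by have /(@cvg_nmP R C (nbhs y) _ g (g y))/(_ _ e0) := gc.
pose m : R := Num.min r d / 2; have m0 : 0 < m by rewrite divr_gt0// lt_min r0.
have mr : m < Num.min r d by rewrite /m ltr_pdivrMr// ltr_pMr ?ltr1n// lt_min r0.
move: mr; rewrite lt_min => /andP[m1 m2].
have nmm : nm ((y + (m%:C)%C) - y) = m by rewrite addrC addKr nm_real ger0_norm// ltW.
have yn : y + (m%:C)%C != y.
  by rewrite -subr_eq0 -nm_eq0 nmm gt_eqF.
rewrite -(hg (y + (m%:C)%C)) ?nmm//; apply/ltW/hr.
by rewrite nmB nmm.
Qed.

(* h y and h' (s / y) are the residues of f at two poles swapped by x -> s / x. *)
Lemma residue_reflection (f A B h h' : C -> C) (s y : C) (E : seq C) (d d' : R) :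
  s != 0 -> y != 0 -> 0 < d -> 0 < d' ->
  {for y, continuous A} -> {for y, continuous B} ->
  {for y, continuous h} -> {for s / y, continuous h'} ->
  (forall x, nm (x - y) < d -> x != y -> f x = h x / (x - y)) ->
  (forall x, nm (x - s / y) < d' -> x != s / y -> f x = h' x / (x - s / y)) ->
  (forall x, x \notin E -> x != 0 -> f (s / x) * A x = - f x * B x) ->
  h' (s / y) * (y ^+ 2 / s) * A y = h y * B y.
Proof.
move=> s0 y0 d0 d0' Ac Bc hc hc' hf hf' hE.
have sc : {for y, continuous (fun x => s / x)}.
  by apply: continuousM; [exact: cst_continuous|exact: inv_continuous].
have hsc : {for y, continuous (fun x => h' (s / x))}.
  exact: (cvg_comp _ _ sc hc').
have xc : {for y, continuous (fun x : C => x * (y / s))}.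
  by apply: continuousM; [exact: cvg_id|exact: cst_continuous].
(* The identity to prove is g(y) = 0; [g] is continuous and vanishes near [y]. The factor x y/s
   comes from s/x - s/y = -s (x - y)/(x y). *)
pose g x := h' (s / x) * (x * (y / s)) * A x - h x * B x.
have gc : {for y, continuous g}.
  have c1 := @continuousM _ _ _ _ y hsc xc; have c2 := @continuousM _ _ _ _ y c1 Ac.
  have c3 := @continuousM _ _ _ _ y hc Bc.
  exact: (@continuousB _ _ _ _ _ y c2 c3).
have [e1 e10 he1] := near_notin (0 :: E) y.
have /near_nmP[e2 e20 he2] : \forall x \near y, nm (s / y - s / x) < d'.
  by have /(@cvg_nmP R C (nbhs y) _ (fun x => s / x) (s / y))/(_ _ d0') := sc.
have : g y = 0.
  apply: (@continuous_punctured_eq0 g y (Num.min d (Num.min e1 e2))) => //.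
    by rewrite !lt_min d0 e10.
  move=> x; rewrite !lt_min => /and3P[x1 x2 x3] xy.
  have := he1 x x2 xy; rewrite inE negb_or => /andP[x0 xE].
  have := hE x xE x0; rewrite (hf x x1 xy) hf'; last 2 first.
  - by rewrite nmB he2// nmB.
  - by rewrite (inj_eq (mulfI s0)) (inj_eq invr_inj).
  have xy' : x - y != 0 by rewrite subr_eq0.
  have -> : s / x - s / y = - (s * (x - y) / (x * y)) by field; rewrite x0 y0.
  rewrite /g; move: (h' _) (h x) (A x) (B x) => H' H a b e.
  have : (H' / - (s * (x - y) / (x * y)) * a) * - (x - y) = (- (H / (x - y)) * b) * - (x - y).
    by rewrite e.
  have -> : (H' / - (s * (x - y) / (x * y)) * a) * - (x - y) = H' * (x * (y / s)) * a.
    by field; rewrite x0 y0 s0 xy'.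
  have -> : (- (H / (x - y)) * b) * - (x - y) = H * b by field.
  by move=> ->; rewrite subrr.
rewrite /g => /eqP; rewrite subr_eq0 => /eqP <-.
by rewrite expr2 !mulrA.
Qed.
End ResidueReflection.

(** * Recursion for the weights along the chain *)

Section Weights.
Variables (R : realType) (t : par R).
Local Notation C := (cplx R).
Implicit Types (x y : C).
Local Notation q := (qq t).
Local Notation td := (dual_par t).
Hypotheses (ht : generic_par t)
  (hpole : forall y, sigma' t y -> has_simple_pole (Delta td) y).

Let ag := alg_generic_of ht.
Let q1 : nm (qq td) < 1 := generic_nmq ht.
Let nzd : par_neq0 td. Proof. by case: (generic_neq0 ht). Qed.
Let nz_qh : qh t != 0. Proof. by case: nzd. Qed.
Let nz_q : q != 0. Proof. exact: expf_neq0. Qed.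
Let pd0 e : e \in pabcd td -> e != 0.
Proof.
case: nzd => /= h1 h2 h3 h4 h5.
by rewrite !inE => /or4P[] /eqP ->; rewrite /pa /pb /pc /pd /= ?oppr_eq0 !mulf_neq0 ?invr_neq0.
Qed.

Definition weightb r : C := weight t (lamb t r)^-1.

Lemma sigma'_lamb r : sigma' t (lamb t r)^-1.
Proof. by exists (unrank r). Qed.

(** [h y] is the residue of [Delta], whereas the weight uses that of Delta(z)/z with a sign; hence
    the factor [y] and the power of -1, which is the sign attached to rank r. *)
Lemma weightb_pole r : let y := (lamb t r)^-1 in
  exists (h : C -> C) (d : R), [/\ 0 < d, h y != 0, {for y, continuous h},
    forall x, nm (x - y) < d -> x != y -> Delta td x = h x / (x - y) &
    h y = (-1) ^+ odd r * weightb r * y].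
Proof.
move=> y; have l0 := lamb_neq0 ag r; have y0 : y != 0 by rewrite invr_eq0.
have [h [d [d0 hy hc hf hr]]] := simple_poleP y0 (hpole (sigma'_lamb r)).
exists h, d; split=> //; rewrite /weightb /weight (sigma'_index_lamb ag) hr.
have -> : (epsi (unrank r))%:~R = (-1) ^+ odd r :> C.
  by rewrite /unrank /epsi; case: (odd r).
by rewrite mulrA -exprD addnn -muln2 mulnC exprM sqrrN expr1n expr1n mul1r divfK.
Qed.

Lemma weightb_neq0 r : weightb r != 0.
Proof.
have [h [d [_ hy _ _ hr]]] := weightb_pole r.
by move: hy; rewrite hr !mulf_eq0 !negb_or => /andP[/andP[]].
Qed.

Lemma quadratic_continuous (a b u v : C) y :
  {for y, continuous (fun x => (a + u * x) * (b + v * x))}.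
Proof.
have lin (z w : C) : {for y, continuous (fun x => z + w * x)}.
  have c1 : {for y, continuous (fun x : C => w * x)} by exact: mulrl_continuous.
  have c2 : {for y, continuous (fun=> z)} by exact: cst_continuous.
  exact: (@continuousD _ _ _ _ _ y c2 c1).
exact: (@continuousM _ _ _ _ y (lin a u) (lin b v)).
Qed.

(** The residue form of [Delta_inv] at 1/l, whose image l is the inverse of the next point of the
    chain; the sign in the weight changes between the two ranks. *)
Lemma weightb_odd r : odd r -> let l := lamb t r in
  weightb r * ((l - pa td) * (l - pb td)) =
  - weightb r.+1 * ((1 - pa td * l) * (1 - pb td * l)).
Proof.
move=> ro l; have l0 : l != 0 := lamb_neq0 ag r.
have ln : lamb t r.+1 = l^-1 by exact: lamb_odd_next.
have [h [d [d0 hy hcont hf hr]]] := weightb_pole r.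
have [h' [d' [d0' hy' hcont' hf' hr']]] := weightb_pole r.+1.
rewrite -/l in hcont hf hr hy; rewrite ln invrK in hcont' hf' hr' hy'.
have li : 1 / l^-1 = l by rewrite div1r invrK.
have := @residue_reflection R (Delta td) (fun x => (- pa td + 1 * x) * (- pb td + 1 * x))
  (fun x => (1 + - pa td * x) * (1 + - pb td * x)) h h' 1 l^-1
  [:: 1; -1; (pa td)^-1; (pb td)^-1; pa td; pb td] d d' (oner_neq0 _) (invr_neq0 l0) d0 d0'
  (@quadratic_continuous _ _ _ _ _) (@quadratic_continuous _ _ _ _ _) hcont.
rewrite li => /(_ hcont' hf hf') H.
have := H _; rewrite hr hr' /= ro /= => {}H.
have ia : pa td != 0 by exact: (pd0 (pa_in _)).
have ib : pb td != 0 by exact: (pd0 (pb_in _)).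
have : 1 * weightb r.+1 * l * (l^-1 ^+ 2 / 1) * ((- pa td + 1 / l) * (- pb td + 1 / l)) =
  -1 * weightb r / l * ((1 + - pa td / l) * (1 + - pb td / l)).
  apply: H => x; rewrite !inE !negb_or => /and5P[x1 x2 x3 x4 /andP[x5 x6]] x0.
  have xe (e : C) : e != 0 -> x != e^-1 -> 1 - e * x != 0.
    move=> e0; apply: contra_neq => /eqP; rewrite subr_eq0 => /eqP E.
    by apply: (mulfI e0); rewrite -E divff.
  rewrite div1r !mul1r ![- _ + x]addrC [- pa td * x]mulNr [- pb td * x]mulNr.
  apply: (Delta_inv q1 x0); rewrite ?xe// ?subr_eq0//.
  by rewrite sqrf_eq1 negb_or x1.
move: (weightb r) (weightb r.+1) (pa td) (pb td) => w w' a b.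
move=> E; have := congr1 (fun z => - z * l ^+ 3) E.
have -> : - (1 * w' * l * (l^-1 ^+ 2 / 1) * ((- a + 1 / l) * (- b + 1 / l))) * l ^+ 3 =
  - w' * ((1 - a * l) * (1 - b * l)) by field.
by move=> ->; field.
Qed.

Lemma weightb_even r : ~~ odd r -> let l := lamb t r in
  q * weightb r * ((1 - pc td * l) * (1 - pd td * l)) =
  - weightb r.+1 * ((q * l - pc td) * (q * l - pd td)).
Proof.
move=> re l; have l0 : l != 0 := lamb_neq0 ag r.
have ln : lamb t r.+1 = (q * l)^-1 by exact: lamb_even_next.
have [h [d [d0 hy hcont hf hr]]] := weightb_pole r.
have [h' [d' [d0' hy' hcont' hf' hr']]] := weightb_pole r.+1.
rewrite -/l in hcont hf hr hy; rewrite ln invrK in hcont' hf' hr' hy'.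
have li : q / l^-1 = q * l by rewrite invrK.
have := @residue_reflection R (Delta td) (fun x => (q + - pc td * x) * (q + - pd td * x))
  (fun x => (- pc td * q + q * x) * (- pd td + 1 * x)) h h' q l^-1
  [:: qh t; - qh t; q / pc td; q / pd td; pc td; pd td] d d' nz_q (invr_neq0 l0) d0 d0'
  (@quadratic_continuous _ _ _ _ _) (@quadratic_continuous _ _ _ _ _) hcont.
rewrite li => /(_ hcont' hf hf') H.
have := H _; rewrite hr hr' /= (negPf re) /= => {}H.
have ic : pc td != 0 by exact: (pd0 (pc_in _)).
have id : pd td != 0 by exact: (pd0 (pd_in _)).
have : -1 * weightb r.+1 * (q * l) * (l^-1 ^+ 2 / q) * ((q + - pc td / l) * (q + - pd td / l)) =
  1 * weightb r / l * ((- pc td * q + q / l) * (- pd td + 1 / l)).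
  apply: H => x; rewrite !inE !negb_or => /and5P[x1 x2 x3 x4 /andP[x5 x6]] x0.
  have xe (e : C) : e != 0 -> x != q / e -> q - e * x != 0.
    move=> e0; apply: contra_neq => /eqP; rewrite subr_eq0 => /eqP ->.
    by rewrite mulrAC divff// mul1r.
  rewrite mul1r ![- _ + x]addrC [- pc td * x]mulNr [- pd td * x]mulNr.
  rewrite [- pc td * q]mulrC -mulrDr [- pc td + x]addrC -mulrA.
  apply: (Delta_qinv nzd q1 x0 _ _ _ (xe _ ic x3) (xe _ id x4)); rewrite subr_eq0//.
  by rewrite eq_sym eqf_sqr negb_or x1.
move: (weightb r) (weightb r.+1) (pc td) (pd td) nz_q => w w' a b; move: (q : C) => p p0.
move=> E; have := congr1 (fun z => z * l ^+ 3) E.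
have -> : (-1 * w' * (p * l) * (l^-1 ^+ 2 / p) * ((p + - a / l) * (p + - b / l))) * l ^+ 3 =
  - w' * ((p * l - a) * (p * l - b)) by field; rewrite p0 l0.
by move=> ->; field.
Qed.
End Weights.

(** * The Fourier transforms *)

Section NormWeight.
Variables (R : realType) (t : par R) (c : R -> cplx R).
Local Notation C := (cplx R).
Implicit Types (f g h : laurent R) (x : C).
Hypotheses (ht : generic_par t) (hc : admissible_contour t c)
  (hpole : forall y, sigma' t y -> has_simple_pole (Delta (dual_par t)) y).
Local Notation q := (qq t).
Local Notation t' := (inv_par t).
Local Notation td := (dual_par t).
Local Notation N := (norm_form t c).
Local Notation W := (weightb t).

Let ag := alg_generic_of ht.
Let nz := generic_neq0 ht.

(** The factors [p] and [s] of the norm recursion are those of the weight recursion, so they cancel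
    in the product. *)
Lemma norm_weightS_alg (F : fieldType) (n n' w w' p s k : F) : k != 0 -> p != 0 ->
  k^-1 * p * n' = - (k^-1 * s * n) -> w * p = - (w' * s) -> n' * w' = n * w.
Proof.
move=> k0 p0 h1 h2; apply: (mulIf (mulf_neq0 (invr_neq0 k0) p0)).
have -> : n' * w' * (k^-1 * p) = (k^-1 * p * n') * w' by ring.
have -> : n * w * (k^-1 * p) = n * k^-1 * (w * p) by ring.
by rewrite h1 h2; ring.
Qed.

Lemma norm_weightS r : N r.+1 * W r.+1 = N r * W r.
Proof.
have [h1 h2 h3 h4 h5] := nz; set l := lamb t r.
have q0 : q != 0 by exact: expf_neq0.
have [ro|re] := boolP (odd r).
  have ia : pa td != 0 by rewrite /pa /= mulf_neq0.
  have ib : pb td != 0 by rewrite /pb /= oppr_eq0 mulf_neq0 ?invr_eq0.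
  have ea := lamb_odd_ne1 ag ro ia (mem_head _ _).
  have eb : 1 - l / pb td != 0 by exact: (lamb_odd_ne1 ag ro ib (pb_in _)).
  (* This product converts the factors l - e of the weight recursion into the factors 1 - l/e of the
     norm recursion. *)
  have ab : pa td * pb td = - k1 t ^+ 2 by rewrite /pa /pb /=; field.
  have la (e : C) : e != 0 -> l - e = - e * (1 - l / e) by move=> e0; field.
  apply: (@norm_weightS_alg _ _ _ _ _ ((l - pa td) * (l - pb td))
    ((1 - pa td * l) * (1 - pb td * l)) (k1 t)) => //.
  - by rewrite !la//; apply: mulf_neq0; apply: mulf_neq0; rewrite 1?oppr_eq0.
  - have -> : (l - pa td) * (l - pb td) = - k1 t ^+ 2 * ((1 - l / pa td) * (1 - l / pb td)).
      by rewrite -ab !la// mulrACA mulrNN.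
    have h : k1 t * (1 - l / pa td) * (1 - l / pb td) * N r.+1 =
      (k1 t)^-1 * (1 - pa td * l) * (1 - pb td * l) * N r := norm_form_odd ht hc ro.
    rewrite [in RHS](mulrA (k1 t)^-1) -h.
    by move: (1 - l / pa td) (1 - l / pb td) (N _) => a b n; field.
  - by rewrite (weightb_odd ht hpole ro) mulNr.
have ic : pc td != 0 by rewrite /pc /= !mulf_neq0.
have id : pd td != 0 by rewrite /pd /= oppr_eq0 !mulf_neq0 ?invr_eq0.
have ec : 1 - pc td * l != 0 by exact: (lamb_even_ne1 ag re (pc_in _)).
have ed : 1 - pd td * l != 0 by exact: (lamb_even_ne1 ag re (pd_in _)).
have cd : pc td * pd td = - q * u1 t ^+ 2 by rewrite /pc /pd /qq /=; field.
have la (e : C) : e != 0 -> q * l - e = - e * (1 - q * l / e) by move=> e0; field.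
apply: (@norm_weightS_alg _ _ _ _ _ (q * ((1 - pc td * l) * (1 - pd td * l)))
    ((q * l - pc td) * (q * l - pd td)) (u1 t)) => //.
- by apply: mulf_neq0 => //; apply: mulf_neq0.
- have -> : (q * l - pc td) * (q * l - pd td) =
    - q * u1 t ^+ 2 * ((1 - q * l / pc td) * (1 - q * l / pd td)).
    by rewrite -cd !la// mulrACA mulrNN.
  have h : (u1 t)^-1 * (1 - pc td * l) * (1 - pd td * l) * N r.+1 =
    u1 t * (1 - q * l / pc td) * (1 - q * l / pd td) * N r := norm_form_even ht hc re.
  have -> : (u1 t)^-1 * (q * ((1 - pc td * l) * (1 - pd td * l))) * N r.+1 =
    q * ((u1 t)^-1 * (1 - pc td * l) * (1 - pd td * l) * N r.+1) by ring.
  rewrite h; move: (1 - q * l / pc td) (1 - q * l / pd td) (N r) => a b n.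
  by move: (q : C) => p; field.
- by rewrite mulrCA mulrA (weightb_even ht hpole re) mulNr.
Qed.

Lemma norm_weight r : N r * W r = N 0 * W 0.
Proof. by elim: r => [|r IH]; [reflexivity|rewrite norm_weightS; exact: IH]. Qed.

Lemma norm_form0 : N 0 = aw_form t c (lone R) (lone R).
Proof. by rewrite /norm_form !Eb0. Qed.

Lemma form_lcomb (a : nat -> C) n g :
  aw_form t c (lcomb a (Eb t) n) g = \sum_(i < n) a i * aw_form t c (Eb t i) g.
Proof.
elim: n => [|n IH].
  by rewrite big_ord0 /= -(lsc0 (lone R)) (form_scl ht hc) mul0r.
by rewrite big_ord_recr /= (form_adl ht hc) IH (form_scl ht hc).
Qed.

Lemma form_lcomb_Eb (a : nat -> C) n r :
  aw_form t c (lcomb a (Eb t) n) (Eb t' r) = if (r < n)%N then a r * N r else 0.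
Proof.
rewrite form_lcomb; case: ifP => rn.
  rewrite (bigD1 (Ordinal rn))//= big1 ?addr0// => i ir.
  by rewrite (biorthogonal ht hc) ?mulr0.
rewrite big1// => i _; rewrite (biorthogonal ht hc) ?mulr0//.
by apply/eqP => e; move: rn; rewrite -e ltn_ord.
Qed.

Lemma norm_form_neq0 r : N r != 0.
Proof.
suff n0 : N 0 != 0.
  have := norm_weight r => e; apply: contra_neq n0 => nr.
  move: e; rewrite nr mul0r => /esym/eqP; rewrite mulf_eq0 (negPf (weightb_neq0 ht hpole 0)) orbF.
  by move/eqP.
apply/eqP => n0; apply: (form_nondegenerate ht hc) => f.
have [n [a ->]] := Eb_expand ag f.
by rewrite -(Eb0 t') form_lcomb_Eb n0 mulr0; case: ifP.
Qed.
End NormWeight.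

(** * The points of the dual spectrum and finitely supported functions *)

Section Assembly.
Variables (R : realType) (t : par R) (c : R -> cplx R).
Local Notation C := (cplx R).
Implicit Types (f g h : laurent R) (x : C).
Hypotheses (ht : generic_par t) (hc : admissible_contour t c)
  (hpole : forall y, sigma' t y -> has_simple_pole (Delta (dual_par t)) y).
Local Notation t' := (inv_par t).
Local Notation N := (norm_form t c).
Local Notation W := (weightb t).

Let ag := alg_generic_of ht.
Let ag' := alg_generic_inv ht.

Lemma Epol'_Eb r : Epol' t (lamb t r)^-1 = Eb t' r.
Proof.
rewrite /Epol' (sigma'_index_lamb ag) /Ppol'; have [b b0 ->] := Ppol_eigf ag' r.
have -> : k1 t * u1 t = evpt t' by rewrite /evpt /= !invrK.
by rewrite -levE -lscE lev_sc lscA invfM mulrAC mulVf// mul1r.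
Qed.

(** The dual spectrum enumerated by rank: finite support becomes eventual vanishing, and the inverse
    transform becomes a combination of the first [Eb]. *)
Definition spec_pt r : sigma' t := SigSub (mem_set (sigma'_lamb t r)).

Lemma spec_ptE r : set_val (spec_pt r) = (lamb t r)^-1.
Proof. by rewrite set_valE. Qed.

Lemma spec_pt_surj (y : sigma' t) : exists r, y = spec_pt r.
Proof.
have [m _ hm] := set_valP y; exists (mrank m).
by apply: val_inj; rewrite /= -hm /gam' /lamb mrankK.
Qed.

Lemma spec_pt_inj : injective spec_pt.
Proof.
move=> r s /(congr1 set_val); rewrite !spec_ptE => /invr_inj; exact: (lamb_inj ag).
Qed.

Lemma fourier_spec f r : fourier t c f (spec_pt r) = aw_form t c f (Eb t' r).
Proof. by rewrite /fourier spec_ptE Epol'_Eb. Qed.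

Lemma fin_suppP (g : sigma' t -> C) :
  fin_supp t g <-> exists n, forall r, (n <= r)%N -> g (spec_pt r) = 0.
Proof.
split=> [/finite_seqP[s hs]|[n hn]].
  have [n hn] : exists n, forall r, spec_pt r \in s -> (r < n)%N.
    elim: s {hs} => [|y s [n hn]]; first by exists 0%N.
    have [m ->] := spec_pt_surj y; exists (maxn m.+1 n) => r.
    rewrite inE leq_max => /orP[/eqP/spec_pt_inj ->|/hn ->]; last by rewrite orbT.
    by rewrite ltnSn.
  exists n => r nr; apply/eqP; apply: contraTT nr => gr; rewrite -ltnNge; apply: hn.
  by have : [set y | g y != 0] (spec_pt r) by []; rewrite hs.
apply: (@sub_finite_set _ _ [set` [seq spec_pt i | i <- iota 0 n]]); last exact: finite_seq.
move=> y; have [r ->] := spec_pt_surj y => /= gr; apply: map_f.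
by rewrite mem_iota /= add0n ltnNge; apply: contraNN gr => /hn ->.
Qed.

Lemma inv_fourier_lcomb (g : sigma' t -> C) n : (forall r, (n <= r)%N -> g (spec_pt r) = 0) ->
  inv_fourier t g = lcomb (fun r => g (spec_pt r) * W r) (Eb t) n.
Proof.
move=> gn; rewrite /inv_fourier.
rewrite (@fsbigE _ _ _ _ _ [seq spec_pt i | i <- iota 0 n]); last 3 first.
- by rewrite (map_inj_uniq spec_pt_inj) iota_uniq.
- by [].
- move=> y _; have [r ->] := spec_pt_surj y.
  rewrite (mem_map spec_pt_inj) mem_iota /= add0n -leqNgt => /gn ->.
  by rewrite mul0r -lscE lsc0.
rewrite (eq_bigl xpredT); last by move=> y; rewrite in_setT.
rewrite big_map (_ : iota 0 n = index_iota 0 n); last by rewrite /index_iota subn0.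
elim: n {gn} => [|n IH]; first by rewrite big_nil.
rewrite big_nat_recr//= IH lad.unlock; congr (_ + _).
by rewrite -lscE spec_ptE invrK (Epol_Eb ag).
Qed.
End Assembly.

Theorem theorem11p5 (R : realType) (t : par R) (c : R -> cplx R)
    (ht : generic_par t)
    (hpole : forall y, sigma' t y -> has_simple_pole (Delta (dual_par t)) y)
    (hc : admissible_contour t c) :
  let ctq := weight t (gam t 0)^-1 * aw_form t c (lone R) (lone R) in
  [/\ forall f : laurent R, fin_supp t (fourier t c f),
      forall f : laurent R, inv_fourier t (fourier t c f) = ctq *: f,
      forall g : sigma' t -> cplx R, fin_supp t g ->
        forall y : sigma' t, fourier t c (inv_fourier t g) y = ctq * g y &
      forall y : cplx R, sigma t y ->
        aw_form t c (Epol t y) (Epol' t y^-1) / aw_form t c (lone R) (lone R) =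
        weight t (gam t 0)^-1 / weight t y^-1].
Proof.
move=> ctq; have ag := alg_generic_of ht.
(* The constant can be evaluated at any rank: on E_r the two transforms multiply by N_r and by
   W_r. *)
have ctqE r : ctq = norm_form t c r * weightb t r.
  by rewrite (norm_weight ht hc hpole r) norm_form0 mulrC.
have F0 f : exists n a, f = lcomb a (Eb t) n /\
    forall r, fourier t c f (spec_pt t r) = if (r < n)%N then a r * norm_form t c r else 0.
  have [n [a ->]] := Eb_expand ag f; exists n, a; split=> // r.
  by rewrite (fourier_spec _ ht) (form_lcomb_Eb ht hc).
split.
- move=> f; have [n [a [_ h]]] := F0 f; apply/(fin_suppP ht); exists n => r nr.
  by rewrite h ltnNge nr.
- move=> f; have [n [a [fE h]]] := F0 f.
  rewrite (@inv_fourier_lcomb _ _ ht _ n); last by move=> r nr; rewrite h ltnNge nr.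
  rewrite -lscE; apply: lcoP => k; rewrite lco_sc {2}fE !lco_comb mulr_sumr.
  by apply: eq_bigr => i _; rewrite h ltn_ord (ctqE i); ring.
- move=> g /(fin_suppP ht)[n gn] y; have [r ->] := spec_pt_surj y.
  rewrite (inv_fourier_lcomb ht gn) (fourier_spec _ ht) (form_lcomb_Eb ht hc).
  case: ltnP => [_|/gn ->]; last by rewrite mulr0.
  by rewrite (ctqE r); ring.
- move=> _ [m _ <-]; have -> : gam t m = lamb t (mrank m) by rewrite /lamb mrankK.
  move: (mrank m) => r; rewrite (Epol_Eb ag) (Epol'_Eb ht) -/(norm_form t c r).
  have n0 := norm_form_neq0 ht hc hpole 0; rewrite -norm_form0.
  have w0 : weight t (lamb t r)^-1 != 0 := weightb_neq0 ht hpole r.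
  apply: (mulIf n0); rewrite divfK//; apply: (mulIf w0).
  rewrite [RHS]mulrAC divfK//.
  have := norm_weight ht hc hpole r; rewrite /weightb => ->.
  by rewrite mulrC.
Qed.
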